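(* Let $m>2$, let $\varphi=\{\varphi_1,\dots,\varphi_m\}$ and $\psi=\{\psi_1,\dots,\psi_m\}$ be structural sets in $\mathbb{R}^m$, let $\mu>0$ and $\lambda>-\frac23\mu$, and let $\Omega\subset\mathbb{R}^m$ be a bounded simply connected domain (its boundary may be fractal). Put $\Omega_+=\Omega$, $\Omega_-=\mathbb{R}^m\setminus\overline{\Omega}$. Let $m-1<d<m$, let $\partial\Omega$ be $d$-summable, let $0<\nu<1$ with $\nu>\frac{d}{m}$, let $f\in\mathrm{Lip}(1+\nu,\partial\Omega)$ be $\mathbb{R}_{0,m}$-valued, and let $\tilde f$ be its Whitney extension to $\mathbb{R}^m$. Then the jump problem $$\begin{cases} {}^{\varphi,\psi}\mathcal{L}_{\underline{x}}F(\underline{x})=0, & \underline{x}\in\Omega_+\cup\Omega_-,\\ [F]^+(\underline{x})-[F]^-(\underline{x})=f(\underline{x}), & \underline{x}\in\partial\Omega,\\ [\mathcal{M}F]^+(\underline{x})-[\mathcal{M}F]^-(\underline{x})=(\mathcal{M}\tilde f)(\underline{x}), & \underline{x}\in\partial\Omega,\\ F(\infty)=(\mathcal{M}F)(\infty)=0 \end{cases}$$ has a solution given by $$F(\underline{x})=\tilde f(\underline{x})\chi_\Omega(\underline{x})-\mathcal{T}^\dagger_{\varphi,\psi}\big({}^{\varphi,\psi}\mathcal{L}_{\underline{x}}\tilde f\big)(\underline{x}),$$ where $\chi_\Omega$ is the characteristic function of $\Omega$.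
   Context: Clifford algebra. $\mathbb{R}_{0,m}$ is the $2^m$-dimensional real associative unital Clifford algebra generated by the standard basis $e_1,\dots,e_m$ of $\mathbb{R}^m$ with $e_ie_j+e_je_i=-2\delta_{i,j}$. A point $(x_1,\dots,x_m)\in\mathbb{R}^m$ is identified with the vector $\underline{x}=\sum_j x_je_j\in\mathbb{R}_{0,m}$. The norm on $\mathbb{R}_{0,m}$ is the Euclidean norm of the coefficients in the basis $(e_A)$. Continuity, differentiability and integrability of $\mathbb{R}_{0,m}$-valued functions are understood componentwise. Structural sets and operators. A structural set $\varphi=\{\varphi_1,\dots,\varphi_m\}$ is an (ordered) orthonormal basis of $\mathbb{R}^m$, its elements being viewed as vectors in $\mathbb{R}_{0,m}$. For $\underline{x}=\sum_j x_je_j$ put $\underline{x}_\varphi=\sum_j x_j\varphi_j$. The operator ${}^{\varphi}\partial_{\underline{x}}=\sum_j\varphi_j\partial_{x_j}$ acts from the left by ${}^{\varphi}\partial_{\underline{x}}f=\sum_j\varphi_j\,\partial_{x_j}f$ and from the right by $f\,{}^{\varphi}\partial_{\underline{x}}=\sum_j(\partial_{x_j}f)\,\varphi_j$; likewise for $\psi$. With $\mu,\lambda$ the Lamé parameters, $${}^{\varphi,\psi}\mathcal{L}_{\underline{x}}f=\frac{\mu+\lambda}{2}\,{}^{\varphi}\partial_{\underline{x}}f\,{}^{\psi}\partial_{\underline{x}}+\frac{3\mu+\lambda}{2}\,{}^{\varphi}\partial_{\underline{x}}{}^{\psi}\partial_{\underline{x}}f,\qquad \mathcal{M}f=\frac{\mu+\lambda}{2}\,f\,{}^{\psi}\partial_{\underline{x}}+\frac{3\mu+\lambda}{2}\,{}^{\psi}\partial_{\underline{x}}f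 .$$ Teodorescu transform. $\sigma_m$ is the surface area of the unit sphere of $\mathbb{R}^m$, $E_1(\underline{x})=\dfrac{1}{(m-2)\sigma_m\|\underline{x}\|^{m-2}}$, $K_\varphi(\underline{x})=-\dfrac{1}{\sigma_m}\dfrac{\underline{x}_\varphi}{\|\underline{x}\|^m}$. For $g:\Omega\to\mathbb{R}_{0,m}$ and $\underline{x}\in\mathbb{R}^m$, $$(\mathcal{T}_{\varphi,\psi}g)(\underline{x})=-\frac12\left(\int_{\Omega}(\underline{y}_\psi-\underline{x}_\psi)K_\varphi(\underline{y}-\underline{x})g(\underline{y})\,d\underline{y}+\sum_{j=1}^m\int_{\Omega}\psi_j\varphi_jE_1(\underline{y}-\underline{x})g(\underline{y})\,d\underline{y}\right),$$ $$(\mathcal{T}^{\mathsf{infra}}_{\varphi,\psi}g)(\underline{x})=-\frac12\left(\int_{\Omega}K_\varphi(\underline{y}-\underline{x})g(\underline{y})(\underline{y}_\psi-\underline{x}_\psi)\,d\underline{y}+\sum_{j=1}^m\varphi_j\int_{\Omega}E_1(\underline{y}-\underline{x})g(\underline{y})\,d\underline{y}\,\psi_j\right),$$ $$\mathcal{T}^\dagger_{\varphi,\psi}g=-\frac{\mu+\lambda}{2\mu(2\mu+\lambda)}\,\mathcal{T}^{\mathsf{infra}}_{\varphi,\psi}g+\frac{3\mu+\lambda}{2\mu(2\mu+\lambda)}\,\mathcal{T}_{\varphi,\psi}g .$$ $d$-summability. $\partial\Omega$ is $d$-summable if the improper integral $\int_0^1N_{\partial\Omega}(\tau)\,\tau^{d-1}\,d\tau$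 converges, where $N_{\partial\Omega}(\tau)$ is the minimal number of balls of radius $\tau$ needed to cover $\partial\Omega$. Higher order Lipschitz class and Whitney extension. $f\in\mathrm{Lip}(1+\nu,\partial\Omega)$ means (componentwise, in the sense of Whitney) that $f$ comes with a jet $\{f,f^{\mathbf j}:|\mathbf j|=1\}$ of bounded functions on $\partial\Omega$ for which there is a constant $C$ with $\|f(\underline{x})-f(\underline{y})-\sum_{|\mathbf j|=1}f^{\mathbf j}(\underline{y})(\underline{x}-\underline{y})^{\mathbf j}\|\le C\|\underline{x}-\underline{y}\|^{1+\nu}$ and $\|f^{\mathbf j}(\underline{x})-f^{\mathbf j}(\underline{y})\|\le C\|\underline{x}-\underline{y}\|^{\nu}$ for all $\underline{x},\underline{y}\in\partial\Omega$, $|\mathbf j|=1$. Its Whitney extension $\tilde f:\mathbb{R}^m\to\mathbb{R}_{0,m}$ is a $C^{1,\nu}$ function on $\mathbb{R}^m$, of class $C^\infty$ on $\mathbb{R}^m\setminus\partial\Omega$, with $\tilde f=f$ and $\partial^{\mathbf j}\tilde f=f^{\mathbf j}$ ($|\mathbf j|=1$) on $\partial\Omega$, and satisfying for some constant $c$ $$\|\partial^{\mathbf j}_{\underline{x}}\tilde f(\underline{x})\|\le c\,[\mathrm{dist}(\underline{x},\partial\Omega)]^{\nu-1},\qquad |\mathbf j|=2,\ \underline{x}\in\mathbb{R}^m\setminus\partial\Omega .$$ Jump problem. $[G]^{\pm}(\underline{x})$ denotes the limit of $G(\underline{z})$ as $\underline{z}\to\underline{x}\in\partial\Omega$ with $\underline{z}\in\Omega_\pm$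 (for a solution $F$ these limits are required to exist for $G=F$ and $G=\mathcal{M}F$). $G(\infty)=0$ means $G(\underline{x})\to0$ as $\|\underline{x}\|\to\infty$. *)

(* Defs.v *)
From HB Require Import structures.
From mathcomp Require Import all_boot all_order all_algebra.
From mathcomp Require Import all_classical all_reals all_analysis.

Set Implicit Arguments.
Unset Strict Implicit.
Unset Printing Implicit Defensive.

Import Order.TTheory GRing.Theory Num.Theory.
Import numFieldNormedType.Exports.

Local Open Scope classical_set_scope.
Local Open Scope ring_scope.

Definition symd (m : nat) (A B : {set 'I_m}) : {set 'I_m} :=
  [set i | (i \in A) (+) (i \in B)]%SET.

(* Up to the sign cl_sgn, e_A e_B is the blade on the symmetric difference of A
   and B: each pair i in A, j in B with j < i costs a transposition, and each
   i in both A and B contributes the factor e_i ^ 2 = -1. *)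
Definition cl_sgn (m : nat) (A B : {set 'I_m}) : nat :=
  (\sum_(i in A) \sum_(j in B) (j <= i))%N.

(* Coefficients in the basis (e_A), A ranging over the subsets of 'I_m. *)
Definition clifford (R : Type) (m : nat) : Type := {ffun {set 'I_m} -> R}.

Section CliffordSign.
Variable m : nat.
Implicit Types A B C : {set 'I_m}.

Lemma symdA : associative (@symd m).
Proof. by move=> A B C; apply/setP => i; rewrite !inE addbA. Qed.

Lemma symdC : commutative (@symd m).
Proof. by move=> A B; apply/setP => i; rewrite !inE addbC. Qed.

Lemma symdK A : involutive (symd A).
Proof. by move=> B; apply/setP => i; rewrite !inE addbA addbb. Qed.

Lemma symd0 A : symd A finset.set0 = A.
Proof. by apply/setP => i; rewrite !inE addbF. Qed.

Lemma odd_cl_sgn A B : odd (cl_sgn A B) =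
  \big[addb/false]_i \big[addb/false]_j
    [&& i \in A, j \in B & (j <= i)%N].
Proof.
rewrite /cl_sgn (big_morph odd oddD erefl) big_mkcond; apply: eq_bigr => i _.
case: (i \in A); last by rewrite big1.
rewrite (big_morph odd oddD erefl) big_mkcond; apply: eq_bigr => j _.
by case: (j \in B) => //=; rewrite oddb.
Qed.

Lemma odd_cl_sgnDl A B C :
  odd (cl_sgn (symd A B) C) = odd (cl_sgn A C) (+) odd (cl_sgn B C).
Proof.
rewrite !odd_cl_sgn -big_split /=; apply: eq_bigr => i _.
rewrite -big_split /=; apply: eq_bigr => j _; rewrite inE.
by case: (i \in A); case: (_ \in B); case: (_ \in C); case: (_ <= _)%N.
Qed.

Lemma odd_cl_sgnDr A B C :
  odd (cl_sgn A (symd B C)) = odd (cl_sgn A B) (+) odd (cl_sgn A C).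
Proof.
rewrite !odd_cl_sgn -big_split /=; apply: eq_bigr => i _.
rewrite -big_split /=; apply: eq_bigr => j _; rewrite inE.
by case: (i \in A); case: (_ \in B); case: (_ \in C); case: (_ <= _)%N.
Qed.

Lemma cl_sgn0l A : cl_sgn finset.set0 A = 0%N.
Proof. by rewrite /cl_sgn big_set0. Qed.

Lemma cl_sgn0r A : cl_sgn A finset.set0 = 0%N.
Proof. by rewrite /cl_sgn big1// => i _; rewrite big_set0. Qed.

End CliffordSign.

Section CliffordAlgebra.
Variables (R : comNzRingType) (m : nat).
Local Notation Cl := (clifford R m).

HB.instance Definition _ := GRing.Lmodule.copy Cl {ffun {set 'I_m} -> R^o}.

Definition cl_blade (A : {set 'I_m}) : Cl :=
  [ffun C : {set 'I_m} => (C == A)%:R].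

Definition cl_mul (x y : Cl) : Cl :=
  [ffun C : {set 'I_m} => \sum_(A : {set 'I_m})
     (-1) ^+ cl_sgn A (symd A C) * (x A * y (symd A C))].

Lemma cl_mulA : associative cl_mul.
Proof.
move=> x y z; apply/ffunP => D; rewrite !ffunE.
under eq_bigr => A _.
  rewrite ffunE mulr_sumr mulr_sumr.
  over.
under [RHS]eq_bigr => C _.
  rewrite ffunE mulr_suml mulr_sumr.
  over.
rewrite [RHS]exchange_big /=; apply: eq_bigr => A _.
rewrite [RHS](reindex_inj (inv_inj (@symdK m A))) /=; apply: eq_bigr => B _.
rewrite symdK.
have -> : symd (symd A B) D = symd B (symd A D) by rewrite symdA (symdC B).
set E := symd B (symd A D).
have -> : symd A D = symd B E by rewrite /E symdK.
transitivity ((-1) ^+ (cl_sgn A (symd B E) + cl_sgn B E) * (x A * (y B * z E))).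
  by rewrite exprD -!mulrA; congr (_ * _); rewrite mulrCA.
transitivity ((-1) ^+ (cl_sgn A B + cl_sgn (symd A B) E) * (x A * (y B * z E))).
  congr (_ * _); rewrite -signr_odd -[RHS]signr_odd; congr (_ ^+ nat_of_bool _).
  rewrite !oddD odd_cl_sgnDl odd_cl_sgnDr -!addbA; congr (_ (+) _).
by rewrite addnC exprD -!mulrA.
Qed.

Lemma cl_mul1 : left_id (cl_blade finset.set0) cl_mul.
Proof.
move=> x; apply/ffunP => C; rewrite ffunE (bigD1 finset.set0)//= big1 ?addr0.
  by rewrite ffunE eqxx symdC symd0 cl_sgn0l mul1r mul1r.
by move=> A /negPf A0; rewrite ffunE A0 mul0r mulr0.
Qed.

Lemma cl_mulr1 : right_id (cl_blade finset.set0) cl_mul.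
Proof.
move=> x; apply/ffunP => C; rewrite ffunE (bigD1 C)//= big1 ?addr0.
  have -> : symd C C = finset.set0 by apply/setP => i; rewrite !inE addbb.
  by rewrite ffunE eqxx cl_sgn0r mul1r mulr1.
move=> A AC; rewrite ffunE; case: eqVneq => [E|_]; last by rewrite !mulr0.
by rewrite -(symdK A C) E symd0 eqxx in AC.
Qed.

Lemma cl_mulDl : left_distributive cl_mul +%R.
Proof.
move=> x y z; apply/ffunP => C; rewrite !ffunE -big_split; apply: eq_bigr => A _.
by rewrite ffunE /= -mulrDr -mulrDl.
Qed.

Lemma cl_mulDr : right_distributive cl_mul +%R.
Proof.
move=> x y z; apply/ffunP => C; rewrite !ffunE -big_split; apply: eq_bigr => A _.
by rewrite ffunE /= -!mulrDr.
Qed.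

Lemma cl_oner_neq0 : cl_blade finset.set0 != 0.
Proof. by apply/eqP => /ffunP/(_ finset.set0)/eqP; rewrite !ffunE eqxx oner_eq0. Qed.

HB.instance Definition _ := GRing.Zmodule_isNzRing.Build Cl
  cl_mulA cl_mul1 cl_mulr1 cl_mulDl cl_mulDr cl_oner_neq0.

Lemma cl_scaleE (a : R) (x : Cl) A : (a *: x) A = a * x A.
Proof. by rewrite ffunE. Qed.

Lemma cl_scaleAl (a : R) (x y : Cl) : a *: (x * y) = (a *: x) * y.
Proof.
apply/ffunP => C; rewrite cl_scaleE !ffunE mulr_sumr; apply: eq_bigr => A _.
by rewrite cl_scaleE mulrCA !mulrA.
Qed.

Lemma cl_scaleAr (a : R) (x y : Cl) : a *: (x * y) = x * (a *: y).
Proof.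
apply/ffunP => C; rewrite cl_scaleE !ffunE mulr_sumr; apply: eq_bigr => A _.
by rewrite cl_scaleE mulrCA (mulrCA a).
Qed.

HB.instance Definition _ := GRing.Lmodule_isLalgebra.Build R Cl cl_scaleAl.
HB.instance Definition _ := GRing.Lalgebra_isAlgebra.Build R Cl cl_scaleAr.

Lemma cl_bladeM (A B : {set 'I_m}) :
  cl_blade A * cl_blade B = (-1) ^+ cl_sgn A B *: cl_blade (symd A B).
Proof.
apply/ffunP => C; rewrite cl_scaleE !ffunE (bigD1 A)//= big1 ?addr0; last first.
  by move=> D /negPf DA; rewrite ffunE DA mul0r mulr0.
rewrite !ffunE eqxx mul1r.
case: (eqVneq C (symd A B)) => [->|CAB]; first by rewrite symdK eqxx.
by case: eqVneq => [E|_]; [rewrite -E symdK eqxx in CAB | rewrite !mulr0].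
Qed.

Definition cl_e (j : 'I_m) : Cl := cl_blade [set j]%SET.

Lemma cl_e_rel (i j : 'I_m) :
  cl_e i * cl_e j + cl_e j * cl_e i = - (2 * (i == j)%:R)%:A.
Proof.
rewrite /cl_e !cl_bladeM (symdC [set j]%SET) /cl_sgn !big_set1.
have [->|ij] := eqVneq i j.
  rewrite leqnn expr1.
  have -> : symd [set j]%SET [set j]%SET = finset.set0.
    by apply/setP => k; rewrite !inE addbb.
  by rewrite -scalerDl -scaleNr; congr (_ *: _); rewrite mulr1 opprD.
rewrite mulr0 scale0r oppr0 -scalerDl.
have : i != j :> nat by [].
by case: ltngtP => //= _ _; rewrite ?expr0 ?expr1 ?addNr ?subrr scale0r.
Qed.

Lemma cl_blade_rcons (A : {set 'I_m}) (j : 'I_m) :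
  (forall i, i \in A -> (i < j)%N) ->
  cl_blade (j |: A)%SET = cl_blade A * cl_e j.
Proof.
move=> Aj; rewrite cl_bladeM; have -> : cl_sgn A [set j]%SET = 0%N.
  by rewrite /cl_sgn big1// => i /Aj ij; rewrite big_set1 leqNgt ij.
rewrite scale1r; congr cl_blade; apply/setP => i; rewrite !inE addbC.
have [->|//] := eqVneq i j.
by case: (boolP (j \in A)) => // /Aj; rewrite ltnn.
Qed.

End CliffordAlgebra.

Section LebesgueMeasure.
Variable R : realType.
Local Notation T := (measurableTypeR R).

Definition tcons n (p : T * n.-tuple T) : n.+1.-tuple T := [tuple of p.1 :: p.2].

Lemma measurable_tcons n : measurable_fun setT (@tcons n).
Proof. exact: measurable_cons. Qed.

Section Step.
Variables (n : nat) (mu : {sigma_finite_measure set (n.-tuple T) -> \bar R}).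

Definition leb_step : set (n.+1.-tuple T) -> \bar R :=
  pushforward (lebesgue_measure \x mu)%E (@tcons n).

Let mtcons A : measurable A -> measurable (@tcons n @^-1` A).
Proof. by move=> mA; rewrite -[X in measurable X]setTI; exact: measurable_tcons. Qed.

Let leb_step0 : leb_step set0 = 0%E.
Proof. by rewrite /leb_step /pushforward preimage_set0 measure0. Qed.

Let leb_step_ge0 A : (0 <= leb_step A)%E.
Proof. exact: (measure_ge0 (lebesgue_measure \x mu)%E). Qed.

Let leb_step_sigma_additive : semi_sigma_additive leb_step.
Proof.
move=> F mF tF mUF; rewrite /leb_step /pushforward preimage_bigcup.
apply: measure_semi_sigma_additive.
- by move=> k; exact: mtcons.
- apply/trivIsetP => /= i j _ _ ij; rewrite -preimage_setI.
  by move/trivIsetP : tF => /(_ _ _ _ _ ij) ->//; rewrite preimage_set0.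
- by rewrite -preimage_bigcup; exact: mtcons.
Qed.

HB.instance Definition _ := isMeasure.Build _ _ _ leb_step
  leb_step0 leb_step_ge0 leb_step_sigma_additive.

Let tuncons (t : n.+1.-tuple T) : T * n.-tuple T := (thead t, [tuple of behead t]).

Let tconsK : cancel (@tcons n) tuncons.
Proof.
by move=> [x t]; rewrite /tuncons /tcons theadE; congr (_, _); exact/val_inj.
Qed.

Let measurable_tuncons : measurable_fun setT tuncons.
Proof.
apply: measurable_fun_pair; last exact: measurable_behead.
by rewrite /thead; exact: measurable_tnth.
Qed.

Let leb_step_sigma_finite : sigma_finite setT leb_step.
Proof.
have /sigma_finiteP[F [TF ndF Foo]] := sigma_finiteT (@lebesgue_measure R).
have /sigma_finiteP[G [TG ndG Goo]] := sigma_finiteT mu.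
have mFG k : measurable (F k `*` G k).
  by apply: measurableX; [case: (Foo k)|case: (Goo k)].
exists (fun k => tuncons @^-1` (F k `*` G k)).
  rewrite -preimage_bigcup -[LHS](@preimage_setT _ _ tuncons).
  congr (_ @^-1` _); apply/seteqP; split => // -[x y] _.
  have [n1 _ Fx] : (\bigcup_i F i) x by rewrite -TF.
  have [n2 _ Gy] : (\bigcup_i G i) y by rewrite -TG.
  exists (maxn n1 n2) => //; split => /=.
  - by move: x Fx; exact/subsetPset/ndF/leq_maxl.
  - by move: y Gy; exact/subsetPset/ndG/leq_maxr.
move=> k; split.
  by rewrite -[X in measurable X]setTI; exact: measurable_tuncons.
rewrite /leb_step /pushforward -comp_preimage.
rewrite (_ : tuncons \o _ = id); last by apply/funext => p /=; rewrite tconsK.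
rewrite preimage_id product_measure1E//; [|by case: (Foo k)|by case: (Goo k)].
case: (Foo k) => ? ?; case: (Goo k) => ? ?.
by rewrite lte_mul_pinfty// ge0_fin_numE.
Qed.

HB.instance Definition _ := Measure_isSigmaFinite.Build _ _ _ leb_step
  leb_step_sigma_finite.

End Step.

Fixpoint lebesgue_tuple (n : nat) :
    {sigma_finite_measure set (n.-tuple T) -> \bar R} :=
  match n with
  | 0 => [the sigma_finite_measure _ _ of \d_([tuple] : 0.-tuple T)]
  | n'.+1 => [the sigma_finite_measure _ _ of leb_step (lebesgue_tuple n')]
  end.

Lemma lebesgue_tuple_box n (A : 'I_n -> set T) :
  (forall i, measurable (A i)) ->
  lebesgue_tuple n [set t | forall i, A i (tnth t i)] =
  (\prod_(i < n) lebesgue_measure (A i))%E.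
Proof.
elim: n A => [|n IH] A mA /=.
  by rewrite big_ord0 diracE mem_set// => -[].
rewrite big_ord_recl /leb_step /pushforward.
rewrite (_ : _ @^-1` _ =
    A ord0 `*` [set t | forall i, A (lift ord0 i) (tnth t i)]); last first.
  apply/seteqP; split => [[x t] /= h|[x t] /= [h0 h] i].
    split; first by have := h ord0; rewrite (tnth_nth x).
    by move=> i; have := h (lift ord0 i); rewrite tnthS.
  case: (unliftP ord0 i) => [j ->|->]; first by rewrite tnthS; exact: h.
  by rewrite (tnth_nth x).
rewrite product_measure1E//; last first.
  rewrite (_ : [set t | _] =
      \bigcap_(i in [set: 'I_n]) ((@tnth n T)^~ i @^-1` A (lift ord0 i))).
    apply: fin_bigcap_measurable => // i _.
    by rewrite -[X in measurable X]setTI; exact: measurable_tnth.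
  by apply/seteqP; split => [t h i _|t h i]; [exact: h|exact: (h i)].
by congr (_ * _)%E; rewrite -IH.
Qed.

End LebesgueMeasure.

Section Euclidean.
Variables (R : realType) (m : nat).
Local Notation V := 'rV[R]_m.
Local Notation I01 := [set t : R | 0 <= t <= 1].

Definition dotv (x y : V) : R := \sum_(j < m) x 0 j * y 0 j.

(* The norm that 'rV[R]_m carries in the library is the sup norm. *)
Definition enorm (x : V) : R := Num.sqrt (dotv x x).

Definition dist_to (x : V) (A : set V) : R := inf [set enorm (x - y) | y in A].

Definition boundary (A : set V) : set V := closure A `\` A°.

Definition path_connected (A : set V) : Prop :=
  forall x y, A x -> A y -> exists g : R -> V,
    [/\ {within I01, continuous g}, g 0 = x, g 1 = y &
        forall t, I01 t -> A (g t)].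

Definition simply_connected (A : set V) : Prop :=
  path_connected A /\
  forall g : R -> V,
    {within I01, continuous g} -> g 0 = g 1 ->
    (forall t, I01 t -> A (g t)) ->
    exists H : R * R -> V,
      [/\ {within I01 `*` I01, continuous H},
          forall s t, I01 s -> I01 t -> A (H (s, t)),
          forall t, I01 t -> H (0, t) = g t,
          forall t, I01 t -> H (1, t) = g 0 &
          forall s, I01 s -> H (s, 0) = g 0 /\ H (s, 1) = g 0].

Definition domain (A : set V) : Prop := [/\ open A, connected A & A !=set0].

Definition structural_set (phi : 'I_m -> V) : Prop :=
  row_full (\matrix_(i < m) phi i) /\
  forall i j, dotv (phi i) (phi j) = (i == j)%:R.

(* Balls are open, Euclidean, with arbitrary centres; a finite family of them
   is given by the sequence of its centres. *)
Definition covering_number (G : set V) (tau : R) : \bar R :=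
  ereal_inf [set (size s)%:R%:E |
    s in [set s : seq V | forall x, G x -> exists2 c, c \in s & enorm (x - c) < tau]].

Definition d_summable (d : R) (G : set V) : Prop :=
  (\int[lebesgue_measure]_(t in `]0%R, 1%R])
     (covering_number G t * ((t `^ (d - 1))%R%:E)) < +oo)%E.

Definition pt_of_tuple (t : m.-tuple (measurableTypeR R)) : V :=
  \row_(j < m) tnth t j.

Definition lebesgue_vol (A : set V) : \bar R :=
  lebesgue_tuple R m (pt_of_tuple @^-1` A).

(* The surface measure on the unit sphere, given by the volume of cones over
   E with apex at the origin. *)
Definition sphere_measure (E : set V) : \bar R :=
  (m%:R%:E * lebesgue_vol [set t *: x | t in [set t : R | 0 < t <= 1] & x in E]%R)%E.

Definition sphere_area : R := fine (sphere_measure [set x | enorm x = 1]).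

End Euclidean.

Section CliffordAnalysis.
Variables (R : realType) (m : nat).
Local Notation V := 'rV[R]_m.
Local Notation Cl := (clifford R m).

Definition cnorm (a : Cl) : R := Num.sqrt (\sum_(A : {set 'I_m}) a A ^+ 2).

Definition cl_vec (x : V) : Cl := \sum_(j < m) x 0 j *: cl_e R j.

Definition struct_vec (phi : 'I_m -> V) (x : V) : Cl :=
  \sum_(j < m) x 0 j *: cl_vec (phi j).

Definition pderiv (j : 'I_m) (f : V -> Cl) : V -> Cl :=
  fun x => [ffun A => 'D_(delta_mx 0 j) (fun y => f y A) x].

Definition pderivs (s : seq 'I_m) (f : V -> Cl) : V -> Cl := foldr pderiv f s.

(* To be used on an open set U. *)
Definition class_C (k : nat) (U : set V) (f : V -> Cl) : Prop :=
  forall s : seq 'I_m, (size s <= k)%N -> forall (A : {set 'I_m}) x, U x ->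
    {for x, continuous (fun y => pderivs s f y A)} /\
    ((size s < k)%N ->
     forall j : 'I_m, derivable (fun y => pderivs s f y A) x (delta_mx 0 j)).

Definition class_Coo (U : set V) (f : V -> Cl) : Prop :=
  forall k, class_C k U f.

Definition dirac_l (phi : 'I_m -> V) (f : V -> Cl) : V -> Cl :=
  fun x => \sum_(j < m) cl_vec (phi j) * pderiv j f x.

Definition dirac_r (phi : 'I_m -> V) (f : V -> Cl) : V -> Cl :=
  fun x => \sum_(j < m) pderiv j f x * cl_vec (phi j).

Definition lame_op (phi psi : 'I_m -> V) (mu lambda : R) (f : V -> Cl) : V -> Cl :=
  fun x => ((mu + lambda) / 2) *: dirac_r psi (dirac_l phi f) x +
           ((3 * mu + lambda) / 2) *: dirac_l phi (dirac_l psi f) x.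

Definition M_op (psi : 'I_m -> V) (mu lambda : R) (f : V -> Cl) : V -> Cl :=
  fun x => ((mu + lambda) / 2) *: dirac_r psi f x +
           ((3 * mu + lambda) / 2) *: dirac_l psi f x.

Definition cl_integrable (D : set V) (g : V -> Cl) : Prop :=
  forall A : {set 'I_m},
    (lebesgue_tuple R m).-integrable (@pt_of_tuple R m @^-1` D)
      (fun t => (g (pt_of_tuple t) A)%:E).

Definition cl_integral (D : set V) (g : V -> Cl) : Cl :=
  [ffun A : {set 'I_m} =>
     \int[lebesgue_tuple R m]_(t in @pt_of_tuple R m @^-1` D)
       g (pt_of_tuple t) A].

Definition E1 (x : V) : R :=
  1 / ((m%:R - 2) * sphere_area R m * enorm x ^+ (m - 2)).

Definition K_ker (phi : 'I_m -> V) (x : V) : Cl :=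
  (- 1 / sphere_area R m) *: ((enorm x ^+ m)^-1 *: struct_vec phi x).

Definition teo_vec (phi psi : 'I_m -> V) (g : V -> Cl) (x y : V) : Cl :=
  (struct_vec psi y - struct_vec psi x) * K_ker phi (y - x) * g y.

Definition teo_scal (phi psi : 'I_m -> V) (g : V -> Cl) (j : 'I_m) (x y : V) : Cl :=
  E1 (y - x) *: (cl_vec (psi j) * cl_vec (phi j) * g y).

Definition teodorescu (Omega : set V) (phi psi : 'I_m -> V) (g : V -> Cl) : V -> Cl :=
  fun x => (- (1 / 2)) *:
    (cl_integral Omega (teo_vec phi psi g x) +
     \sum_(j < m) cl_integral Omega (teo_scal phi psi g j x)).

Definition teo_infra_vec (phi psi : 'I_m -> V) (g : V -> Cl) (x y : V) : Cl :=
  K_ker phi (y - x) * g y * (struct_vec psi y - struct_vec psi x).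

Definition teo_infra_scal (g : V -> Cl) (x y : V) : Cl := E1 (y - x) *: g y.

Definition teodorescu_infra (Omega : set V) (phi psi : 'I_m -> V) (g : V -> Cl) :
    V -> Cl :=
  fun x => (- (1 / 2)) *:
    (cl_integral Omega (teo_infra_vec phi psi g x) +
     \sum_(j < m) cl_vec (phi j) * cl_integral Omega (teo_infra_scal g x) *
                  cl_vec (psi j)).

Definition teodorescu_dag (Omega : set V) (phi psi : 'I_m -> V) (mu lambda : R)
    (g : V -> Cl) : V -> Cl :=
  fun x =>
    (- ((mu + lambda) / (2 * mu * (2 * mu + lambda)))) *:
      teodorescu_infra Omega phi psi g x +
    ((3 * mu + lambda) / (2 * mu * (2 * mu + lambda))) *:
      teodorescu Omega phi psi g x.

(* All the integrals entering teodorescu_dag at x converge; the library integral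
   has a default value otherwise. *)
Definition teodorescu_dag_defined (Omega : set V) (phi psi : 'I_m -> V)
    (g : V -> Cl) (x : V) : Prop :=
  [/\ cl_integrable Omega (teo_vec phi psi g x),
      forall j, cl_integrable Omega (teo_scal phi psi g j x),
      cl_integrable Omega (teo_infra_vec phi psi g x) &
      cl_integrable Omega (teo_infra_scal g x)].

Definition lip_jet (nu : R) (G : set V) (f : V -> Cl) (fj : 'I_m -> V -> Cl) : Prop :=
  (exists B : R, forall x, G x ->
     cnorm (f x) <= B /\ forall j, cnorm (fj j x) <= B) /\
  (exists C : R, forall x y, G x -> G y ->
     cnorm (f x - f y - \sum_(j < m) (x 0 j - y 0 j) *: fj j y)
       <= C * enorm (x - y) `^ (1 + nu) /\
     forall j, cnorm (fj j x - fj j y) <= C * enorm (x - y) `^ nu).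

Definition whitney_extension (nu : R) (G : set V) (f : V -> Cl)
    (fj : 'I_m -> V -> Cl) (ft : V -> Cl) : Prop :=
  [/\ class_C 1 setT ft /\
        (exists H : R, forall j x y,
           cnorm (pderiv j ft x - pderiv j ft y) <= H * enorm (x - y) `^ nu),
      class_Coo (~` G) ft,
      forall x, G x -> ft x = f x,
      forall j x, G x -> pderiv j ft x = fj j x &
      exists c : R, forall i j x, ~ G x ->
        cnorm (pderiv i (pderiv j ft) x) <= c * dist_to x G `^ (nu - 1)].

(* When x is not adherent to U the filter is trivial and the condition is void:
   this concerns the points of the boundary of Omega that are interior to its
   closure, at which there is no limit from the exterior to be taken. *)
Definition has_side_limit (U : set V) (G : V -> Cl) (x : V) (a : Cl) : Prop :=
  forall A : {set 'I_m}, G z A @[z --> within U (nbhs x)] --> a A.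

Definition has_jump (Up Um : set V) (G : V -> Cl) (x : V) (a : Cl) : Prop :=
  exists ap am : Cl,
    [/\ has_side_limit Up G x ap, has_side_limit Um G x am & ap - am = a].

Definition vanishes_at_infinity (G : V -> Cl) : Prop :=
  forall e : R, 0 < e -> exists r : R, forall x, r < enorm x -> cnorm (G x) < e.

Definition jump_solution (phi psi : 'I_m -> V) (mu lambda : R) (Omega : set V)
    (f : V -> Cl) (ft : V -> Cl) (F : V -> Cl) : Prop :=
  let Up := Omega in
  let Um := ~` closure Omega in
  [/\ class_C 2 (Up `|` Um) F /\
        (forall x, (Up `|` Um) x -> lame_op phi psi mu lambda F x = 0),
      forall x, boundary Omega x -> has_jump Up Um F x (f x),
      forall x, boundary Omega x ->
        has_jump Up Um (M_op psi mu lambda F) x (M_op psi mu lambda ft x) &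
      vanishes_at_infinity F /\ vanishes_at_infinity (M_op psi mu lambda F)].

End CliffordAnalysis.

(* Main.v *)
Require Import Defs.
From HB Require Import structures.
From mathcomp Require Import all_boot all_order all_algebra.
From mathcomp Require Import all_classical all_reals all_analysis.
From mathcomp Require Import measurable_realfun.
From mathcomp Require Import ring lra zify.

(** Let g be the Lame operator applied to the Whitney extension, restricted to
   Omega and extended by 0. The theorem follows from two facts about the
   transform of g: it is of class C^1 on the whole space, the boundary included,
   and on Omega and on its exterior it is of class C^2 and the Lame operator maps
   it back to g. Then the candidate F solves the equation on both sides, and since
   the transform and its first derivatives are continuous across the boundary, the
   jumps of F and of M F are those of the Whitney extension cut off by Omega.

   The first fact is an estimate. The Whitney extension only gives the bound
   c dist(y, G)^(nu - 1) for g, which blows up at the boundary G. Summability of G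
   bounds the volume of the points at distance less than t from G by a multiple of
   t^(m - d) (vol_tube_le), and as d / m < nu, Young's inequality then shows that,
   for some delta > 0, the integral of |x - y|^-(m - 1 + delta) |g(y)| is bounded
   uniformly in x (tube_density). Under such a bound the potentials of kernels of
   order 1 - m are continuous and those of kernels of order 2 - m are of class C^1
   (potential_continuous, potential_derive), whatever the density.

   For the second fact, both transforms are combinations of the same scalar
   potentials P_jk, with kernels the k-th partial derivatives of z_j E1; the
   coefficients psi_j phi_k stand on the left for one transform, and phi_k and
   psi_j on either side for the other (teodorescu_dagE). Away from G the density g
   is of class C^1, and P_jk has second derivatives there: a cutoff splits g into a
   compactly supported C^1 function, on which one derivative of the kernel is moved
   by parts, and a function that vanishes nearby (potential_split). The array
   S_abjk of second derivatives of the P_jk is totally symmetric, in a and b by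
   Schwarz's theorem and in b, j, k by the form of the kernel, and its full trace is
   twice the Laplacian of the Newton potential of g, that is - 2 g (laplace_newton,
   elastic_potential). The Laplacian is computed from the divergence of the field
   |z|^-m z, which is a Dirac mass: a dilation argument proves this without
   integrating over spheres (theta_gradient, newton_gradient0).

   What remains is algebra (symbol_lame_dag). Since the vectors of a structural set
   anticommute up to squares - 1, contracting the symmetric array S with products of
   two vectors of the same set leaves minus a trace. The operator and the transform
   each have two parts; the two products of corresponding parts contract twice, and
   the two mixed products are equal by the symmetry of S and cancel because of their
   coefficients. *)

Set Implicit Arguments.
Unset Strict Implicit.
Unset Printing Implicit Defensive.
Import Order.TTheory GRing.Theory Num.Theory.
Import numFieldNormedType.Exports.
Local Open Scope classical_set_scope.
Local Open Scope ring_scope.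

(** * Affine changes of variables for Lebesgue measure *)

Local Notation pushM m mf :=
  (measure_function_pushforward__canonical__measure_function_Measure m mf).

Section LebesgueAffine.
Variable R : realType.
Local Notation T := (measurableTypeR R).
Local Notation lam := (@lebesgue_measure R).

Lemma measurable_affine (s w : R) : measurable_fun setT (fun x : T => s * x + w : T).
Proof. by apply: measurable_funD => //; exact: measurable_funM. Qed.

(** Both sides are measures that agree on half-open intervals, and such a measure
   is unique. *)
Lemma lebesgue_affine (s w : R) (A : set T) : 0 < s -> measurable A ->
  lam A = (s%:E * lam ((fun x : T => s * x + w)%R @^-1` A))%E.
Proof.
move=> s0 mA.
pose f : T -> T := fun x => s * x + w.
have mf : measurable_fun setT f by exact: measurable_affine.
pose nu : {measure set T -> \bar R} :=
  mscale (NngNum (ltW s0)) (pushM lam mf).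
have -> : (s%:E * lam (f @^-1` A))%E = nu A by [].
apply: lebesgue_measure_unique => //= _ [[a b]] _ <-.
rewrite /nu /mscale /= /pushforward /=.
have -> : f @^-1` `]a, b]%classic = `](a - w) / s, (b - w) / s]%classic.
  apply/seteqP; split => x /=; rewrite !in_itv /= /f ltr_pdivrMr// ler_pdivlMr//;
    by rewrite ltrBlDr lerBrDr mulrC.
rewrite !lebesgue_measure_itv /= !lte_fin ltr_pM2r ?invr_gt0// ltrD2r.
case: ifPn => ab; last by rewrite mule0.
by rewrite -!EFinD -EFinM; congr EFin; field; rewrite gt_eqF.
Qed.

Lemma ge0_integral_affine1 (s w : R) (f : T -> \bar R) : 0 < s ->
  measurable_fun setT f -> (forall x, 0 <= f x)%E ->
  (\int[lam]_x f (s * x + w)%R = s^-1%:E * \int[lam]_x f x)%E.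
Proof.
move=> s0 mf f0.
pose g : T -> T := fun x => s * x + w.
have mg : measurable_fun setT g by exact: measurable_affine.
have E : (\int[lam]_x f x = s%:E * \int[lam]_x f (g x))%E.
  rewrite -[X in (_ * X)%E](ge0_integral_pushforward mg lam measurableT mf)//.
  transitivity (\int[mscale (NngNum (ltW s0)) (pushM lam mg)]_x f x)%E.
    by apply: eq_measure_integral => A mA _; exact: (lebesgue_affine w s0 mA).
  by rewrite ge0_integral_mscale.
by rewrite E muleA -EFinM mulVf ?mul1e// gt_eqF.
Qed.
End LebesgueAffine.

Section TupleIntegral.
Variable R : realType.
Local Notation T := (measurableTypeR R).
Local Notation lam := (@lebesgue_measure R).
Local Notation mu := (lebesgue_tuple R).

Lemma ge0_integral_tcons n (f : n.+1.-tuple T -> \bar R) :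
  measurable_fun setT f -> (forall x, 0 <= f x)%E ->
  (\int[mu n.+1]_t f t = \int[lam]_x \int[mu n]_t f (tcons (x, t)))%E.
Proof.
move=> mf f0 /=.
have mt := @measurable_tcons R n.
transitivity (\int[pushM (lam \x mu n)%E mt]_t f t)%E.
  by apply: eq_measure_integral.
rewrite (ge0_integral_pushforward mt (lam \x mu n)%E measurableT mf)//.
rewrite preimage_setT fubini_tonelli1//; first by apply: measurableT_comp.
by move=> x; exact: f0.
Qed.

Definition aff_tuple n (s : R) (w : 'I_n -> R) (t : n.-tuple T) : n.-tuple T :=
  mktuple (fun i => s * tnth t i + w i).

Lemma measurable_aff_tuple n s w : measurable_fun setT (@aff_tuple n s w).
Proof.
apply/measurable_fun_tnthP => i /=.
rewrite (_ : _ \o _ = fun t => s * tnth t i + w i); last first.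
  by apply/funext => t /=; rewrite tnth_mktuple.
apply: measurable_funD => //; apply: measurable_funM => //.
exact: measurable_tnth.
Qed.

(** Tonelli peels off one coordinate at a time, so the Jacobian collects one
   factor s per dimension. *)
Lemma ge0_integral_aff n (s : R) (w : 'I_n -> R) (f : n.-tuple T -> \bar R) :
  0 < s -> measurable_fun setT f -> (forall x, 0 <= f x)%E ->
  (\int[mu n]_t f (aff_tuple s w t) = (s ^- n)%:E * \int[mu n]_t f t)%E.
Proof.
move=> s0; elim: n w f => [|n IH] w f mf f0.
  rewrite expr0 invr1 mul1e; apply: eq_integral => t _; congr f.
  by rewrite tuple0 [RHS]tuple0.
rewrite ge0_integral_tcons//; last first.
  by apply: (measurableT_comp mf); exact: measurable_aff_tuple.
pose w' := fun i => w (lift ord0 i).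
have mft x : measurable_fun setT (fun t => f (tcons (x, t))).
  apply: (measurableT_comp mf).
  exact: (measurableT_comp (@measurable_tcons R n) (measurable_pair1 x)).
under eq_integral => x _.
  under eq_integral => t _.
    have -> : aff_tuple s w (tcons (x, t)) = tcons (s * x + w ord0, aff_tuple s w' t).
      apply: eq_from_tnth => i; rewrite tnth_mktuple.
      case: (unliftP ord0 i) => [j ->|->].
        by rewrite !tnthS tnth_mktuple.
      by rewrite !(tnth_nth 0).
    over.
  rewrite (IH w' (fun t => f (tcons (s * x + w ord0, t))))//.
  over.
pose F x := (\int[mu n]_t f (tcons (x, t)))%E.
have mF : measurable_fun setT F.
  have mfc : measurable_fun setT (f \o @tcons R n).
    exact: (measurableT_comp mf (@measurable_tcons R n)).
  by apply: (@measurable_fun_fubini_tonelli_F _ _ _ _ R (mu n) _ mfc) => p; exact: f0.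
have F0 x : (0 <= F x)%E by exact: integral_ge0.
have mFs : measurable_fun setT (fun x => F (s * x + w ord0)).
  by apply: (measurableT_comp mF); exact: measurable_affine.
have sn0 : 0 <= s ^- n by rewrite invr_ge0 exprn_ge0// ltW.
transitivity ((s ^- n)%:E * \int[lam]_x F (s * x + w ord0)%R)%E.
  by rewrite -ge0_integralZl_EFin.
rewrite (ge0_integral_affine1 (w ord0) s0 mF)// muleA.
by rewrite -EFinM -invfM -exprSr ge0_integral_tcons.
Qed.
End TupleIntegral.

(** * Euclidean geometry of row vectors *)

Section EuclideanNorm.
Variables (R : realType) (m : nat).
Local Notation V := 'rV[R]_m.
Implicit Types (x y z : V) (a : R).

Lemma dotvC x y : dotv x y = dotv y x.
Proof. by apply: eq_bigr => i _; rewrite mulrC. Qed.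

Lemma dotvDl x y z : dotv (x + y) z = dotv x z + dotv y z.
Proof. by rewrite -big_split; apply: eq_bigr => i _; rewrite mxE mulrDl. Qed.

Lemma dotvZl a x y : dotv (a *: x) y = a * dotv x y.
Proof. by rewrite mulr_sumr; apply: eq_bigr => i _; rewrite mxE mulrA. Qed.

Lemma dotvDr x y z : dotv z (x + y) = dotv z x + dotv z y.
Proof. by rewrite dotvC dotvDl !(dotvC z). Qed.

Lemma dotvZr a x y : dotv x (a *: y) = a * dotv x y.
Proof. by rewrite dotvC dotvZl dotvC. Qed.

Lemma dotv_ge0 x : 0 <= dotv x x.
Proof. by apply: sumr_ge0 => i _; rewrite -expr2 sqr_ge0. Qed.

Lemma enorm_ge0 x : 0 <= enorm x.
Proof. exact: sqrtr_ge0. Qed.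

Lemma sqr_enorm x : enorm x ^+ 2 = dotv x x.
Proof. by rewrite sqr_sqrtr// dotv_ge0. Qed.

Lemma dotv_delta i x : dotv (delta_mx 0 i) x = x 0 i.
Proof.
rewrite /dotv (bigD1 i)//= big1 ?addr0 => [|j ji].
  by rewrite mxE !eqxx mul1r.
by rewrite mxE (negPf ji) andbF mul0r.
Qed.

Lemma enorm_delta (i : 'I_m) : enorm (delta_mx 0 i : V) = 1.
Proof. by rewrite /enorm dotv_delta mxE !eqxx sqrtr1. Qed.

Lemma enormZ a x : enorm (a *: x) = `|a| * enorm x.
Proof. by rewrite /enorm dotvZl dotvZr mulrA -expr2 sqrtrM ?sqr_ge0// sqrtr_sqr. Qed.

Lemma enorm0 : enorm (0 : V) = 0.
Proof. by rewrite -(scale0r (0 : V)) enormZ normr0 mul0r. Qed.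

Lemma enormN x : enorm (- x) = enorm x.
Proof. by rewrite -scaleN1r enormZ normrN1 mul1r. Qed.

Lemma enormBC x y : enorm (x - y) = enorm (y - x).
Proof. by rewrite -enormN opprB. Qed.

Lemma coord_le_enorm x i : `|x 0 i| <= enorm x.
Proof.
rewrite -(ler_pXn2r (ltn0Sn 1)) ?nnegrE ?enorm_ge0// sqr_enorm real_normK ?num_real//.
rewrite /dotv (bigD1 i)//= -expr2 lerDl; apply: sumr_ge0 => j _.
by rewrite -expr2 sqr_ge0.
Qed.

Lemma enorm_eq0 x : (enorm x == 0) = (x == 0).
Proof.
apply/idP/eqP => [/eqP x0|->]; last by rewrite enorm0.
apply/rowP => i; rewrite mxE; apply/eqP; rewrite -normr_eq0.
by rewrite eq_le normr_ge0 -x0 coord_le_enorm.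
Qed.

Lemma enorm_gt0 x : (0 < enorm x) = (x != 0).
Proof. by rewrite lt_neqAle enorm_ge0 andbT eq_sym enorm_eq0. Qed.

Lemma le_dotv x y : dotv x y <= enorm x * enorm y.
Proof.
have [->|y0] := eqVneq y 0.
  by rewrite -(scale0r (0 : V)) dotvZr mul0r enormZ normr0 mul0r mulr0.
have y1 : 0 < enorm y by rewrite enorm_gt0.
(* the squared norm of a combination of x and y orthogonal to y *)
have H : 0 <= dotv (enorm y ^+ 2 *: x - dotv x y *: y) (enorm y ^+ 2 *: x - dotv x y *: y).
  exact: dotv_ge0.
rewrite -scaleNr dotvDl !dotvDr !dotvZl !dotvZr (dotvC y x) -!sqr_enorm in H.
have {}H : 0 <= enorm y ^+ 2 * ((enorm x * enorm y) ^+ 2 - dotv x y ^+ 2).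
  by apply: (le_trans H); rewrite le_eqVlt; apply/orP; left; apply/eqP; ring.
rewrite pmulr_rge0 ?exprn_gt0// subr_ge0 in H.
have [d0|d0] := leP (dotv x y) 0.
  by apply: (le_trans d0); rewrite mulr_ge0// enorm_ge0.
by rewrite -(ler_pXn2r (ltn0Sn 1)) ?nnegrE ?mulr_ge0 ?enorm_ge0// ltW.
Qed.

Lemma enormD x y : enorm (x + y) <= enorm x + enorm y.
Proof.
rewrite -(ler_pXn2r (ltn0Sn 1)) ?nnegrE ?addr_ge0 ?enorm_ge0//.
rewrite sqr_enorm dotvDl !dotvDr (dotvC y x) -!sqr_enorm.
by have := le_dotv x y; nra.
Qed.

Lemma enormB x y : enorm (x - y) <= enorm x + enorm y.
Proof. by rewrite -(enormN y) enormD. Qed.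

Lemma ler_enormB x y : enorm x - enorm y <= enorm (x - y).
Proof. by rewrite lerBlDr -{1}(subrK y x) enormD. Qed.

Lemma ler_dist_enorm x y : `|enorm x - enorm y| <= enorm (x - y).
Proof. by rewrite ler_norml ler_enormB andbT lerNl opprB enormBC ler_enormB. Qed.

Lemma enorm_le_sum x : enorm x <= \sum_i `|x 0 i|.
Proof.
rewrite {1}(row_sum_delta x); elim/big_ind2 : _ => [|x1 x2 y1 y2 h1 h2|i _].
- by rewrite enorm0.
- by apply: (le_trans (enormD _ _)); exact: lerD.
- by rewrite enormZ enorm_delta mulr1.
Qed.

Lemma coord_le_norm x i : `|x 0 i| <= `|x|.
Proof.
by rewrite -[leRHS]/(mx_norm x) mx_normrE; apply/bigmax_geP; right => /=; exists (0, i).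
Qed.

Lemma norm_le_enorm x : `|x| <= enorm x.
Proof.
rewrite -[leLHS]/(mx_norm x) mx_normrE; apply/bigmax_leP; split; first exact: enorm_ge0.
by move=> [i j] _ /=; rewrite ord1 coord_le_enorm.
Qed.

Lemma enorm_le_norm x : enorm x <= m%:R * `|x|.
Proof.
apply: (le_trans (enorm_le_sum x)).
rewrite mulr_natl -[X in _ *+ X]card_ord -sumr_const.
by apply: ler_sum => i _; exact: coord_le_norm.
Qed.

(** Row vectors carry the topology of the sup norm; it is equivalent to the
   Euclidean norm, in which all the estimates below are made. *)
Lemma nbhs_enormP x (A : set V) :
  nbhs x A <-> exists2 e : R, 0 < e & forall y, enorm (y - x) < e -> A y.
Proof.
split=> [/nbhs_ballP[e /= e0 eA]|[e e0 eA]].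
  exists e => // y yx; apply: eA; rewrite -ball_normE /ball_ /=.
  by apply: le_lt_trans (norm_le_enorm _) _; rewrite enormBC.
apply/nbhs_ballP; exists (e / m.+1%:R) => /=; first by rewrite divr_gt0.
move=> y; rewrite -ball_normE /ball_ /= ltr_pdivlMr// => xy.
apply: eA; rewrite enormBC; apply: le_lt_trans (enorm_le_norm _) _.
apply: le_lt_trans xy; rewrite mulrC; apply: ler_wpM2l => //.
by rewrite ler_nat.
Qed.

Lemma continuous_enormP (f : V -> R) x : {for x, continuous f} <->
  (forall e, 0 < e -> exists2 d, 0 < d &
     forall y, enorm (y - x) < d -> `|f y - f x| < e).
Proof.
split=> [/cvgrPdist_lt cf e e0|h].
  have /nbhs_enormP[d d0 dP] := cf e e0.
  by exists d => // y /dP /=; rewrite distrC.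
have F : Filter (nbhs x) by exact: nbhs_filter.
rewrite /prop_for /continuous_at; apply/cvgrPdist_lt => e e0; have [d d0 dP] := h e e0.
by apply/nbhs_enormP; exists d => // y /dP /=; rewrite distrC.
Qed.

Lemma lipschitz_continuous (f : V -> R) (L : R) :
  (forall x y, `|f x - f y| <= L * enorm (x - y)) -> continuous f.
Proof.
move=> Lf x; apply/continuous_enormP => e e0.
have L1 : 0 < `|L| + 1 by rewrite ltr_wpDl.
exists (e / (`|L| + 1)); first by rewrite divr_gt0.
move=> y; rewrite ltr_pdivlMr// => yx; apply: le_lt_trans (Lf _ _) _.
apply: le_lt_trans yx; rewrite mulrC; apply: ler_wpM2l; first exact: enorm_ge0.
by rewrite (le_trans (ler_norm _))// lerDl.
Qed.

Lemma continuous_enorm : continuous (@enorm R m).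
Proof. by apply: (lipschitz_continuous (L := 1)) => x y; rewrite mul1r ler_dist_enorm. Qed.

End EuclideanNorm.

(** Directional derivatives as first order expansions: in this form they combine
   with integral estimates without passing through quotients and filters. *)
Lemma is_deriveP (R : realType) (W : normedModType R) (f : W -> R) (x v : W) (d : R) :
  (forall e, 0 < e -> exists2 tau, 0 < tau & forall t, t != 0 -> `|t| < tau ->
     `|f (x + t *: v) - f x - t * d| <= e * `|t|) <->
  is_derive x v f d.
Proof.
have E t : t != 0 -> t^-1 * (f (x + t *: v) - f x) - d =
    t^-1 * (f (x + t *: v) - f x - t * d).
  by move=> t0; rewrite [RHS]mulrBr mulKf.
split=> [h|[df fd] e e0].
  suff D : (fun h => h^-1 *: ((f \o shift x) (h *: v) - f x)) @ 0^' --> (d : R).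
    by split; [apply/cvg_ex; exists d | exact: cvg_lim].
  apply/cvgrPdist_le => e e0; have [tau tau0 tauP] := h e e0.
  exists tau => //= t /= tt t0; rewrite /= distrC addrC.
  rewrite sub0r normrN in tt.
  rewrite /GRing.scale /= (addrC (t *: v)) addrC E// normrM normfV.
  by rewrite ler_pdivrMl ?normr_gt0// [leRHS]mulrC tauP.
move/cvgrPdist_le: df; rewrite -/(derive f x v) fd => /(_ e e0)[tau /= tau0 tauP].
exists tau => // t t0 tt; have := tauP t; rewrite /= sub0r normrN => /(_ tt t0).
rewrite distrC /GRing.scale /= (addrC (t *: v)) E// normrM normfV.
by rewrite ler_pdivrMl ?normr_gt0// [leRHS]mulrC.
Qed.

(** * Integration over Euclidean space *)

(** Locked, so that unification never unfolds it to an integral over tuples. *)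
HB.lock Definition vint (R : realType) (m : nat) (f : 'rV[R]_m -> R) : R :=
  \int[lebesgue_tuple R m]_t (f \o @pt_of_tuple R m) t.

Section VectorIntegral.
Variables (R : realType) (m : nat).
Local Notation T := (measurableTypeR R).
Local Notation V := 'rV[R]_m.
Local Notation mu := (lebesgue_tuple R m).
Local Notation pt := (@pt_of_tuple R m).
Implicit Types (f g : V -> R) (A U : set V) (x y z : V).

Definition vset A := measurable (pt @^-1` A).
Definition vmeas f := measurable_fun setT (f \o pt : m.-tuple T -> R).
Definition vintegrable f := mu.-integrable setT (EFin \o (f \o pt)).
Local Notation vint := (@vint R m).
Definition eint f : \bar R := (\int[mu]_t (f (pt t))%:E)%E.
Definition closed_box x (r : R) : set V := [set y | forall i, `|y 0 i - x 0 i| <= r].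

Lemma pt_aff (s : R) x (t : m.-tuple T) :
  pt (aff_tuple s (x 0) t) = s *: pt t + x.
Proof. by apply/rowP => i; rewrite !mxE tnth_mktuple. Qed.

Lemma measurable_pt_coord i : measurable_fun setT (fun t : m.-tuple T => pt t 0 i).
Proof.
rewrite (_ : (fun _ => _) = (@tnth m T)^~ i); first exact: measurable_tnth.
by apply/funext => t; rewrite mxE.
Qed.

Lemma vset_coord (B : 'I_m -> set T) : (forall i, measurable (B i)) ->
  vset [set y : V | forall i, B i (y 0 i)].
Proof.
move=> mB; rewrite /vset (_ : _ @^-1` _ =
    \bigcap_(i in [set: 'I_m]) ((fun t => pt t 0 i) @^-1` B i)).
  apply: fin_bigcap_measurable => // i _.
  by rewrite -[X in measurable X]setTI; exact: (measurable_pt_coord i measurableT (mB i)).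
by apply/seteqP; split => [t h i _|t h i]; [exact: h|exact: (h i)].
Qed.

Lemma vol_coord (B : 'I_m -> set T) : (forall i, measurable (B i)) ->
  lebesgue_vol [set y : V | forall i, B i (y 0 i)] =
  (\prod_(i < m) lebesgue_measure (B i))%E.
Proof.
move=> mB; rewrite -lebesgue_tuple_box// /lebesgue_vol.
rewrite (_ : pt @^-1` _ = [set t | forall i, B i (tnth t i)])//.
by apply/seteqP; split => t /= h i; have := h i; rewrite mxE.
Qed.

(** An open set is a countable union of boxes with rational centres and radii. *)
Lemma vset_open U : open U -> vset U.
Proof.
move=> oU.
pose I : countType := ('rV[rat]_m * nat)%type.
pose B (p : I) : set V := [set y | forall i, `|y 0 i - ratr (p.1 0 i)| < p.2.+1%:R^-1].
have -> : U = \bigcup_(p in [set p : I | B p `<=` U]) B p.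
  apply/seteqP; split => [x Ux|x [p pU]]; last exact: pU.
  have /nbhs_ballP[e /= e0 eU] : nbhs x U by exact: open_nbhs_nbhs.
  have [k ke] : exists k : nat, k.+1%:R^-1 < e / 2.
    exists (Num.bound (e / 2)^-1).
    rewrite invf_plt ?posrE ?divr_gt0//.
    have h : (e / 2)^-1 < (Num.bound (e / 2)^-1)%:R.
      by apply: archi_boundP; rewrite invr_ge0 ltW// divr_gt0.
    by apply: (lt_le_trans h); rewrite ler_nat.
  have q i : {q : rat | `|x 0 i - ratr q| < k.+1%:R^-1}.
    apply: cid; have [|q /= qx] := @rat_in_itvoo R (x 0 i - k.+1%:R^-1) (x 0 i).
      by rewrite ltrBlDr ltrDl invr_gt0.
    exists q; move: qx; rewrite in_itv /= => /andP[q1 q2].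
    by rewrite ger0_norm ?subr_ge0 1?ltW// ltrBlDr -ltrBlDl.
  exists (\row_i sval (q i), k) => /=; last first.
    by move=> i /=; rewrite mxE; case: (q i).
  move=> y By; apply: eU; split=> // i j; rewrite ord1 {i}.
  have := By j; rewrite /= mxE; case: (q j) => r /= h1 h2.
  rewrite /ball /= (le_lt_trans (ler_distD (ratr r) _ _))//.
  have -> : e = e / 2 + e / 2 by lra.
  by rewrite ltrD// ?(lt_trans h1)// distrC (lt_trans h2).
rewrite /vset preimage_bigcup bigcup_mkcond.
apply: countable_bigcupT_measurable => [|p]; first exact: countableP.
case: ifP => // _; apply: (@vset_coord (fun i => [set u : R | `|u - ratr (p.1 0 i)| < p.2.+1%:R^-1])) => i.
rewrite (_ : mkset _ = ball (ratr (p.1 0 i) : R) p.2.+1%:R^-1); first exact: measurable_ball.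
by apply/seteqP; split => u /=; rewrite /ball /= distrC.
Qed.

Lemma vset_closed A : closed A -> vset A.
Proof.
move=> cA; rewrite -(setCK A) /vset preimage_setC; apply: measurableC.
by apply: (@vset_open (~` A)); exact: closed_openC.
Qed.

Lemma vmeas_patch U f : open U -> (forall x, U x -> {for x, continuous f}) ->
  vmeas (f \_ U).
Proof.
move=> oU cf; rewrite /vmeas.
have -> : f \_ U \o pt = (f \o pt) \_ (pt @^-1` U).
  apply/funext => t; rewrite /patch /= (_ : (t \in pt @^-1` U) = (pt t \in U))//.
have mU : measurable (pt @^-1` U) by exact: vset_open.
apply/(measurable_restrictT _ mU).
apply: (measurability _ (RGenOInfty.measurableE R)) => //.
move=> /= _ [_ [a ->] <-].
rewrite (_ : _ `&` _ = pt @^-1` (U `&` f @^-1` `]a, +oo[%classic)); last by [].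
apply: vset_open; rewrite openE => x [Ux fx]; rewrite /interior.
apply: filterI; first exact: open_nbhs_nbhs.
by apply: (cf x Ux); apply: open_nbhs_nbhs; split => //; exact: interval_open.
Qed.

Lemma vmeas_continuous f : continuous f -> vmeas f.
Proof.
move=> cf; rewrite (_ : f = f \_ setT); last by apply/funext => x; rewrite /patch in_setT.
by apply: vmeas_patch => [|x _]; [exact: openT | exact: cf].
Qed.

Lemma vmeas_cst (c : R) : vmeas (fun=> c). Proof. exact: measurable_cst. Qed.

Lemma vmeasD f g : vmeas f -> vmeas g -> vmeas (fun x => f x + g x).
Proof. exact: measurable_funD. Qed.

Lemma vmeasB f g : vmeas f -> vmeas g -> vmeas (fun x => f x - g x).
Proof. exact: measurable_funB. Qed.

Lemma vmeasM f g : vmeas f -> vmeas g -> vmeas (fun x => f x * g x).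
Proof. exact: measurable_funM. Qed.

Lemma vmeas_comp (h : R -> R) f : measurable_fun setT (h : T -> T) -> vmeas f ->
  vmeas (fun x => h (f x)).
Proof. by move=> mh mf; exact: (measurableT_comp mh mf). Qed.

Lemma vmeas_norm f : vmeas f -> vmeas (fun x => `|f x|).
Proof. by move=> mf; apply: vmeas_comp mf; exact: normr_measurable. Qed.

Lemma vmeas_sum (I : Type) (s : seq I) (F : I -> V -> R) :
  (forall i, vmeas (F i)) -> vmeas (fun x => \sum_(i <- s) F i x).
Proof.
move=> mF; elim: s => [|i s IH].
  rewrite (_ : (fun _ => _) = fun=> 0); first exact: vmeas_cst.
  by apply/funext => x; rewrite big_nil.
rewrite (_ : (fun _ => _) = fun x => F i x + \sum_(j <- s) F j x); first exact: vmeasD.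
by apply/funext => x; rewrite big_cons.
Qed.

Lemma vmeas_coord i : vmeas (fun x => x 0 i).
Proof. exact: measurable_pt_coord. Qed.

Lemma vmeas_enorm : vmeas (@enorm R m).
Proof. by apply: vmeas_continuous; exact: continuous_enorm. Qed.

Lemma vmeas_indic A : vset A -> vmeas (\1_A).
Proof.
move=> mA; rewrite /vmeas (_ : _ \o _ = \1_(pt @^-1` A)); first exact: measurable_indic.
by apply/funext => t; rewrite /= !indicE; congr (_ %:R); apply/idP/idP; rewrite !inE.
Qed.

Lemma vmeas_aff (s : R) x f : vmeas f -> vmeas (fun z => f (s *: z + x)).
Proof.
move=> mf; rewrite /vmeas (_ : _ \o _ = (f \o pt) \o aff_tuple s (x 0)).
  by apply: (measurableT_comp mf); exact: measurable_aff_tuple.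
by apply/funext => t /=; rewrite pt_aff.
Qed.

Lemma eint_aff (s : R) x f : 0 < s -> vmeas f -> (forall z, 0 <= f z) ->
  eint (fun z => f (s *: z + x)) = ((s ^- m)%:E * eint f)%E.
Proof.
move=> s0 mf f0; rewrite /eint -(ge0_integral_aff (x 0) (f := fun t => (f (pt t))%:E))//.
- by apply: eq_integral => t _; rewrite pt_aff.
- exact/measurable_EFinP.
- by move=> t; rewrite lee_fin.
Qed.

Lemma vintegrableP f : (forall z, 0 <= f z) ->
  vintegrable f <-> vmeas f /\ (eint f < +oo)%E.
Proof.
move=> f0; have E : (\int[mu]_t `|(EFin \o (f \o pt)) t|)%E = eint f.
  by apply: eq_integral => t _ /=; rewrite ger0_norm.
split=> [/integrableP[/measurable_EFinP mf]|[mf]]; first by rewrite E.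
by move=> fi; apply/integrableP; split; [exact/measurable_EFinP|rewrite E].
Qed.

Lemma vintegrable_meas f : vintegrable f -> vmeas f.
Proof. by move=> /integrableP[/measurable_EFinP]. Qed.

Lemma vintE f : vint f = \int[mu]_t (f \o pt) t.
Proof. by rewrite vint.unlock. Qed.

Lemma eintE f : (forall z, 0 <= f z) -> vintegrable f -> eint f = (vint f)%:E.
Proof. by move=> f0 fi; rewrite vintE /Rintegral fineK//; exact: integrable_fin_num. Qed.

Lemma le_vintegrable f g : vmeas f -> (forall z, `|f z| <= g z) -> vintegrable g ->
  vintegrable f.
Proof.
move=> mf fg; apply: le_integrable => //; first exact/measurable_EFinP.
by move=> t _ /=; rewrite lee_fin (le_trans (fg _))// ler_norm.
Qed.

Lemma vintegrable_norm f : vintegrable f -> vintegrable (fun x => `|f x|).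
Proof. exact: integrable_norm. Qed.

Lemma vintegrableD f g : vintegrable f -> vintegrable g ->
  vintegrable (fun x => f x + g x).
Proof. by move=> fi gi; exact: (integrableD measurableT fi gi). Qed.

Lemma vintegrableB f g : vintegrable f -> vintegrable g ->
  vintegrable (fun x => f x - g x).
Proof. by move=> fi gi; exact: (integrableB measurableT fi gi). Qed.

Lemma vintegrableZ (c : R) f : vintegrable f -> vintegrable (fun x => c * f x).
Proof. by move=> fi; exact: (integrableZl measurableT c fi). Qed.

Lemma vintegrable0 : vintegrable (fun=> 0).
Proof. exact: integrable0. Qed.

Lemma vintegrable_sum (I : Type) (s : seq I) (F : I -> V -> R) :
  (forall i, vintegrable (F i)) -> vintegrable (fun x => \sum_(i <- s) F i x).
Proof.
move=> mF; elim: s => [|i s IH].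
  rewrite (_ : (fun _ => _) = fun=> 0); first exact: vintegrable0.
  by apply/funext => x; rewrite big_nil.
rewrite (_ : (fun _ => _) = fun x => F i x + \sum_(j <- s) F j x); first exact: vintegrableD.
by apply/funext => x; rewrite big_cons.
Qed.

Lemma vintD f g : vintegrable f -> vintegrable g ->
  vint (fun x => f x + g x) = vint f + vint g.
Proof. by move=> fi gi; rewrite !vintE; exact: (RintegralD measurableT fi gi). Qed.

Lemma vintB f g : vintegrable f -> vintegrable g ->
  vint (fun x => f x - g x) = vint f - vint g.
Proof. by move=> fi gi; rewrite !vintE; exact: (RintegralB measurableT fi gi). Qed.

Lemma vintZ (c : R) f : vintegrable f -> vint (fun x => c * f x) = c * vint f.
Proof. by move=> fi; rewrite !vintE; exact: (RintegralZl c measurableT fi). Qed.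

Lemma vint0 : vint (fun=> 0) = 0.
Proof. by rewrite vintE /Rintegral integral0. Qed.

Lemma vint_sum (I : Type) (s : seq I) (F : I -> V -> R) :
  (forall i, vintegrable (F i)) ->
  vint (fun x => \sum_(i <- s) F i x) = \sum_(i <- s) vint (F i).
Proof.
move=> mF; elim: s => [|i s IH].
  rewrite big_nil (_ : (fun _ => _) = fun=> 0) ?vint0//.
  by apply/funext => x; rewrite big_nil.
rewrite big_cons -IH -vintD//; last exact: vintegrable_sum.
by congr vint; apply/funext => x; rewrite big_cons.
Qed.

Lemma le_vint f g : vintegrable f -> vintegrable g -> (forall z, f z <= g z) ->
  vint f <= vint g.
Proof. by move=> fi gi fg; rewrite !vintE; apply: le_Rintegral => // t _; exact: fg. Qed.

Lemma vint_ge0 f : (forall z, 0 <= f z) -> 0 <= vint f.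
Proof. by move=> f0; rewrite vintE; apply: Rintegral_ge0 => t _; exact: f0. Qed.

Lemma le_norm_vint f g : vmeas f -> vintegrable g -> (forall z, `|f z| <= g z) ->
  `|vint f| <= vint g.
Proof.
move=> mf gi fg; have fi := le_vintegrable mf fg gi.
rewrite [in leLHS]vintE; apply: (le_trans (le_normr_Rintegral measurableT fi)).
rewrite -(vintE (fun x => `|f x|)).
exact: (le_vint (vintegrable_norm fi) gi fg).
Qed.

Lemma vintegrable_aff (s : R) x f : 0 < s -> vintegrable f ->
  vintegrable (fun z => f (s *: z + x)).
Proof.
move=> s0 fi; have mf := vintegrable_meas fi.
have /(vintegrableP (f := fun z => `|f z|) (fun z => normr_ge0 _))[_ ni] := vintegrable_norm fi.
have ni' : vintegrable (fun z => `|f (s *: z + x)|).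
  apply/vintegrableP => //; split.
    by apply: (vmeas_norm (f := fun z => f (s *: z + x))); exact: vmeas_aff.
  rewrite (@eint_aff s x (fun z => `|f z|))//; last exact: vmeas_norm.
  by rewrite lte_mul_pinfty// lee_fin invr_ge0 exprn_ge0// ltW.
by apply: le_vintegrable ni' => //; exact: vmeas_aff.
Qed.

Lemma vint_aff (s : R) x f : 0 < s -> vintegrable f ->
  vint (fun z => f (s *: z + x)) = s ^- m * vint f.
Proof.
move=> s0 fi; have mf := vintegrable_meas fi.
(* the change of variables is known for nonnegative functions: split f *)
pose p := fun z => `|f z| + f z.
pose n := fun z => `|f z|.
have ni : vintegrable n by exact: vintegrable_norm.
have pi : vintegrable p by exact: vintegrableD.
have p0 z : 0 <= p z.
  by rewrite /p; have := ler_norm (- f z); rewrite normrN; lra.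
have E g : (forall z, 0 <= g z) -> vintegrable g ->
    vint (fun z => g (s *: z + x)) = s ^- m * vint g.
  move=> g0 gi; apply: EFin_inj; rewrite EFinM -!eintE//; first last.
    exact: vintegrable_aff.
  exact: (eint_aff x s0 (vintegrable_meas gi) g0).
rewrite (_ : f = fun z => p z - n z); last by apply/funext => z; rewrite /p /n addrC addKr.
rewrite [RHS](_ : _ = s ^- m * vint p - s ^- m * vint n); last by rewrite -mulrBr -vintB.
rewrite -(E p p0 pi) -(E n (fun z => normr_ge0 _) ni).
exact: (vintB (vintegrable_aff x s0 pi) (vintegrable_aff x s0 ni)).
Qed.

Lemma vint_shift x f : vintegrable f -> vint (fun z => f (z + x)) = vint f.
Proof.
move=> fi; have := vint_aff x ltr01 fi; rewrite expr1n invr1 mul1r => <-.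
by congr vint; apply/funext => z; rewrite scale1r.
Qed.

Lemma vintegrable_shift x f : vintegrable f -> vintegrable (fun z => f (z + x)).
Proof.
move=> fi; have := vintegrable_aff x ltr01 fi; congr vintegrable.
by apply/funext => z; rewrite scale1r.
Qed.

Lemma vset_closed_box x r : vset (closed_box x r).
Proof.
apply: (vset_coord (B := fun i => [set u : T | `|u - x 0 i| <= r])) => i.
rewrite (_ : mkset _ = `[x 0 i - r, x 0 i + r]%classic); first exact: measurable_itv.
by apply/seteqP; split => u /=; rewrite in_itv /= ler_distl.
Qed.

Lemma vol_closed_box x r : 0 <= r -> lebesgue_vol (closed_box x r) = ((2 * r) ^+ m)%:E.
Proof.
move=> r0; rewrite (vol_coord (B := fun i => [set u : T | `|u - x 0 i| <= r])); last first.
  move=> i; rewrite (_ : mkset _ = `[x 0 i - r, x 0 i + r]%classic); first exact: measurable_itv.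
  by apply/seteqP; split => u /=; rewrite in_itv /= ler_distl.
rewrite (eq_bigr (fun=> (2 * r)%:E)).
  elim: m => [|n IH]; first by rewrite big_ord0.
  by rewrite big_ord_recl IH exprS EFinM.
move=> i _; rewrite (_ : mkset _ = `[x 0 i - r, x 0 i + r]%classic); last first.
  by apply/seteqP; split => u /=; rewrite in_itv /= ler_distl.
rewrite lebesgue_measure_itv /= lte_fin ltrBlDr -addrA ltrDl.
have [rr|rr] := ltP 0 (r + r); first by rewrite -EFinD; congr EFin; lra.
by congr EFin; lra.
Qed.

Lemma le_vol A B : vset A -> vset B -> A `<=` B ->
  (lebesgue_vol A <= lebesgue_vol B)%E.
Proof. by move=> mA mB AB; apply: le_measure; rewrite ?inE// => t; exact: AB. Qed.

Lemma eint_indic A : vset A -> eint \1_A = lebesgue_vol A.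
Proof.
move=> mA; rewrite /eint /lebesgue_vol -[in RHS](setTI (pt @^-1` A)) setIC -integral_indic//.
Qed.

Lemma vintegrable_indic A : vset A -> (lebesgue_vol A < +oo)%E -> vintegrable \1_A.
Proof.
move=> mA Ao; apply/vintegrableP; first by move=> z; rewrite indicE.
by split; [exact: vmeas_indic|rewrite eint_indic].
Qed.

Lemma vint_indic A : vset A -> vint \1_A = fine (lebesgue_vol A).
Proof. by move=> mA; rewrite vintE -eint_indic. Qed.

End VectorIntegral.

(** * Integrals of negative powers *)

Section LayerCake.
Variables (R : realType) (m : nat).
Local Notation T := (measurableTypeR R).
Local Notation V := 'rV[R]_m.
Local Notation mu := (lebesgue_tuple R m).
Local Notation pt := (@pt_of_tuple R m).

Let t_ k : R := 2^-1 ^+ k.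

Let t_gt0 k : 0 < t_ k. Proof. by rewrite exprn_gt0// invr_gt0. Qed.

Let t_le1 k : t_ k <= 1.
Proof. by rewrite exprn_ile1// ?invr_ge0// invf_le1// ler1n. Qed.

Let t_powR k x : t_ k `^ x = (2^-1 `^ x) ^+ k.
Proof. by rewrite /t_ -powR_mulrn ?invr_ge0// powRAC powR_mulrn// powR_ge0. Qed.

Lemma dyadic_shell (w : R) : 0 < w -> w < 1 -> exists k, t_ k.+1 <= w < t_ k.
Proof.
move=> w0 w1.
have ex : exists n, t_ n <= w.
  exists (Num.bound w^-1); rewrite /t_ exprVn -[leRHS]invrK lef_pV2 ?posrE ?invr_gt0 ?exprn_gt0//.
  apply: (le_trans (ltW (archi_boundP _))); first by rewrite invr_ge0 ltW.
  by rewrite -natrX ler_nat ltnW// ltn_expl.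
case: (ex_minnP ex) => -[|k] tk kmin.
  by move: tk; rewrite /t_ expr0 leNgt w1.
exists k; rewrite tk /= ltNge; apply/negP => /kmin; by rewrite ltnn.
Qed.

(** Layer cake over dyadic shells. On the shell where w is about 2^-k the integrand
   is about 2^(k s), the volume bound makes the shell at most of size 2^(- k a),
   and the resulting geometric series converges as s < a. The constant K depends
   on a and s only: later w is a distance to a moving point x. *)
Lemma eint_powR_le (a s : R) : 0 < s -> s < a -> exists2 K : R, 0 <= K &
  forall (D : set V) (w : V -> R) (M : R), vset D -> vmeas w ->
    (forall z, 0 <= w z) -> 0 <= M ->
    (forall t : R, 0 < t -> t <= 1 ->
      (lebesgue_vol (D `&` [set z : V | (w z < t)%R]) <= (M * t `^ a)%:E)%E) ->
    (eint (fun z => \1_D z * w z `^ (- s))%R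
       <= lebesgue_vol D + (M * K)%:E)%E.
Proof.
move=> s0 sa.
pose q : R := 2^-1 `^ (a - s).
have q0 : 0 <= q by exact: powR_ge0.
have q1 : q < 1.
  have h1 : 1 `^ (a - s) = 1 :> R by rewrite powR1.
  rewrite /q -[ltRHS]h1 gt0_ltr_powR ?subr_gt0 ?nnegrE ?invr_ge0//.
  by rewrite invf_lt1// ltr1n.
pose c0 : R := 2^-1 `^ (- s).
have c0_ge0 : 0 <= c0 by exact: powR_ge0.
exists (c0 / (1 - q)); first by rewrite divr_ge0// subr_ge0 ltW.
move=> D w M mD mw w0 M0 volD.
pose c k := t_ k.+1 `^ (- s).
have c_ge0 k : 0 <= c k by exact: powR_ge0.
pose B k := D `&` [set z | w z < t_ k].
have mB k : vset (B k).
  rewrite /vset preimage_setI; apply: measurableI => //.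
  rewrite (_ : _ @^-1` _ = (w \o pt) @^-1` `]-oo, t_ k[%classic).
    by rewrite -[X in measurable X]setTI; apply: mw.
  by apply/seteqP; split => t /=; rewrite in_itv.
pose S k (t : m.-tuple T) := (c k * \1_(B k) (pt t))%:E.
have S0 k t : (0 <= S k t)%E by rewrite lee_fin mulr_ge0// indicE.
have mS k : measurable_fun setT (S k).
  apply/measurable_EFinP; apply: measurable_funM => //.
  exact: (vmeas_indic (mB k)).
have mI : measurable_fun setT (fun t => (\1_D (pt t) : R)%:E).
  by apply/measurable_EFinP; exact: (vmeas_indic mD).
have ptw t : ((\1_D (pt t) * w (pt t) `^ (- s))%:E <=
    (\1_D (pt t) : R)%:E + \sum_(k <oo) S k t)%E.
  have ser0 : (0 <= \sum_(k <oo) S k t)%E by apply: nneseries_ge0.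
  have I0 : (0 <= (\1_D (pt t) : R)%:E)%E by rewrite lee_fin indicE.
  have [Dt|Dt] := boolP (pt t \in D); last first.
    by rewrite indicE (negPf Dt) mul0r adde_ge0.
  have [w1|w1] := leP 1 (w (pt t)).
    rewrite -[leLHS]adde0 leeD// lee_fin indicE Dt mul1r.
    rewrite powRN invf_le1; last by rewrite powR_gt0// (lt_le_trans ltr01).
    have h1 : 1 `^ s = 1 :> R by rewrite powR1.
    rewrite -[leLHS]h1; apply: ge0_ler_powR; rewrite ?nnegrE//; exact: ltW.
  have := w0 (pt t); rewrite le_eqVlt => /predU1P[wt0|wt0].
    rewrite -wt0 powR0 ?mulr0 ?adde_ge0//.
    by rewrite oppr_eq0 gt_eqF.
  have [k /andP[tk1 tk2]] := dyadic_shell wt0 w1.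
  apply: (@le_trans _ _ (S k t)); last first.
    rewrite -[leLHS]add0e leeD//.
    apply: (le_trans _ (nneseries_lim_ge k.+1 _)) => //.
    by rewrite big_mkord big_ord_recr/= leeDr// sume_ge0.
  rewrite lee_fin !indicE Dt mul1r (_ : _ \in B k) ?mulr1; last first.
    by rewrite inE; split => //; exact: set_mem.
  rewrite /c !powRN lef_pV2 ?posrE ?powR_gt0//.
  by apply: ge0_ler_powR; rewrite ?nnegrE// ltW.
have mSS : measurable_fun setT (fun t => \sum_(k <oo) S k t)%E.
  exact: ge0_emeasurable_sum.
apply: (@le_trans _ _ (\int[mu]_t ((\1_D (pt t) : R)%:E + \sum_(k <oo) S k t))%E).
  apply: ge0_le_integral => //=.
  - by move=> t _; rewrite lee_fin mulr_ge0// ?powR_ge0// indicE.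
  - have mww : vmeas (fun z => w z `^ (- s)).
      by apply: (vmeas_comp (h := fun x => x `^ (- s))) => //; exact: measurable_powR.
    apply/measurable_EFinP; exact: (vmeasM (vmeas_indic mD) mww).
  - exact: emeasurable_funD.
rewrite ge0_integralD//; first last.
  by move=> t _; apply: nneseries_ge0 => k _ _; exact: S0.
apply: leeD; first by rewrite -(eint_indic mD).
rewrite integral_nneseries//.
apply: lime_le; first by apply: is_cvg_nneseries => k _ _; exact: integral_ge0.
apply: nearW => n; rewrite big_mkord.
apply: (@le_trans _ _ (\sum_(k < n) (M * c0 * q ^+ k)%:E)%E).
  apply: lee_sum => k _.
  rewrite /S; under eq_integral do rewrite EFinM.
  have mIB : measurable_fun setT (fun t => (\1_(B k) (pt t) : R)%:E).
    by apply/measurable_EFinP; exact: (vmeas_indic (mB k)).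
  rewrite ge0_integralZl_EFin//.
  rewrite -/(eint \1_(B k)) eint_indic//.
  apply: (@le_trans _ _ ((c k)%:E * (M * t_ k `^ a)%:E)%E).
    by apply: lee_wpmul2l; [rewrite lee_fin | exact: volD].
  rewrite -EFinM lee_fin le_eqVlt; apply/orP; left; apply/eqP.
  have qE : q = 2^-1 `^ a * c0.
    by rewrite /q /c0 powRD//; apply/implyP => _; rewrite gt_eqF// invr_gt0.
  by rewrite /c !t_powR exprS -/c0 qE exprMn; ring.
rewrite sumEFin lee_fin -mulr_sumr -mulrA ler_wpM2l// ler_wpM2l//.
rewrite -[leRHS]mul1r ler_pdivlMr ?subr_gt0// mulrC.
have -> : \sum_(i < n) q ^+ i = series (geometric 1 q) n.
  by rewrite /series /= big_mkord; apply: eq_bigr => i _; rewrite mul1r.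
rewrite geometric_seriesE ?lt_eqF//= mul1r mulrC divfK ?gt_eqF ?subr_gt0//.
by rewrite gerBl exprn_ge0.
Qed.
End LayerCake.

(** * Volume of tubes around a summable set *)

Section Distance.
Variables (R : realType) (m : nat).
Local Notation V := 'rV[R]_m.
Implicit Types (x y : V) (A G : set V).

Let has_lb x A : has_lbound [set enorm (x - y) | y in A].
Proof. by exists 0 => _ [y _ <-]; exact: enorm_ge0. Qed.

Lemma dist_to_ge0 x A : 0 <= dist_to x A.
Proof.
rewrite /dist_to; have [->|/set0P A0] := eqVneq A set0; first by rewrite image_set0 inf0.
by apply: lb_le_inf; [exact: image_nonempty | move=> _ [y _ <-]; exact: enorm_ge0].
Qed.

Lemma dist_to_le x y A : A y -> dist_to x A <= enorm (x - y).
Proof. by move=> Ay; apply: ge_inf; [exact: has_lb | exists y]. Qed.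

Lemma dist_to_lt x A t : A !=set0 -> dist_to x A < t ->
  exists2 y, A y & enorm (x - y) < t.
Proof.
by move=> A0 /inf_lt[|_ [y Ay <-] yt]; [exact: image_nonempty | exists y].
Qed.

Lemma dist_to_lipschitz A x y : A !=set0 -> `|dist_to x A - dist_to y A| <= 1 * enorm (x - y).
Proof.
move=> A0; rewrite mul1r.
have H u v : dist_to u A - dist_to v A <= enorm (u - v).
  rewrite lerBlDr; apply/ler_addgt0Pl => e e0.
  have [|w Aw vw] := @dist_to_lt v A (dist_to v A + e) A0; first by rewrite ltrDl.
  apply: (le_trans (dist_to_le u Aw)).
  have -> : u - w = (u - v) + (v - w) by rewrite addrA subrK.
  apply: (le_trans (enormD _ _)); lra.
by rewrite ler_norml H andbT lerNl opprB enormBC H.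
Qed.

Lemma continuous_dist_to A : A !=set0 -> continuous (fun x => dist_to x A).
Proof. by move=> A0; apply: lipschitz_continuous => x y; exact: dist_to_lipschitz. Qed.

End Distance.

Section CoveringNumber.
Variables (R : realType) (m : nat).
Local Notation V := 'rV[R]_m.
Local Notation lam := (@lebesgue_measure R).
Implicit Types G : set V.

Lemma covering_number_ge0 G (t : R) : (0 <= covering_number G t)%E.
Proof. by apply: le_ereal_inf_tmp => _ [s _ <-]; rewrite lee_fin. Qed.

Lemma covering_number_anti G (s t : R) : s <= t ->
  (covering_number G t <= covering_number G s)%E.
Proof.
move=> st; apply: ereal_inf_le_tmp => _ [l lP <-]; exists l => // x /lP[c cl xc].
by exists c => //; exact: lt_le_trans st.
Qed.

Lemma measurable_covering_number G (D : set R) : measurable D ->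
  measurable_fun (D : set (measurableTypeR R)) (covering_number G).
Proof.
move=> mD; apply: (measurable_funS measurableT) => //.
apply: (measurability _ (ErealGenCInfty.measurableE R)) => //.
move=> _ [_ [a ->] <-]; rewrite setTI; apply: is_interval_measurable.
move=> x y /=; rewrite !in_itv /= !andbT => xa ya z /andP[xz zy].
by rewrite in_itv /= andbT (le_trans ya)// covering_number_anti.
Qed.

(** The covering number is nonincreasing, so its weighted integral over
   ]t / 2, t] is at least N(t) times a multiple of t^d; summability bounds it. *)
Lemma d_summable_cover (d : R) G : 1 <= d -> d_summable d G ->
  exists2 M : R, 0 <= M & forall t : R, 0 < t -> t <= 1 ->
  exists2 s : seq V, (forall x, G x -> exists2 c, c \in s & enorm (x - c) < t) &
    (size s)%:R <= M * t `^ (- d).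
Proof.
move=> d1 sumd.
pose J : \bar R := (\int[lam]_(t in `]0%R, 1%R])
     (covering_number G t * ((t `^ (d - 1))%R%:E)))%E.
have Joo : (J < +oo)%E by exact: sumd.
have d1' : 0 <= d - 1 by rewrite subr_ge0.
have f0 t : (0 <= covering_number G t * (t `^ (d - 1))%:E)%E.
  by rewrite mule_ge0 ?covering_number_ge0// lee_fin powR_ge0.
have mf : measurable_fun (`]0%R, 1%R] : set (measurableTypeR R))
    (fun t => covering_number G t * (t `^ (d - 1))%:E)%E.
  apply: emeasurable_funM; first exact: measurable_covering_number.
  apply/measurable_EFinP; apply: (measurable_funS measurableT) => //.
have J0 : (0 <= J)%E by apply: integral_ge0 => t _; exact: f0.
have Jfin : J = (fine J)%:E by rewrite fineK// ge0_fin_numE.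
have key (t : R) : 0 < t -> t <= 1 ->
    (covering_number G t * ((t / 2) `^ d)%:E <= (fine J)%:E)%E.
  move=> t0 t1; rewrite -Jfin.
  have t2 : 0 < t / 2 by rewrite divr_gt0.
  have sub : (`]t / 2, t] : set R) `<=` `]0, 1].
    move=> u /=; rewrite !in_itv /= => /andP[u1 u2].
    by rewrite (lt_trans t2 u1) (le_trans u2 t1).
  apply: (@le_trans _ _ (\int[lam]_(u in `](t / 2)%R, t]) (covering_number G t * ((t / 2) `^ (d - 1))%R%:E))%E); last first.
    apply: (@le_trans _ _ (\int[lam]_(u in `](t / 2)%R, t]) (covering_number G u * (u `^ (d - 1))%R%:E))%E); last first.
      by apply: ge0_subset_integral => //.
    apply: ge0_le_integral => //.
    - by move=> u _; rewrite mule_ge0 ?covering_number_ge0// lee_fin powR_ge0.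
    - exact: measurable_funS mf.
    - move=> u /=; rewrite in_itv /= => /andP[u1 u2].
      apply: lee_pmul; rewrite ?covering_number_ge0// ?lee_fin ?powR_ge0//.
        exact: covering_number_anti.
      by apply: ge0_ler_powR; rewrite ?nnegrE ?(ltW t2)//; [exact: ltW (lt_trans t2 u1)| exact: ltW].
  rewrite integral_cst//= lebesgue_measure_itv /= lte_fin ltr_pdivrMr// ltr_pMr// ltr1n.
  rewrite -EFinD -muleA -EFinM (_ : t - t / 2 = t / 2); last by lra.
  by rewrite [X in (_ <= _ * X%:E)%E]mulrC mulr_powRB1 ?(ltW t2)// (lt_le_trans ltr01).
exists (fine J * 2 `^ d + 1); first by rewrite addr_ge0// mulr_ge0 ?powR_ge0// fine_ge0.
move=> t t0 t1.
have t2 : 0 < t / 2 by rewrite divr_gt0.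
have kd : 0 < (t / 2) `^ d by rewrite powR_gt0.
have : (covering_number G t < (fine J / (t / 2) `^ d + 1)%:E)%E.
  apply: (@le_lt_trans _ _ (fine J / (t / 2) `^ d)%:E).
    by rewrite EFinM lee_pdivlMr// key.
  by rewrite lte_fin ltrDl.
move=> /ereal_inf_lt[_ [s sP <-]]; rewrite lte_fin => sz.
exists s => //; apply: (le_trans (ltW sz)).
rewrite mulrDl mul1r; apply: lerD.
  have h : (t / 2) `^ d = t `^ d / 2 `^ d.
    by rewrite powRM ?invr_ge0 ?(ltW t0)// -powR_inv1// -powRrM mulN1r powRN.
  by rewrite h invf_div powRN mulrA.
have h1 : 1 `^ d = 1 :> R by rewrite powR1.
rewrite powRN -[leLHS]invr1 lef_pV2 ?posrE ?powR_gt0//.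
by rewrite -[leRHS]h1 ge0_ler_powR ?nnegrE ?(le_trans ler01 d1) ?(ltW t0).
Qed.
End CoveringNumber.

Section TubeVolume.
Variables (R : realType) (m : nat).
Local Notation V := 'rV[R]_m.
Implicit Types (G D : set V).

Lemma vol_cover_boxes (s : seq V) (r : R) (A : set V) : 0 <= r -> vset A ->
  (forall x, A x -> exists2 c, c \in s & closed_box c r x) ->
  (lebesgue_vol A <= ((size s)%:R * (2 * r) ^+ m)%:E)%E.
Proof.
move=> r0; elim: s A => [|c s IH] A mA As.
  rewrite mul0r (_ : A = set0) /lebesgue_vol ?preimage_set0 ?measure0//.
  by apply/seteqP; split => // x /As[].
pose A1 := A `&` closed_box c r; pose A2 := A `\` closed_box c r.
have mB := vset_closed_box c r.
have mA1 : vset A1 by rewrite /vset preimage_setI; exact: measurableI.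
have mA2 : vset A2 by exact: (measurableD mA mB).
have AE : A = A1 `|` A2 by rewrite /A1 /A2 setUIDK.
apply: (@le_trans _ _ (lebesgue_vol A1 + lebesgue_vol A2)%E).
  by rewrite {1}AE /lebesgue_vol preimage_setU; exact: measureU2.
rewrite /= -[X in X%:R]add1n natrD mulrDl mul1r EFinD; apply: leeD.
  rewrite -(vol_closed_box c r0); apply: le_vol => // x [].
  by [].
apply: IH => // x [Ax nB]; have [c' + xc'] := As x Ax.
by rewrite inE => /predU1P[c'E|c's]; [rewrite c'E in xc' | exists c'].
Qed.

Lemma vol_ball_le x D (t : R) : vset D -> 0 < t ->
  (lebesgue_vol (D `&` [set y : V | (enorm (y - x)%R < t)%R]) <= ((2 ^+ m) * t `^ m%:R)%:E)%E.
Proof.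
move=> mD t0; rewrite powR_mulrn ?(ltW t0)// -exprMn -(vol_closed_box x (ltW t0)).
apply: le_vol; [|exact: vset_closed_box|].
  rewrite /vset preimage_setI; apply: measurableI => //.
  apply: (@vset_open _ _ [set y : V | enorm (y - x) < t]).
  rewrite openE => y /= yx; apply/nbhs_enormP.
  exists (t - enorm (y - x)); first by rewrite subr_gt0.
  move=> z zy /=; rewrite (_ : z - x = (z - y) + (y - x)); last by rewrite addrA subrK.
  by apply: (le_lt_trans (enormD _ _)); rewrite -ltrBrDr.
move=> y [_ /= yx] i; apply: (le_trans _ (ltW yx)).
by have := coord_le_enorm (y - x) i; rewrite !mxE.
Qed.

(** A point at distance less than t from G is within 2 t of a centre of any cover
   of G by balls of radius t. *)
Lemma vol_tube_le (d : R) G : 1 <= d -> d_summable d G -> G !=set0 ->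
  exists2 M : R, 0 <= M & forall D (t : R), vset D -> 0 < t -> t <= 1 ->
  (lebesgue_vol (D `&` [set y : V | (dist_to y G < t)%R]) <= (M * t `^ (m%:R - d))%:E)%E.
Proof.
move=> d1 sumd G0; have [M M0 cov] := d_summable_cover d1 sumd.
exists (M * 4 ^+ m); first by rewrite mulr_ge0// exprn_ge0.
move=> D t mD t0 t1; have [s sP sz] := cov t t0 t1.
have mA : vset (D `&` [set y : V | dist_to y G < t]).
  rewrite /vset preimage_setI; apply: measurableI => //.
  rewrite -/(vset _) (_ : mkset _ = (fun y => dist_to y G) @^-1` `]-oo, t[%classic).
    apply: vset_open; apply: open_comp => [y _|]; last exact: interval_open.
    exact: continuous_dist_to.
  by apply/seteqP; split => y /=; rewrite in_itv.
apply: le_trans (vol_cover_boxes (s := s) (r := 2 * t) _ mA _) _.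
- by rewrite mulr_ge0// ltW.
- move=> y [_ /= /(dist_to_lt G0)[z Gz yz]]; have [c cs zc] := sP z Gz.
  exists c => // i; have := coord_le_enorm (y - c) i; rewrite !mxE => /le_trans; apply.
  rewrite -(subrK z y) -addrA; apply: (le_trans (enormD _ _)).
  lra.
- rewrite lee_fin mulrA (_ : 2 * 2 = 4); last by ring.
  rewrite exprMn mulrA -(powR_mulrn m (ltW t0)).
  rewrite (_ : m%:R - d = - d + m%:R); last by rewrite addrC.
  rewrite powRD; last by apply/implyP => _; rewrite gt_eqF.
  rewrite [leRHS](_ : _ = M * t `^ (- d) * 4 ^+ m * t `^ m%:R); last by ring.
  by rewrite ler_wpM2r ?powR_ge0// ler_wpM2r// exprn_ge0.
Qed.
End TubeVolume.

(** * Densities and their weighted mass *)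

(** More singular by delta than the kernels of order 1 - m, the gradients of the
   Newton kernel: increments of kernels are paid for with the surplus. *)
HB.lock Definition weight (R : realType) (m : nat) (delta : R) (z : 'rV[R]_m) : R :=
  enorm z `^ (- (m%:R - 1 + delta)).

Section Density.
Variables (R : realType) (m : nat).
Local Notation V := 'rV[R]_m.
Implicit Types (x y z : V) (h : V -> R) (G U : set V).

Local Notation weight := (@weight R m).

Lemma weightE (delta : R) z : weight delta z = enorm z `^ (- (m%:R - 1 + delta)).
Proof. by rewrite weight.unlock. Qed.

(** The mass against the weight is bounded independently of its centre. This
   uniformity replaces boundedness of h, which fails near the boundary. *)
Definition density (delta C D : R) h :=
  [/\ vintegrable h, forall y, D < enorm y -> h y = 0 &
      forall x, vintegrable (fun y => weight delta (y - x) * `|h y|) /\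
        vint (fun y => weight delta (y - x) * `|h y|) <= C].

Lemma weight_ge0 delta z : 0 <= weight delta z.
Proof. by rewrite weightE; exact: powR_ge0. Qed.

Lemma vmeas_enormB x : vmeas (fun y => enorm (y - x)).
Proof.
have := vmeas_aff 1 (- x) (@vmeas_enorm R m); congr vmeas.
by apply/funext => y; rewrite scale1r.
Qed.

Lemma vmeas_powR (f : V -> R) (s : R) : vmeas f -> vmeas (fun y => f y `^ s).
Proof. by move=> mf; apply: (vmeas_comp (h := fun u => u `^ s)) => //; exact: measurable_powR. Qed.

Lemma vmeas_weight delta x : vmeas (fun y => weight delta (y - x)).
Proof.
under eq_fun do rewrite weightE.
by apply: vmeas_powR; exact: vmeas_enormB.
Qed.

Lemma ge0_vint_le (f : V -> R) (C : R) : (forall z, 0 <= f z) -> vmeas f ->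
  (eint f <= C%:E)%E -> vintegrable f /\ vint f <= C.
Proof.
move=> f0 mf fC; have fi : vintegrable f.
  by apply/vintegrableP => //; split => //; apply: le_lt_trans fC _; exact: ltry.
by split => //; rewrite -lee_fin -eintE.
Qed.

Lemma vint_powR_dist_le (s : R) : 0 < s -> s < m%:R -> exists2 K : R, 0 <= K &
  forall U x, vset U -> (lebesgue_vol U < +oo)%E ->
    vintegrable (fun y => \1_U y * enorm (y - x) `^ (- s)) /\
    vint (fun y => \1_U y * enorm (y - x) `^ (- s)) <= fine (lebesgue_vol U) + K.
Proof.
move=> s0 sm; have [K K0 KP] := @eint_powR_le R m _ _ s0 sm.
exists (2 ^+ m * K); first by rewrite mulr_ge0// exprn_ge0.
move=> U x mU Uoo; apply: ge0_vint_le.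
- by move=> z; rewrite mulr_ge0 ?powR_ge0// indicE.
- apply: (vmeasM (vmeas_indic mU)); apply: vmeas_powR; exact: vmeas_enormB.
- rewrite EFinD fineK ?ge0_fin_numE ?measure_ge0//; apply: KP => //.
  + exact: vmeas_enormB.
  + by move=> z; exact: enorm_ge0.
  + by move=> t t0 _; exact: vol_ball_le.
Qed.

Lemma vol_bounded_fin U (D : R) : vset U -> (forall y, U y -> enorm y <= D) ->
  (lebesgue_vol U < +oo)%E.
Proof.
move=> mU UD; apply: (@le_lt_trans _ _ (lebesgue_vol (closed_box (0 : V) `|D|))).
  apply: le_vol => //; first exact: vset_closed_box.
  move=> y /UD yD i; rewrite mxE subr0 (le_trans (coord_le_enorm _ _))//.
  by rewrite (le_trans yD)// ler_norm.
by rewrite vol_closed_box// ltry.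
Qed.

Lemma vset_enorm_le (D : R) : vset [set y : V | enorm y <= D].
Proof.
rewrite (_ : mkset _ = (@enorm R m) @^-1` `]-oo, D]%classic); last first.
  by apply/seteqP; split => y /=; rewrite in_itv.
apply: vset_closed; apply: closed_comp => [y _|]; last exact: interval_closed.
exact: continuous_enorm.
Qed.

(** Bounded functions with bounded support are densities: the weight is less
   singular than a power of order m. *)
Lemma bounded_density (delta B D : R) h : (0 < m)%N -> 0 < delta -> delta < 1 ->
  vmeas h -> (forall y, `|h y| <= B) -> (forall y, D < enorm y -> h y = 0) ->
  exists C, density delta C D h.
Proof.
move=> m0 d0 d1 mh hB hD.
pose U := [set y : V | enorm y <= D].
have mU : vset U by exact: vset_enorm_le.
have Uoo : (lebesgue_vol U < +oo)%E by exact: (@vol_bounded_fin U D).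
have m1 : 1 <= m%:R :> R by rewrite ler1n.
have B0 : 0 <= B by apply: le_trans (hB 0).
have s0 : 0 < m%:R - 1 + delta by lra.
have sm : m%:R - 1 + delta < m%:R by lra.
have [K K0 KP] := vint_powR_dist_le s0 sm.
have hU y : `|h y| <= B * \1_U y.
  rewrite indicE; have [yU|yU] := boolP (y \in U); first by rewrite mulr1.
  rewrite mulr0 hD ?normr0// ltNge; apply: contra yU => yD.
  by rewrite inE.
exists (B * (fine (lebesgue_vol U) + K)); split => // [|x].
  apply: (le_vintegrable mh hU).
  by apply: vintegrableZ; exact: vintegrable_indic.
have [Ki KC] := KP U x mU Uoo.
have mw : vmeas (fun y => weight delta (y - x) * `|h y|).
  by apply: vmeasM; [exact: vmeas_weight | exact: vmeas_norm].
have dom y : `|weight delta (y - x) * `|h y| | <=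
    B * (\1_U y * enorm (y - x) `^ (- (m%:R - 1 + delta))).
  rewrite -weightE [leRHS]mulrA [leRHS]mulrC ger0_norm; last by rewrite mulr_ge0// weight_ge0.
  exact: (ler_wpM2l (weight_ge0 _ _) (hU y)).
have BKi := vintegrableZ B Ki.
split; first exact: le_vintegrable mw dom BKi.
apply: (le_trans (ler_norm _)); apply: (le_trans (le_norm_vint mw BKi dom)).
by rewrite vintZ// ler_wpM2l.
Qed.

(** Young's inequality separates the two singularities of the integrand: the one
   at x, integrable below order m, and the one along G, where by vol_tube_le the
   distance is integrable below order m - d. That exponents exist for which both
   are subcritical is exactly the condition d / m < nu. *)
Lemma tube_density (d nu c D : R) G U h : (1 < m)%N -> 1 <= d -> d < m%:R ->
  0 < nu -> nu < 1 -> d / m%:R < nu -> d_summable d G -> G !=set0 ->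
  vset U -> (forall y, U y -> enorm y <= D) -> vmeas h ->
  (forall y, ~ U y -> h y = 0) ->
  (forall y, U y -> `|h y| <= c * dist_to y G `^ (nu - 1)) ->
  exists delta C, [/\ 0 < delta, delta < 1 & density delta C D h].
Proof.
move=> m1 d1 dm nu0 nu1 dnu sumd G0 mU UD mh h0 hc.
have M0 : 0 < m%:R :> R by rewrite ltr0n (ltn_trans _ m1).
have M1 : 1 < m%:R :> R by rewrite ltr1n.
have md : 0 < m%:R - d by rewrite subr_gt0.
pose gam := 1 - nu.
have gam0 : 0 < gam by rewrite subr_gt0.
(* this is d / m < nu; tau is chosen between the two sides *)
have gm : gam / (m%:R - d) < m%:R^-1.
  rewrite ltr_pdivrMr// mulrC mulrBl divff ?gt_eqF// /gam.
  by rewrite ltrBlDr addrAC ltrBrDr; lra.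
pose tau := (gam / (m%:R - d) + m%:R^-1) / 2.
have tau1 : gam / (m%:R - d) < tau by rewrite /tau; lra.
have tau2 : tau < m%:R^-1 by rewrite /tau; lra.
have tau0 : 0 < tau by apply: lt_trans tau1; rewrite divr_gt0.
have mtau : m%:R * tau < 1 by rewrite -ltr_pdivlMl// mulr1.
have mtau0 : 0 < m%:R * tau by rewrite mulr_gt0.
have tau_lt1 : tau < 1 by apply: (lt_trans tau2); rewrite invf_lt1.
(* small enough for s = (m - 1 + delta) / (1 - tau) to stay below m *)
pose delta := (1 - m%:R * tau) / 2.
have delta0 : 0 < delta by rewrite /delta; lra.
have delta1 : delta < 1 by rewrite /delta; lra.
pose alpha := m%:R - 1 + delta.
have alpha0 : 0 < alpha by rewrite /alpha; lra.
pose s := alpha / (1 - tau).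
have s0 : 0 < s by rewrite divr_gt0// subr_gt0.
have sm : s < m%:R by rewrite ltr_pdivrMr ?subr_gt0// /alpha /delta mulrBr; lra.
pose s' := gam / tau.
have s'0 : 0 < s' by rewrite divr_gt0.
have s'm : s' < m%:R - d by rewrite ltr_pdivrMr// mulrC -ltr_pdivrMr.
have gamm : gam < m%:R - d by apply: lt_trans s'm; rewrite ltr_pdivlMr// gtr_pMr.
have [K K0 KP] := vint_powR_dist_le s0 sm.
have [M Mge0 tube] := vol_tube_le d1 sumd G0.
have Uoo : (lebesgue_vol U < +oo)%E by exact: (vol_bounded_fin mU UD).
have mdist : vmeas (fun y => dist_to y G) by apply: vmeas_continuous; exact: continuous_dist_to.
have distint (r : R) : 0 < r -> r < m%:R - d -> exists C,
    vintegrable (fun y => \1_U y * dist_to y G `^ (- r)) /\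
    vint (fun y => \1_U y * dist_to y G `^ (- r)) <= C.
  move=> r0 rm; have [K' K'0 K'P] := @eint_powR_le R m _ _ r0 rm.
  exists (fine (lebesgue_vol U) + M * K'); apply: ge0_vint_le.
  - by move=> z; rewrite mulr_ge0 ?powR_ge0// indicE.
  - by apply: (vmeasM (vmeas_indic mU)); exact: vmeas_powR.
  - rewrite EFinD fineK ?ge0_fin_numE ?measure_ge0//; apply: K'P => //.
    + by move=> z; exact: dist_to_ge0.
    + by move=> t t0 t1; exact: tube.
have [K' [K'i K'C]] := distint _ s'0 s'm.
have [K'' [K''i _]] := distint _ gam0 gamm.
have hU y : `|h y| <= `|c| * (\1_U y * dist_to y G `^ (- gam)).
  rewrite indicE; have [yU|yU] := boolP (y \in U).
    rewrite mul1r (le_trans (hc y (set_mem yU)))// /gam opprB.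
    by rewrite ler_wpM2r ?powR_ge0// ler_norm.
  by rewrite mul0r mulr0 h0 ?normr0// => /mem_set yU'; rewrite yU' in yU.
exists delta, (`|c| * (fine (lebesgue_vol U) + K + K')); split => //; split.
- by apply: (le_vintegrable mh hU); exact: vintegrableZ.
- by move=> y Dy; apply: h0 => /UD; rewrite leNgt Dy.
- move=> x; have [Ki KC] := KP U x mU Uoo.
  have mw : vmeas (fun y => weight delta (y - x) * `|h y|).
    by apply: vmeasM; [exact: vmeas_weight | exact: vmeas_norm].
  have bnd := vintegrableZ `|c| (vintegrableD Ki K'i).
  have dom y : `|weight delta (y - x) * `|h y| | <=
      `|c| * (\1_U y * enorm (y - x) `^ (- s) + \1_U y * dist_to y G `^ (- s')).
    rewrite ger0_norm ?mulr_ge0 ?weight_ge0//.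
    apply: (le_trans (ler_wpM2l (weight_ge0 _ _) (hU y))).
    rewrite mulrCA; apply: ler_wpM2l => //.
    rewrite mulrCA -mulrDr; apply: ler_wpM2l; first by rewrite indicE.
    (* Young's inequality with exponents 1 / (1 - tau) and 1 / tau *)
    have p0 : 0 < (1 - tau)^-1 by rewrite invr_gt0 subr_gt0.
    have q0 : 0 < tau^-1 by rewrite invr_gt0.
    have pq : (1 - tau)^-1^-1 + tau^-1^-1 = 1 by rewrite !invrK subrK.
    apply: (le_trans (conjugate_powR (weight_ge0 delta (y - x)) (powR_ge0 (dist_to y G) (- gam)) p0 q0 pq)).
    rewrite !invrK weightE -!powRrM !mulNr -/s -/s'.
    by apply: lerD; apply: (ler_piMr (powR_ge0 _ _)); lra.
  split; first exact: le_vintegrable mw dom bnd.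
  apply: (le_trans (ler_norm _)); apply: (le_trans (le_norm_vint mw bnd dom)).
  rewrite vintZ; last exact: vintegrableD.
  by rewrite ler_wpM2l// vintD// lerD.
Qed.
End Density.

(** * Homogeneous kernels *)

Section Lines.
Variables (R : realType) (W : normedModType R).
Implicit Types (f : W -> R) (x v : W).

Lemma is_derive_lineP f x v (s d : R) :
  is_derive (x + s *: v) v f d -> is_derive s 1 (fun t : R => f (x + t *: v)) d.
Proof.
move=> /is_deriveP h; apply/is_deriveP => e e0; have [tau tau0 tauP] := h e e0.
exists tau => // t t0 tt; have := tauP t t0 tt.
by rewrite -(addrA x) -scalerDl [t%:A]mulr1.
Qed.

Lemma MVT_line f x v (df : R -> R) :
  (forall t : R, 0 <= t -> t <= 1 -> is_derive (x + t *: v) v f (df t)) ->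
  exists t : R, [/\ 0 <= t, t <= 1 & f (x + v) - f x = df t].
Proof.
move=> fd; pose g (t : R) := f (x + t *: v).
have gd (t : R) : 0 <= t -> t <= 1 -> is_derive t 1 g (df t).
  by move=> t0 t1; apply: is_derive_lineP; exact: fd.
have [||t] := @MVT R g df 0 1 ltr01.
- by move=> t; rewrite in_itv /= => /andP[t0 t1]; apply: gd; exact: ltW.
- apply: derivable_within_continuous => t; rewrite in_itv /= => /andP[t0 t1].
  by have [] := gd t t0 t1.
- rewrite in_itv /= => /andP[t0 t1]; rewrite /g scale1r scale0r addr0 subr0 mulr1 => E.
  by exists t; split; rewrite ?ltW.
Qed.
End Lines.

Section Kernels.
Variables (R : realType) (m : nat).
Local Notation V := 'rV[R]_m.
Implicit Types (K : V -> R) (z w v : V).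

(** Kernels of order - n, smooth away from 0. The class is given by generators, so
   that bounds, measurability and closure under differentiation (which lowers
   the order by one) are inductions; every kernel of the transforms belongs to it. *)
Inductive riesz : nat -> (V -> R) -> Prop :=
| riesz_pow n : riesz n (fun z => (enorm z ^+ n)^-1)
| riesz_coord n j K : riesz n.+1 K -> riesz n (fun z => z 0 j * K z)
| rieszD n K1 K2 : riesz n K1 -> riesz n K2 -> riesz n (fun z => K1 z + K2 z)
| rieszZ n c K : riesz n K -> riesz n (fun z => c * K z).

Lemma riesz_vmeas n K : riesz n K -> vmeas K.
Proof.
elim=> {n K} [n|n j K _ mK|n K1 K2 _ m1 _ m2|n c K _ mK].
- rewrite (_ : (fun _ => _) = fun z : V => enorm z `^ (- n%:R)).
    by apply: vmeas_powR; exact: vmeas_enorm.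
  by apply/funext => z; rewrite powR_invn// enorm_ge0.
- by apply: vmeasM => //; exact: vmeas_coord.
- exact: vmeasD.
- by apply: vmeasM => //; exact: vmeas_cst.
Qed.

Lemma riesz_bound n K : riesz n K ->
  exists2 C : R, 0 <= C & forall z, `|K z| <= C * (enorm z ^+ n)^-1.
Proof.
elim=> {n K} [n|n j K _ [C C0 KC]|n K1 K2 _ [C1 C10 K1C] _ [C2 C20 K2C]|n c K _ [C C0 KC]].
- by exists 1 => // z; rewrite mul1r ger0_norm// invr_ge0 exprn_ge0// enorm_ge0.
- exists C => // z; rewrite normrM.
  have := enorm_ge0 z; rewrite le_eqVlt => /predU1P[z0|z0].
    have : `|z 0 j| <= 0 by rewrite [leRHS]z0; exact: coord_le_enorm.
    rewrite normr_le0 => /eqP ->; rewrite normr0 mul0r mulr_ge0//.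
    by rewrite invr_ge0 exprn_ge0// enorm_ge0.
  apply: (le_trans (ler_pM (normr_ge0 _) (normr_ge0 _) (coord_le_enorm z j) (KC z))).
  by rewrite exprS invfM mulrCA mulVKf// gt_eqF.
- exists (C1 + C2); first exact: addr_ge0.
  by move=> z; rewrite mulrDl (le_trans (ler_normD _ _))// lerD.
- exists (`|c| * C); first exact: mulr_ge0.
  by move=> z; rewrite normrM -mulrA ler_wpM2l.
Qed.

Lemma is_derive_enormV n z v : z != 0 ->
  is_derive z v (fun z => (enorm z ^+ n)^-1)
    (\sum_i v 0 i * (- n%:R * (z 0 i * (enorm z ^+ n.+2)^-1))).
Proof.
move=> z0; have r0 : 0 < enorm z by rewrite enorm_gt0.
pose q (t : R) := (dotv v v * t + 2 * dotv z v) * t + dotv z z.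
have qE t : dotv (z + t *: v) (z + t *: v) = q t.
  by rewrite dotvDl !dotvDr !dotvZl !dotvZr (dotvC v z) /q; ring.
have qd : is_derive (0 : R) 1 q (2 * dotv z v).
  apply: is_derive_eq; rewrite /GRing.scale /=; ring.
have q0 : 0 < q 0 by rewrite -qE scale0r addr0 -sqr_enorm exprn_gt0.
have sd := is_derive1_sqrt q0.
have sqd : is_derive (0 : R) 1 (Num.sqrt \o q) ((2 * Num.sqrt (q 0))^-1 * (2 * dotv z v)).
  exact: is_derive1_comp.
have s0 : Num.sqrt (q 0) = enorm z by rewrite -qE scale0r addr0.
have pd : is_derive (0 : R) 1 (fun t => ((Num.sqrt \o q) t ^+ n)^-1)
   (- (enorm z ^+ n) ^- 2 *: ((n%:R * enorm z ^+ n.-1) *: ((2 * Num.sqrt (q 0))^-1 * (2 * dotv z v)))).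
  rewrite -{1 2}s0; apply: is_deriveV.
    by rewrite /= s0 expf_neq0// gt_eqF.
  rewrite (_ : (fun y => _ ^+ n) = ((Num.sqrt \o q : R -> R) ^+ n)).
    exact: is_deriveX.
  by apply/funext => y; rewrite exprfctE.
have {}pd : is_derive z v (fun z => (enorm z ^+ n)^-1)
   (- (enorm z ^+ n) ^- 2 *: ((n%:R * enorm z ^+ n.-1) *: ((2 * Num.sqrt (q 0))^-1 * (2 * dotv z v)))).
  move/is_deriveP: pd => h; apply/is_deriveP => e e0; have [tau tau0 tauP] := h e e0.
  exists tau => // t t0 tt; have := tauP t t0 tt.
  by rewrite /= add0r [t%:A]mulr1 s0 /enorm qE.
apply: (is_derive_eq (df := _)) pd _.
rewrite s0 /GRing.scale /=.
have -> : \sum_i v 0 i * (- n%:R * (z 0 i * (enorm z ^+ n.+2)^-1)) =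
    - n%:R * (enorm z ^+ n.+2)^-1 * dotv z v.
  by rewrite /dotv mulr_sumr; apply: eq_bigr => i _; ring.
have rn : enorm z != 0 by rewrite gt_eqF.
case: n => [|n]; first by rewrite mulr0n oppr0 !(mul0r, mulr0).
rewrite /= -(addn1 n.+2) !exprD !exprS; field; by rewrite ?expf_neq0 ?rn.
Qed.

Lemma is_derive_coordM j K (dK : 'I_m -> R) z v :
  is_derive z v K (\sum_i v 0 i * dK i) ->
  is_derive z v (fun z => z 0 j * K z) (\sum_i v 0 i * ((i == j)%:R * K z + z 0 j * dK i)).
Proof.
move=> Kd; have cd : is_derive z v (fun z : V => z 0 j) (v 0 j).
  apply/is_deriveP => e e0; exists 1 => // t t0 _.
  rewrite !mxE (_ : _ - _ = 0); last by ring.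
  by rewrite normr0 mulr_ge0// ltW.
apply: (is_derive_eq (is_deriveM cd Kd)); rewrite /GRing.scale /=.
under [RHS]eq_bigr do rewrite mulrDr.
rewrite big_split /= [RHS]addrC; congr (_ + _).
  by rewrite mulr_sumr; apply: eq_bigr => i _; ring.
rewrite (bigD1 j)//= big1 ?addr0 ?eqxx ?mul1r 1?mulrC// => i ij.
by rewrite (negPf ij) mul0r mulr0.
Qed.

Lemma riesz_derive n K : riesz n K -> exists2 dK : 'I_m -> V -> R,
  forall i, riesz n.+1 (dK i) &
  forall z v, z != 0 -> is_derive z v K (\sum_i v 0 i * dK i z).
Proof.
elim=> {n K} [n|n j K Kn [dK dKn dKP]|n K1 K2 _ [d1 d1n d1P] _ [d2 d2n d2P]|n c K _ [dK dKn dKP]].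
- exists (fun i z => - n%:R * (z 0 i * (enorm z ^+ n.+2)^-1)).
    by move=> i; apply: rieszZ; apply: riesz_coord; exact: riesz_pow.
  by move=> z v; exact: is_derive_enormV.
- exists (fun i z => (i == j)%:R * K z + z 0 j * dK i z).
    by move=> i; apply: rieszD; [exact: rieszZ | exact: riesz_coord].
  by move=> z v z0; exact: is_derive_coordM (dKP z v z0).
- exists (fun i z => d1 i z + d2 i z); first by move=> i; exact: rieszD.
  move=> z v z0; have h1 := d1P z v z0; have h2 := d2P z v z0.
  apply: (is_derive_eq (is_deriveD h1 h2)).
  by rewrite -big_split; apply: eq_bigr => i _ /=; rewrite mulrDr.
- exists (fun i z => c * dK i z); first by move=> i; exact: rieszZ.
  move=> z v z0; have h := dKP z v z0.
  apply: (is_derive_eq (is_deriveZ c h)).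
  by rewrite /GRing.scale /= mulr_sumr; apply: eq_bigr => i _; ring.
Qed.
End Kernels.

(** * Increments of kernels *)

Section HolderRemainder.
Variables (R : realType) (m : nat).
Local Notation V := 'rV[R]_m.

Lemma sum_coord_le (w : V) (d : 'I_m -> R) (B : R) : (forall i, `|d i| <= B) ->
  `|\sum_i w 0 i * d i| <= m%:R * (enorm w * B).
Proof.
move=> dB; apply: (le_trans (ler_norm_sum _ _ _)).
rewrite mulr_natl -[X in _ *+ X]card_ord -sumr_const; apply: ler_sum => i _.
by rewrite normrM ler_pM// coord_le_enorm.
Qed.

(** An expansion with remainder of order 1 + e gives all directional derivatives
   and continuity at once. *)
Lemma holder_is_derive (f : V -> R) x (d : 'I_m -> R) (C e r : R) :
  0 < e -> 0 < r -> 0 <= C ->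
  (forall w, enorm w < r ->
    `|f (x + w) - f x - \sum_i w 0 i * d i| <= C * enorm w `^ (1 + e)) ->
  (forall v, is_derive x v f (\sum_i v 0 i * d i)) /\ {for x, continuous f}.
Proof.
move=> e0 r0 C0 h; split.
  move=> v; apply/is_deriveP => eps eps0.
  pose A := C * enorm v `^ (1 + e) + 1.
  have A0 : 0 < A by rewrite ltr_wpDl// mulr_ge0// powR_ge0.
  pose tau2 := (eps / A) `^ e^-1.
  have tau20 : 0 < tau2 by rewrite powR_gt0// divr_gt0.
  have v1 : 0 < enorm v + 1 by rewrite ltr_wpDl// enorm_ge0.
  exists (Num.min (r / (enorm v + 1)) tau2); first by rewrite lt_min divr_gt0.
  move=> t t0; rewrite lt_min => /andP[tr t2].
  have tn0 : 0 < `|t| by rewrite normr_gt0.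
  have -> : t * (\sum_i v 0 i * d i) = \sum_i (t *: v) 0 i * d i.
    by rewrite mulr_sumr; apply: eq_bigr => i _; rewrite mxE mulrA.
  apply: (le_trans (h _ _)).
    rewrite enormZ; rewrite ltr_pdivlMr// in tr; apply: le_lt_trans tr.
    by rewrite ler_wpM2l// lerDl.
  rewrite enormZ powRM ?enorm_ge0// powRD; last first.
    by apply/implyP => _; rewrite gt_eqF.
  rewrite powRr1// mulrCA -mulrA mulrC ler_wpM2r//.
  have te : `|t| `^ e <= eps / A.
    have -> : eps / A = tau2 `^ e.
      by rewrite /tau2 -powRrM mulVf ?gt_eqF// powRr1// divr_ge0// ltW.
    by apply: ge0_ler_powR; rewrite ?nnegrE// ltW.
  apply: (@le_trans _ _ (eps / A * A)); last by rewrite divfK// gt_eqF.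
  by apply: ler_pM => //; rewrite ?powR_ge0// ?mulr_ge0 ?powR_ge0// /A lerDl.
apply/continuous_enormP => eps eps0.
pose S := m%:R * (\sum_i `|d i|).
have S0 : 0 <= S by rewrite mulr_ge0// sumr_ge0.
have SC : 0 < S + C + 1 by rewrite ltr_wpDl// addr_ge0.
exists (Num.min (Num.min r 1) (eps / (S + C + 1))).
  by rewrite !lt_min r0 ltr01 divr_gt0.
move=> y; rewrite !lt_min => /andP[/andP[yr y1] ye].
have := h (y - x) yr; rewrite addrCA subrr addr0 => hy.
have {}hy : `|f y - f x| <= C * enorm (y - x) `^ (1 + e) + S * enorm (y - x).
  have hs : `|\sum_i (y - x) 0 i * d i| <= S * enorm (y - x).
    apply: (le_trans (sum_coord_le (y - x) (B := \sum_i `|d i|) _)).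
      by move=> i; rewrite (bigD1 i)//= lerDl sumr_ge0.
    by rewrite /S -mulrA (mulrC (enorm _)).
  rewrite -[f y - f x](subrK (\sum_i (y - x) 0 i * d i)).
  by apply: (le_trans (ler_normD _ _)); exact: lerD.
apply: (le_lt_trans hy); rewrite ltr_pdivlMr// in ye; apply: le_lt_trans ye.
rewrite mulrC; have p1 : enorm (y - x) `^ (1 + e) <= enorm (y - x).
  have := enorm_ge0 (y - x); rewrite le_eqVlt => /predU1P[<-|y0].
    by rewrite powR0// gt_eqF// addr_gt0.
  rewrite -[leRHS](powRr1 (enorm_ge0 _)); apply: ger_powR; first by rewrite y0 ltW.
  by rewrite lerDl ltW.
have := enorm_ge0 (y - x); have := ler_wpM2l C0 p1; nra.
Qed.

End HolderRemainder.

Section KernelEstimates.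
Variables (R : realType) (m : nat).
Local Notation V := 'rV[R]_m.
Implicit Types (K : V -> R) (z w v : V).

Lemma riesz_bound_family (I : finType) n (dK : I -> V -> R) : (forall i, riesz n (dK i)) ->
  exists2 C : R, 0 <= C & forall i z, `|dK i z| <= C * (enorm z ^+ n)^-1.
Proof.
move=> dKn; have /choice[C CP] : forall i, exists C : R, 0 <= C /\
    forall z, `|dK i z| <= C * (enorm z ^+ n)^-1.
  by move=> i; have [C C0 CP] := riesz_bound (dKn i); exists C.
exists (\sum_i C i); first by apply: sumr_ge0 => i _; case: (CP i).
move=> i z; have [Ci Pi] := CP i; apply: (le_trans (Pi z)).
rewrite ler_wpM2r ?invr_ge0 ?exprn_ge0 ?enorm_ge0// (bigD1 i)//= lerDl.
by apply: sumr_ge0 => j _; case: (CP j).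
Qed.

Lemma enorm_segment z w (t : R) : enorm w <= enorm z / 2 -> 0 <= t -> t <= 1 ->
  enorm z / 2 <= enorm (z + t *: w).
Proof.
move=> wz t0 t1; have := ler_enormB z (- (t *: w)); rewrite enormN opprK => h.
apply: le_trans h; have : enorm (t *: w) <= enorm w.
  by rewrite enormZ ger0_norm// ler_piMl// enorm_ge0.
lra.
Qed.

(** The mean value theorem on the segment from z to z + w, which keeps at distance
   at least |z| / 2 from the singularity. *)
Lemma riesz_lip_family (I : finType) n (F : I -> V -> R) : (forall i, riesz n (F i)) ->
  exists2 C : R, 0 <= C & forall i z w, enorm w <= enorm z / 2 ->
    `|F i (z + w) - F i z| <= C * (enorm w * (enorm z ^+ n.+1)^-1).
Proof.
move=> Fn; have /choice[dF dFP] : forall i, exists dF : 'I_m -> V -> R,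
    (forall j, riesz n.+1 (dF j)) /\
    forall z v, z != 0 -> is_derive z v (F i) (\sum_j v 0 j * dF j z).
  by move=> i; have [dF h1 h2] := riesz_derive (Fn i); exists dF.
have /choice[C CP] : forall i, exists C : R, 0 <= C /\
    forall j z, `|dF i j z| <= C * (enorm z ^+ n.+1)^-1.
  by move=> i; have [C C0 h] := riesz_bound_family (dFP i).1; exists C.
have S0 : 0 <= \sum_i C i by apply: sumr_ge0 => i _; case: (CP i).
have CS i : C i <= \sum_i C i.
  by rewrite (bigD1 i)//= lerDl; apply: sumr_ge0 => j _; case: (CP j).
exists (m%:R * (\sum_i C i) * 2 ^+ n.+1); first by rewrite !mulr_ge0// exprn_ge0.
move=> i z w wz.
have [z0|z0] := eqVneq z 0.
  have : enorm w <= 0 by move: wz; rewrite z0 enorm0 mul0r.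
  rewrite le_eqVlt ltNge enorm_ge0 orbF enorm_eq0 => /eqP ->.
  by rewrite addr0 subrr normr0 enorm0 mul0r mulr0.
have rz : 0 < enorm z by rewrite enorm_gt0.
have seg t : 0 <= t -> t <= 1 -> 0 < enorm (z + t *: w).
  by move=> t0 t1; apply: lt_le_trans (enorm_segment wz t0 t1); rewrite divr_gt0.
have [|t [t0 t1 ->]] := @MVT_line R _ (F i) z w (fun t => \sum_j w 0 j * dF i j (z + t *: w)).
  by move=> t t0 t1; apply: (dFP i).2; rewrite -enorm_gt0 seg.
apply: (le_trans (sum_coord_le w (B := (\sum_i C i) * ((enorm z / 2) ^+ n.+1)^-1) _)).
  move=> j; apply: (le_trans ((CP i).2 j _)); apply: ler_pM => //; first by case: (CP i).
    by rewrite invr_ge0 exprn_ge0// enorm_ge0.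
  rewrite lef_pV2 ?posrE ?exprn_gt0 ?seg ?divr_gt0//.
  by rewrite lerXn2r ?nnegrE ?enorm_ge0 ?divr_ge0 ?(ltW rz)// enorm_segment.
rewrite exprMn exprVn invfM invrK le_eqVlt; apply/orP; left; apply/eqP; ring.
Qed.

Lemma riesz_lip n K : riesz n K ->
  exists2 C : R, 0 <= C & forall z w, enorm w <= enorm z / 2 ->
    `|K (z + w) - K z| <= C * (enorm w * (enorm z ^+ n.+1)^-1).
Proof.
move=> Kn; have [C C0 CP] := @riesz_lip_family unit n (fun=> K) (fun=> Kn).
by exists C => // z w; exact: CP tt z w.
Qed.

Lemma riesz_taylor n K (dK : 'I_m -> V -> R) : (forall i, riesz n.+1 (dK i)) ->
  (forall z v, z != 0 -> is_derive z v K (\sum_i v 0 i * dK i z)) ->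
  exists2 C : R, 0 <= C & forall z w, enorm w <= enorm z / 2 ->
    `|K (z + w) - K z - \sum_i w 0 i * dK i z|
      <= C * (enorm w ^+ 2 * (enorm z ^+ n.+2)^-1).
Proof.
move=> dKn dKP; have [C C0 CP] := riesz_lip_family dKn.
exists (m%:R * C); first exact: mulr_ge0.
move=> z w wz.
have [z0|z0] := eqVneq z 0.
  have : enorm w <= 0 by move: wz; rewrite z0 enorm0 mul0r.
  rewrite le_eqVlt ltNge enorm_ge0 orbF enorm_eq0 => /eqP ->.
  rewrite addr0 subrr sub0r normrN big1 ?normr0 ?enorm0 ?expr0n ?mul0r ?mulr0//.
  by move=> i _; rewrite mxE mul0r.
have rz : 0 < enorm z by rewrite enorm_gt0.
have seg t : 0 <= t -> t <= 1 -> 0 < enorm (z + t *: w).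
  by move=> t0 t1; apply: lt_le_trans (enorm_segment wz t0 t1); rewrite divr_gt0.
have [|t [t0 t1 ->]] := @MVT_line R _ K z w (fun t => \sum_j w 0 j * dK j (z + t *: w)).
  by move=> t t0 t1; apply: dKP; rewrite -enorm_gt0 seg.
rewrite -sumrB; under eq_bigr do rewrite -mulrBr.
have tw : enorm (t *: w) <= enorm w by rewrite enormZ ger0_norm// ler_piMl// enorm_ge0.
apply: (le_trans (sum_coord_le w (B := C * (enorm w * (enorm z ^+ n.+2)^-1)) _)).
  move=> j; apply: (le_trans (CP j z (t *: w) (le_trans tw wz))).
  by rewrite ler_wpM2l// ler_wpM2r// invr_ge0 exprn_ge0// enorm_ge0.
by rewrite le_eqVlt; apply/orP; left; apply/eqP; ring.
Qed.

Lemma invX_powR (a s : R) (k : nat) : (0 < k)%N -> 0 <= a ->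
  (a ^+ k)^-1 <= a `^ (s - k%:R) * a `^ (- s).
Proof.
move=> k0; rewrite le_eqVlt => /predU1P[<-|a0].
  by rewrite expr0n gtn_eqF// invr0 mulr_ge0 ?powR_ge0.
rewrite -powRD; last by apply/implyP => _; rewrite gt_eqF.
by rewrite addrAC subrr add0r powR_invn// ltW.
Qed.

Lemma ler_powR2 (a b e : R) : 0 <= a -> a <= b -> 0 <= e -> a `^ e <= b `^ e.
Proof.
by move=> a0 ab e0; apply: ge0_ler_powR; rewrite ?nnegrE// (le_trans a0).
Qed.

Lemma powR_trade (c a delta e : R) : 0 < c -> c <= a -> delta <= 1 ->
  c `^ (1 - delta + e) * a `^ (delta - 1) <= c `^ e.
Proof.
move=> c0 ca d1; have a0 := lt_le_trans c0 ca.
rewrite (_ : c `^ (1 - delta + e) = c `^ (1 - delta) * c `^ e); last first.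
  by rewrite powRD//; apply/implyP => _; rewrite gt_eqF.
rewrite -(opprB 1 delta) powRN mulrAC -[leRHS]mul1r ler_wpM2r ?powR_ge0//.
by rewrite ler_pdivrMr ?powR_gt0// mul1r ler_powR2 ?subr_ge0// ltW.
Qed.

(** Short increments, |w| <= |z| / 2, with c = |w| and a = |z|: the excess of the
   power of c is traded for the missing power of a, since c <= a. *)
Lemma near_weight (c a s e delta : R) (j k : nat) : (0 < j)%N -> (0 < k)%N ->
  0 <= c -> c <= a / 2 -> delta <= 1 -> 0 < e ->
  j%:R = 1 - delta + e -> s - k%:R = delta - 1 ->
  c ^+ j * (a ^+ k)^-1 <= c `^ e * a `^ (- s).
Proof.
move=> j0 k0; rewrite le_eqVlt => /predU1P[<-|c0] ca d1 e0 je sk.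
  by rewrite expr0n gtn_eqF// mul0r mulr_ge0 ?powR_ge0.
have a0 : 0 < a by lra.
have ca' : c <= a by lra.
rewrite -(powR_mulrn j (ltW c0)) je.
apply: (le_trans (ler_wpM2l (powR_ge0 _ _) (invX_powR s k0 (ltW a0)))).
rewrite sk mulrA; apply: (ler_wpM2r (powR_ge0 _ _)).
exact: powR_trade.
Qed.

(** Long increments: a is then at most 3 c, so a positive power of a is bounded by
   one of c. *)
Lemma far_weight (c a s e : R) (k : nat) : (0 < k)%N -> 0 <= a -> a <= 3 * c -> 0 <= e ->
  s - k%:R = e -> (a ^+ k)^-1 <= 3 `^ e * c `^ e * a `^ (- s).
Proof.
move=> k0 a0 ac e0 sk; apply: (le_trans (invX_powR s k0 a0)).
rewrite sk; apply: (ler_wpM2r (powR_ge0 _ _)).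
have c0 : 0 <= c by lra.
by rewrite -powRM//; apply: ler_powR2.
Qed.

Lemma combine_near (C C' c A B : R) : 0 <= C -> 0 <= C' -> 0 <= c -> 0 <= A -> 0 <= B ->
  C * (c * A) <= (C + C') * c * (A + B).
Proof.
move=> C0 C'0 c0 A0 B0; rewrite -subr_ge0.
have -> : (C + C') * c * (A + B) - C * (c * A) = C * c * B + C' * c * (A + B) by ring.
by rewrite addr_ge0// !mulr_ge0// addr_ge0.
Qed.

Lemma combine_far (C C1 C2 c A B : R) : 0 <= C -> 0 <= C2 -> 0 <= c -> 0 <= A -> 0 <= B ->
  C1 * (c * B) + C1 * (c * A) + C2 * (c * A) <= (C + (C1 + C2)) * c * (A + B).
Proof.
move=> C0 C20 c0 A0 B0; rewrite -subr_ge0.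
rewrite (_ : _ - _ = C * c * (A + B) + C2 * c * B); last by ring.
by rewrite addr_ge0// !mulr_ge0// addr_ge0.
Qed.

(** Here n = m - 1. For short increments this is the mean value theorem; for long
   ones each of the two values is controlled by its own weight. *)
Lemma riesz_holder n K (delta : R) : m = n.+1 -> (0 < n)%N -> 0 < delta -> delta < 1 ->
  riesz n K -> exists2 C : R, 0 <= C & forall z w,
    `|K (z + w) - K z| <= C * enorm w `^ delta * (weight delta z + weight delta (z + w)).
Proof.
move=> mn n0 d0 d1 Kn; have [C0 C00 C0P] := riesz_bound Kn.
have [C1 C10 C1P] := riesz_lip Kn.
have sn : m%:R - 1 + delta - n%:R = delta by rewrite mn -natr1; ring.
have sn1 : m%:R - 1 + delta - n.+1%:R = delta - 1 by rewrite mn -natr1; ring.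
have C3 : 0 <= C0 * 3 `^ delta by rewrite mulr_ge0// powR_ge0.
have C31 : 0 <= C0 * 3 `^ delta + 0 by rewrite addr0.
exists (C1 + (C0 * 3 `^ delta + 0)); first exact: addr_ge0 C10 C31.
move=> z w; have c0 := enorm_ge0 w; have a0 := enorm_ge0 z; have b0 := enorm_ge0 (z + w).
have cd0 : 0 <= enorm w `^ delta := powR_ge0 _ _.
have wa := weight_ge0 delta z; have wb := weight_ge0 delta (z + w).
have [wz|zw] := leP (enorm w) (enorm z / 2).
  apply: (le_trans (C1P z w wz)).
  apply: (le_trans _ (combine_near C10 C31 cd0 wa wb)); apply: (ler_wpM2l C10).
  rewrite -[X in X * _]expr1 weightE.
  apply: (near_weight (delta := delta) (ltn0Sn 0) (ltn0Sn n) c0 wz (ltW d1) d0) => //.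
  by rewrite subrK.
have hb (u : V) : enorm u <= 3 * enorm w ->
    `|K u| <= C0 * 3 `^ delta * (enorm w `^ delta * weight delta u).
  move=> u3; apply: (le_trans (C0P u)); rewrite -(mulrA C0).
  apply: (ler_wpM2l C00); rewrite mulrA.
  rewrite weightE; exact: far_weight n0 (enorm_ge0 u) u3 (ltW d0) sn.
have h1 : enorm z <= 3 * enorm w by lra.
have h2 : enorm (z + w) <= 3 * enorm w by have := enormD z w; lra.
apply: (le_trans (ler_normB _ _)); apply: (le_trans (lerD (hb _ h2) (hb _ h1))).
have := combine_far (C0 * 3 `^ delta) C10 (lexx 0) cd0 wa wb.
by rewrite mul0r addr0.
Qed.

(** Here n = m - 2. For short increments this is the Taylor estimate; for long ones
   the two values of K and the linear term are bounded separately. *)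
Lemma riesz_remainder n K (dK : 'I_m -> V -> R) (delta : R) :
  m = n.+2 -> (0 < n)%N -> 0 < delta -> delta < 1 ->
  riesz n K -> (forall i, riesz n.+1 (dK i)) ->
  (forall z v, z != 0 -> is_derive z v K (\sum_i v 0 i * dK i z)) ->
  exists2 C : R, 0 <= C & forall z w,
    `|K (z + w) - K z - \sum_i w 0 i * dK i z|
       <= C * enorm w `^ (1 + delta) * (weight delta z + weight delta (z + w)).
Proof.
move=> mn n0 d0 d1 Kn dKn dKP; have [C0 C00 C0P] := riesz_bound Kn.
have [C1 C10 C1P] := riesz_bound_family dKn.
have [C2 C20 C2P] := riesz_taylor dKn dKP.
have sn : m%:R - 1 + delta - n%:R = 1 + delta by rewrite mn -!natr1; ring.
have sn1 : m%:R - 1 + delta - n.+1%:R = delta by rewrite mn -!natr1; ring.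
have sn2 : m%:R - 1 + delta - n.+2%:R = delta - 1 by rewrite mn -!natr1; ring.
have D1 : 0 < 1 + delta by lra.
pose C3 := C0 * 3 `^ (1 + delta); pose C4 := m%:R * (C1 * 3 `^ delta).
have C30 : 0 <= C3 := mulr_ge0 C00 (powR_ge0 _ _).
have C40 : 0 <= C4 := mulr_ge0 (ler0n _ _) (mulr_ge0 C10 (powR_ge0 _ _)).
have C340 := addr_ge0 C30 C40.
exists (C2 + (C3 + C4)); first exact: addr_ge0 C20 C340.
move=> z w; have c0 := enorm_ge0 w; have a0 := enorm_ge0 z; have b0 := enorm_ge0 (z + w).
have cd0 : 0 <= enorm w `^ (1 + delta) := powR_ge0 _ _.
have wa := weight_ge0 delta z; have wb := weight_ge0 delta (z + w).
have [wz|zw] := leP (enorm w) (enorm z / 2).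
  apply: (le_trans (C2P z w wz)).
  apply: (le_trans _ (combine_near C20 C340 cd0 wa wb)); apply: (ler_wpM2l C20).
  rewrite weightE; apply: (near_weight (delta := delta) (ltn0Sn 1) (ltn0Sn n.+1) c0 wz (ltW d1) D1) => //.
  by ring.
have c1 : 0 < enorm w by lra.
have hb (u : V) : enorm u <= 3 * enorm w ->
    `|K u| <= C3 * (enorm w `^ (1 + delta) * weight delta u).
  move=> u3; apply: (le_trans (C0P u)); rewrite /C3 -(mulrA C0).
  apply: (ler_wpM2l C00); rewrite mulrA.
  rewrite weightE; exact: far_weight n0 (enorm_ge0 u) u3 (ltW D1) sn.
have h1 : enorm z <= 3 * enorm w by lra.
have h2 : enorm (z + w) <= 3 * enorm w by have := enormD z w; lra.
have h3 : `|\sum_i w 0 i * dK i z| <= C4 * (enorm w `^ (1 + delta) * weight delta z).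
  apply: (le_trans (sum_coord_le w (B := C1 * (3 `^ delta * enorm w `^ delta * weight delta z)) _)).
    move=> i; apply: (le_trans (C1P i z)); apply: (ler_wpM2l C10).
    rewrite weightE; exact: far_weight (ltn0Sn n) a0 h1 (ltW d0) sn1.
  have -> : enorm w `^ (1 + delta) = enorm w * enorm w `^ delta.
    by rewrite powRD ?(gt_eqF c1) ?implybT// powRr1.
  rewrite /C4; move: (weight delta z) (enorm w `^ delta) (enorm w) (3 `^ delta) => A1 A2 A3 A4.
  by rewrite le_eqVlt; apply/orP; left; apply/eqP; ring.
apply: (le_trans (ler_normB _ _)); apply: (le_trans (lerD (ler_normB _ _) h3)).
apply: (le_trans (lerD (lerD (hb _ h2) (hb _ h1)) (lexx _))).
exact: combine_far _ C20 C40 cd0 wa wb.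
Qed.
End KernelEstimates.

(** * Potentials *)

Section Potentials.
Variables (R : realType) (m : nat).
Local Notation V := 'rV[R]_m.
Implicit Types (K h : V -> R) (x y z w v : V).

Definition potential K h x : R := vint (fun y => K (y - x) * h y).

Lemma vmeas_shiftB K x : vmeas K -> vmeas (fun y => K (y - x)).
Proof.
move=> mK; have := vmeas_aff 1 (- x) mK; congr vmeas.
by apply/funext => y; rewrite scale1r.
Qed.

Lemma vmeas_potential n K h x : riesz n K -> vmeas h -> vmeas (fun y => K (y - x) * h y).
Proof. by move=> Kn mh; apply: vmeasM => //; apply: vmeas_shiftB; exact: riesz_vmeas Kn. Qed.

Lemma potential_integrable (delta C D : R) n K h x : (0 < n)%N -> (n < m)%N ->
  0 < delta -> riesz n K -> density delta C D h ->
  vintegrable (fun y => K (y - x) * h y).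
Proof.
move=> n0 nm d0 Kn [hi hD hw]; have [B B0 BP] := riesz_bound Kn.
have [wi _] := hw x.
pose s : R := m%:R - 1 + delta.
have sn : 0 <= s - n%:R.
  have : n.+1%:R <= m%:R :> R by rewrite ler_nat.
  by rewrite -natr1 /s; lra.
pose A := B * (D + enorm x) `^ (s - n%:R).
apply: (le_vintegrable _ _ (vintegrableZ A wi)).
  exact: vmeas_potential Kn (vintegrable_meas hi).
move=> y; rewrite normrM.
have [yD|yD] := ltP D (enorm y).
  by rewrite (hD y yD) normr0 !mulr0.
rewrite mulrA; apply: (ler_wpM2r (normr_ge0 _)).
apply: (le_trans (BP _)); rewrite /A -mulrA; apply: (ler_wpM2l B0).
rewrite weightE; apply: (le_trans (invX_powR s n0 (enorm_ge0 _))).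
apply: (ler_wpM2r (powR_ge0 _ _)); apply: ler_powR2 => //; first exact: enorm_ge0.
by apply: (le_trans (enormB _ _)); rewrite lerD2r.
Qed.

Lemma potential_diff (delta C D : R) n K h x w : (0 < n)%N -> (n < m)%N ->
  0 < delta -> riesz n K -> density delta C D h ->
  potential K h (x + w) - potential K h x =
  vint (fun y => (K (y - x - w) - K (y - x)) * h y).
Proof.
move=> n0 nm d0 Kn hd; rewrite /potential -vintB.
- by congr vint; apply/funext => y; rewrite mulrBl opprD addrA.
- exact: (potential_integrable _ n0 nm d0 Kn hd).
- exact: (potential_integrable _ n0 nm d0 Kn hd).
Qed.

Lemma weight_pair (delta C D : R) h x w (B : R) : 0 <= B -> density delta C D h ->
  let F := fun y => B * (weight delta (y - x) + weight delta (y - x - w)) * `|h y| in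
  vintegrable F /\ vint F <= B * (C + C).
Proof.
move=> B0 [hi hD hw] F; have [w1i w1C] := hw x; have [w2i w2C] := hw (x + w).
have FE : F = fun y => B * (weight delta (y - x) * `|h y| + weight delta (y - (x + w)) * `|h y|).
  by apply/funext => y; rewrite /F -mulrA mulrDl (opprD x) addrA.
split; rewrite FE; first by apply: vintegrableZ; exact: vintegrableD.
rewrite vintZ; last exact: vintegrableD.
by apply: (ler_wpM2l B0); rewrite (vintD w1i w2i); exact: lerD w1C w2C.
Qed.

(** Integrating riesz_holder against h: the weights at x and at x + w both have
   bounded mass. *)
Lemma potential_continuous (delta C D : R) n K h : m = n.+1 -> (0 < n)%N ->
  0 < delta -> delta < 1 -> riesz n K -> density delta C D h ->
  continuous (potential K h).
Proof.
move=> mn n0 d0 d1 Kn hd; have nm : (n < m)%N by rewrite mn.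
have [B B0 BP] := riesz_holder mn n0 d0 d1 Kn.
have hm : vmeas h by case: hd => hi _ _; exact: vintegrable_meas.
have [w00 C0] : vintegrable (fun y => weight delta (y - 0) * `|h y|) /\ 0 <= C.
  have [_ _ /(_ 0)[wi wC]] := hd; split => //; apply: le_trans wC.
  by apply: vint_ge0 => z; rewrite mulr_ge0// weight_ge0.
have key x w : `|potential K h (x + w) - potential K h x| <= B * (C + C) * enorm w `^ delta.
  rewrite (potential_diff x w n0 nm d0 Kn hd).
  have [Fi FC] := weight_pair x w (mulr_ge0 B0 (powR_ge0 (enorm (- w)) delta)) hd.
  apply: (le_trans (le_norm_vint _ Fi _)).
  - apply: vmeasM => //; apply: vmeasB.
      have := vmeas_shiftB (x + w) (riesz_vmeas Kn); congr vmeas.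
      by apply/funext => y; rewrite opprD addrA.
    exact: vmeas_shiftB (riesz_vmeas Kn).
  - by move=> y; rewrite normrM; apply: (ler_wpM2r (normr_ge0 _)); exact: BP.
  - by apply: (le_trans FC); rewrite enormN mulrAC.
move=> x; apply/continuous_enormP => e e0.
pose A := B * (C + C) + 1.
have A0 : 0 < A by rewrite ltr_wpDl// mulr_ge0// addr_ge0.
exists ((e / A) `^ delta^-1); first by rewrite powR_gt0// divr_gt0.
move=> y yx; have := key x (y - x); rewrite addrCA subrr addr0 => h'.
apply: (le_lt_trans h').
have ye : enorm (y - x) `^ delta < e / A.
  have -> : e / A = (e / A) `^ delta^-1 `^ delta.
    by rewrite -powRrM mulVf ?gt_eqF// powRr1// divr_ge0// ltW.
  by apply: gt0_ltr_powR; rewrite ?nnegrE ?enorm_ge0 ?powR_ge0.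
rewrite ltr_pdivlMr// in ye; apply: le_lt_trans ye.
by rewrite mulrC; apply: (ler_wpM2l (powR_ge0 _ _)); rewrite /A lerDl.
Qed.

(** Integrating riesz_remainder against h gives a first order expansion of the
   potential with remainder of order 1 + delta. *)
Lemma potential_derive (delta C D : R) n K (dK : 'I_m -> V -> R) h : m = n.+2 -> (0 < n)%N ->
  0 < delta -> delta < 1 -> riesz n K -> (forall i, riesz n.+1 (dK i)) ->
  (forall z v, z != 0 -> is_derive z v K (\sum_i v 0 i * dK i z)) ->
  density delta C D h ->
  forall x, (forall v, is_derive x v (potential K h) (\sum_i v 0 i * - potential (dK i) h x)) /\
    {for x, continuous (potential K h)}.
Proof.
move=> mn n0 d0 d1 Kn dKn dKP hd x.
have nm : (n < m)%N by rewrite mn.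
have n1m : (n.+1 < m)%N by rewrite mn.
have [B B0 BP] := riesz_remainder mn n0 d0 d1 Kn dKn dKP.
have hm : vmeas h by case: hd => hi _ _; exact: vintegrable_meas.
have C0 : 0 <= C.
  have [_ _ /(_ 0)[wi wC]] := hd; apply: le_trans wC.
  by apply: vint_ge0 => z; rewrite mulr_ge0// weight_ge0.
apply: (@holder_is_derive _ _ _ _ _ (B * (C + C)) delta 1) => //.
  by rewrite mulr_ge0// addr_ge0.
move=> w _.
have dKi i : vintegrable (fun y => dK i (y - x) * h y).
  exact: potential_integrable (ltn0Sn n) n1m d0 (dKn i) hd.
have E : potential K h (x + w) - potential K h x - \sum_i w 0 i * - potential (dK i) h x =
    vint (fun y => (K (y - x - w) - K (y - x) - \sum_i (- w) 0 i * dK i (y - x)) * h y).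
  rewrite (potential_diff x w n0 nm d0 Kn hd) /potential.
  under eq_bigr => i _ do rewrite mulrN -mulNr -(vintZ _ (dKi i)).
  rewrite -vint_sum; last by move=> i; exact: vintegrableZ.
  rewrite -vintB.
  - congr vint; apply/funext => y; rewrite [RHS]mulrBl mulr_suml; congr (_ - _).
    by apply: eq_bigr => i _; rewrite mxE mulrA.
  - have k1 := potential_integrable (x + w) n0 nm d0 Kn hd.
    have k2 := potential_integrable x n0 nm d0 Kn hd.
    have := vintegrableB k1 k2; congr vintegrable.
    by apply/funext => y; rewrite mulrBl opprD addrA.
  - by apply: vintegrable_sum => i; exact: vintegrableZ.
rewrite E.
have [Fi FC] := weight_pair x w (mulr_ge0 B0 (powR_ge0 (enorm (- w)) (1 + delta))) hd.
apply: (le_trans (le_norm_vint _ Fi _)).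
- apply: vmeasM => //; apply: vmeasB.
    apply: vmeasB; last exact: vmeas_shiftB (riesz_vmeas Kn).
    have := vmeas_shiftB (x + w) (riesz_vmeas Kn); congr vmeas.
    by apply/funext => y; rewrite opprD addrA.
  apply: vmeas_sum => i; apply: vmeasM; first exact: vmeas_cst.
  exact: vmeas_shiftB (riesz_vmeas (dKn i)).
- by move=> y; rewrite normrM; apply: (ler_wpM2r (normr_ge0 _)); exact: BP.
- by apply: (le_trans FC); rewrite enormN mulrAC.
Qed.

Lemma far_potential_integrable n K h x0 (r : R) : 0 < r -> riesz n K ->
  vintegrable h -> (forall y, enorm (y - x0) < r -> h y = 0) ->
  forall x, enorm (x - x0) < r / 2 -> vintegrable (fun y => K (y - x) * h y).
Proof.
move=> r0 Kn hi h0 x xx0.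
have r2 : 0 < r / 2 by rewrite divr_gt0.
have [B B0 BP] := riesz_bound Kn.
apply: (le_vintegrable _ _ (vintegrableZ (B * ((r / 2) ^+ n)^-1) (vintegrable_norm hi))).
  exact: vmeas_potential Kn (vintegrable_meas hi).
move=> y; rewrite normrM.
have [yx|yx] := ltP (enorm (y - x)) (r / 2).
  rewrite h0 ?normr0 ?mulr0//.
  rewrite (_ : y - x0 = (y - x) + (x - x0)); last by rewrite addrA subrK.
  by apply: (le_lt_trans (enormD _ _)); lra.
apply: (ler_wpM2r (normr_ge0 _)); apply: (le_trans (BP _)); apply: (ler_wpM2l B0).
have yx0 : 0 < enorm (y - x) by lra.
rewrite lef_pV2 ?posrE ?exprn_gt0//.
by apply: lerXn2r => //; rewrite nnegrE ltW.
Qed.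

(** Away from the support of the density a potential may be differentiated
   under the integral sign, whatever the order of its kernel. *)
Lemma far_potential_derive n K (dK : 'I_m -> V -> R) h x0 (r : R) :
  0 < r -> riesz n K -> (forall i, riesz n.+1 (dK i)) ->
  (forall z v, z != 0 -> is_derive z v K (\sum_i v 0 i * dK i z)) ->
  vintegrable h -> (forall y, enorm (y - x0) < r -> h y = 0) ->
  forall x, enorm (x - x0) < r / 2 ->
  (forall v, is_derive x v (potential K h) (\sum_i v 0 i * - potential (dK i) h x)) /\
    {for x, continuous (potential K h)}.
Proof.
move=> r0 Kn dKn dKP hi h0 x xx0.
have hm := vintegrable_meas hi.
have r2 : 0 < r / 2 by rewrite divr_gt0.
have far u y : enorm (u - x0) < r / 2 -> enorm (y - u) < r / 2 -> h y = 0.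
  move=> u1 u2; apply: h0; rewrite (_ : y - x0 = (y - u) + (u - x0)); last by rewrite addrA subrK.
  by apply: (le_lt_trans (enormD _ _)); lra.
have integ k (L : V -> R) u : riesz k L -> enorm (u - x0) < r / 2 ->
    vintegrable (fun y => L (y - u) * h y).
  by move=> Lk ur; exact: (far_potential_integrable r0 Lk hi h0 ur).
have [B B0 BP] := riesz_taylor dKn dKP.
pose rho := Num.min (r / 2 - enorm (x - x0)) (r / 4).
have rho0 : 0 < rho by rewrite lt_min subr_gt0 xx0 divr_gt0.
pose A := B * ((r / 2) ^+ n.+2)^-1.
have A0 : 0 <= A by rewrite mulr_ge0// invr_ge0 exprn_ge0// ltW.
apply: (@holder_is_derive _ _ _ _ _ (A * vint (fun y => `|h y|)) 1 rho) => //.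
  by rewrite mulr_ge0// vint_ge0.
move=> w; rewrite lt_min => /andP[w1 w2].
have xwr : enorm (x + w - x0) < r / 2.
  by rewrite addrAC; apply: (le_lt_trans (enormD _ _)); lra.
have dKi i := integ _ _ x (dKn i) xx0.
have E : potential K h (x + w) - potential K h x - \sum_i w 0 i * - potential (dK i) h x =
    vint (fun y => (K (y - x - w) - K (y - x) - \sum_i (- w) 0 i * dK i (y - x)) * h y).
  rewrite /potential.
  have k1 := integ _ _ _ Kn xwr; have k2 := integ _ _ _ Kn xx0.
  under eq_bigr => i _ do rewrite mulrN -mulNr -(vintZ _ (dKi i)).
  rewrite -vint_sum; last by move=> i; exact: vintegrableZ.
  rewrite -vintB// -vintB.
  - congr vint; apply/funext => y; rewrite [RHS]mulrBl mulrBl mulr_suml opprD addrA; congr (_ - _).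
    by apply: eq_bigr => i _; rewrite mxE mulrA.
  - exact: vintegrableB.
  - by apply: vintegrable_sum => i; exact: vintegrableZ.
rewrite E.
have Ni := vintegrableZ (A * enorm w ^+ 2) (vintegrable_norm hi).
apply: (le_trans (le_norm_vint _ Ni _)).
- apply: vmeasM => //; apply: vmeasB.
    apply: vmeasB; last exact: vmeas_shiftB (riesz_vmeas Kn).
    have := vmeas_shiftB (x + w) (riesz_vmeas Kn); congr vmeas.
    by apply/funext => y; rewrite opprD addrA.
  apply: vmeas_sum => i; apply: vmeasM; first exact: vmeas_cst.
  exact: vmeas_shiftB (riesz_vmeas (dKn i)).
- move=> y; rewrite normrM.
  have [yx|yx] := ltP (enorm (y - x)) (r / 2); first by rewrite (far x y) ?normr0 ?mulr0.
  apply: (ler_wpM2r (normr_ge0 _)).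
  apply: (le_trans (BP _ _ _)); first by rewrite enormN; lra.
  rewrite enormN /A -mulrA [leRHS]mulrA -[leRHS]mulrA (mulrC _ (_ ^+ 2)) ler_wpM2l//.
  apply: (ler_wpM2l (exprn_ge0 _ (enorm_ge0 _))).
  have yx0 : 0 < enorm (y - x) by lra.
  rewrite lef_pV2 ?posrE ?exprn_gt0//.
  by apply: lerXn2r => //; rewrite nnegrE ltW.
- rewrite vintZ; last exact: vintegrable_norm.
  rewrite (_ : 1 + 1 = 2%:R); last by ring.
  rewrite (powR_mulrn 2 (enorm_ge0 w)).
  by rewrite le_eqVlt; apply/orP; left; apply/eqP; ring.
Qed.

(** At infinity a potential decays like its kernel. *)
Lemma potential_vanishes n K h (D : R) : (0 < n)%N -> riesz n K -> vintegrable h ->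
  (forall y, D < enorm y -> h y = 0) ->
  forall e, 0 < e -> exists r : R, forall x, r < enorm x -> `|potential K h x| < e.
Proof.
move=> n0 Kn hi hD e e0; have [B B0 BP] := riesz_bound Kn.
pose A := B * vint (fun y => `|h y|) + 1.
have A0 : 0 < A by rewrite ltr_wpDl// mulr_ge0// vint_ge0.
exists (`|D| + 1 + A / e) => x xr.
have Ae : 0 < A / e by rewrite divr_gt0.
have hm := vintegrable_meas hi.
have Ni := vintegrableZ (B * (e / A)) (vintegrable_norm hi).
apply: (@le_lt_trans _ _ (B * (e / A) * vint (fun y => `|h y|))); last first.
  rewrite mulrAC mulrCA -[ltRHS]mulr1 ltr_pM2l// ltr_pdivrMr// mul1r /A.
  by rewrite ltrDl.
rewrite -vintZ; last exact: vintegrable_norm.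
apply: le_norm_vint Ni _; first exact: vmeas_potential Kn hm.
move=> y; rewrite normrM.
have [yD|yD] := ltP D (enorm y); first by rewrite (hD y yD) normr0 !mulr0.
apply: (ler_wpM2r (normr_ge0 _)); apply: (le_trans (BP _)); apply: (ler_wpM2l B0).
have yx : 1 + A / e <= enorm (y - x).
  have := ler_enormB x y; rewrite enormBC; have := ler_norm D; lra.
have yx0 : 0 < enorm (y - x) by lra.
have yx1 : 1 <= enorm (y - x) by lra.
apply: (@le_trans _ _ (enorm (y - x))^-1).
  by rewrite lef_pV2 ?posrE ?exprn_gt0// -[leLHS]expr1; exact: (ler_weXn2l yx1 n0).
by rewrite -[leRHS]invrK lef_pV2 ?posrE ?invr_gt0 ?divr_gt0// invf_div; lra.
Qed.

End Potentials.

(** * The divergence of the Newton field *)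

Section UniformC1.
Variables (R : realType) (m : nat).
Local Notation V := 'rV[R]_m.
Implicit Types (K h : V -> R) (x y z w v : V).

(** Compactly supported C^1 functions; the partial derivatives du are recorded
   through a uniform first order expansion, the only form in which they are used. *)
Definition uniform_C1 (D B : R) (u : V -> R) (du : 'I_m -> V -> R) :=
  [/\ vmeas u /\ (forall i, vmeas (du i)),
      forall y, `|u y| <= B /\ (forall i, `|du i y| <= B),
      forall y, D < enorm y -> u y = 0 /\ (forall i, du i y = 0) &
      forall e, 0 < e -> exists2 tau : R, 0 < tau & forall y w, enorm w < tau ->
        `|u (y + w) - u y - \sum_i w 0 i * du i y| <= e * enorm w].

Lemma is_derive_unique (W : normedModType R) (f : W -> R) (x v : W) (a b : R) :
  is_derive x v f a -> is_derive x v f b -> a = b.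
Proof. by move=> [_ <-] [_ <-]. Qed.

Lemma vintegrable_bounded (f : V -> R) (B D : R) : vmeas f ->
  (forall y, `|f y| <= B) -> (forall y, D < enorm y -> f y = 0) -> vintegrable f.
Proof.
move=> mf fB fD.
have mU := @vset_enorm_le R m D.
have Uoo : (lebesgue_vol [set y : V | (enorm y <= D)%R] < +oo)%E.
  exact: (@vol_bounded_fin R m _ D mU).
apply: (le_vintegrable mf _ (vintegrableZ B (vintegrable_indic mU Uoo))) => y.
rewrite indicE; have [yU|yU] := boolP (y \in _); first by rewrite mulr1.
rewrite mulr0 fD ?normr0// ltNge; apply: contra yU => yD.
by rewrite inE.
Qed.

Lemma sum_delta (i : 'I_m) (F : 'I_m -> R) : \sum_j (delta_mx 0 i : V) 0 j * F j = F i.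
Proof.
rewrite (bigD1 i)//= big1 ?addr0 => [|j ji]; first by rewrite mxE !eqxx mul1r.
by rewrite mxE (negPf ji) andbF mul0r.
Qed.

Lemma uniform_C1_ge0 D B u du : uniform_C1 D B u du -> 0 <= B.
Proof. by move=> [_ uB _ _]; have [+ _] := uB 0; exact: le_trans. Qed.

(** Up to sign both sides are the partial derivative of the potential of u: one from the
   singular kernel estimate, the other after moving the translation onto u. *)
Lemma potential_by_parts n K (dK : 'I_m -> V -> R) D B u du : m = n.+2 -> (0 < n)%N ->
  riesz n K -> (forall i, riesz n.+1 (dK i)) ->
  (forall z v, z != 0 -> is_derive z v K (\sum_i v 0 i * dK i z)) ->
  uniform_C1 D B u du ->
  forall i x, potential (dK i) u x = - potential K (du i) x.
Proof.
move=> mn n0 Kn dKn dKP [[mu mdu] uB uD uT] i x.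
have nm : (n < m)%N by rewrite mn.
have m0 : (0 < m)%N by rewrite mn.
have d0 : 0 < 2^-1 :> R by rewrite invr_gt0.
have d1 : 2^-1 < 1 :> R by rewrite invf_lt1// ltr1n.
have [C ud] : exists C, density 2^-1 C D u.
  apply: (bounded_density m0 d0 d1 mu (B := B)) => y; first by case: (uB y).
  by move/uD => [].
have [C' dud] : exists C, density 2^-1 C D (du i).
  apply: (bounded_density m0 d0 d1 (mdu i) (B := B)) => y; first by case: (uB y).
  by move/uD => [].
pose e_ : V := delta_mx 0 i.
have := (potential_derive mn n0 d0 d1 Kn dKn dKP ud x).1 e_.
rewrite sum_delta => H1.
suff H2 : is_derive x e_ (potential K u) (potential K (du i) x).
  by rewrite -(is_derive_unique H1 H2) opprK.
apply/is_deriveP => e e0.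
pose chi : V -> R := \1_[set y : V | enorm y <= D + 1].
have chi_bnd y : `|chi y| <= 1 by rewrite /chi indicE; case: (_ \in _); rewrite ?normr1 ?normr0.
have chi_supp y : D + 1 < enorm y -> chi y = 0.
  rewrite /chi indicE => yD; rewrite (_ : _ \in _ = false)//.
  by apply/negP; rewrite inE /= leNgt yD.
have mchi : vmeas chi by apply: vmeas_indic; exact: vset_enorm_le.
have [C'' chid] := bounded_density m0 d0 d1 mchi chi_bnd chi_supp.
have chii := potential_integrable x n0 nm d0 Kn chid.
pose A := vint (fun y => `|K (y - x) * chi y|) + 1.
have A0 : 0 < A by rewrite ltr_wpDl// vint_ge0.
have eA0 : 0 < e / A by rewrite divr_gt0.
have [tau tau0 tauP] := uT _ eA0.
exists (Num.min tau 1); first by rewrite lt_min tau0 ltr01.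
move=> t t0; rewrite lt_min => /andP[tt t1].
have te : enorm (t *: e_) = `|t| by rewrite enormZ enorm_delta mulr1.
have k1 := potential_integrable (x + t *: e_) n0 nm d0 Kn ud.
have k1' := vintegrable_shift (t *: e_) k1.
have k2 := potential_integrable x n0 nm d0 Kn ud.
have k3 := potential_integrable x n0 nm d0 Kn dud.
have E : potential K u (x + t *: e_) - potential K u x - t * potential K (du i) x =
    vint (fun y => K (y - x) * (u (y + t *: e_) - u y - t * du i y)).
  rewrite /potential -(vint_shift (t *: e_) k1) -(vintZ t k3) -(vintB k1' k2).
  rewrite -(vintB (vintegrableB k1' k2) (vintegrableZ t k3)).
  congr vint; apply/funext => y.
  by rewrite (_ : y + t *: e_ - (x + t *: e_) = y - x); [ring | rewrite opprD addrACA subrr addr0].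
rewrite E.
have Ni := vintegrableZ (e / A * `|t|) (vintegrable_norm chii).
apply: (@le_trans _ _ (e / A * `|t| * vint (fun y => `|K (y - x) * chi y|))); last first.
  rewrite mulrAC; apply: (ler_wpM2r (normr_ge0 t)).
  rewrite mulrAC -[leRHS]mulr1 -mulrA; apply: (ler_wpM2l (ltW e0)).
  by rewrite ler_pdivrMr// mul1r /A lerDl.
rewrite -(vintZ _ (vintegrable_norm chii)); apply: (le_norm_vint _ Ni).
  apply: vmeasM; first exact: vmeas_shiftB (riesz_vmeas Kn).
  apply: vmeasB; last by apply: vmeasM => //; exact: vmeas_cst.
  apply: vmeasB => //; have := vmeas_aff 1 (t *: e_) mu; congr vmeas.
  by apply/funext => y; rewrite scale1r.
move=> y; rewrite !normrM mulrCA; apply: (ler_wpM2l (normr_ge0 _)).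
have [yD|yD] := leP (enorm y) (D + 1).
  have -> : chi y = 1 by rewrite /chi indicE mem_set.
  rewrite normr1 mulr1; have := tauP y (t *: e_); rewrite te => /(_ tt).
  congr (`|_ - _| <= _).
  by under eq_bigr do rewrite mxE -mulrA; rewrite -mulr_sumr sum_delta.
have y1 : D < enorm (y + t *: e_).
  by have := ler_enormB y (- (t *: e_)); rewrite opprK enormN te; lra.
have y2 : D < enorm y by lra.
rewrite (uD _ y1).1 (uD _ y2).1 (uD _ y2).2 mulr0 !subr0 normr0.
by rewrite mulr_ge0// mulr_ge0// ltW.
Qed.

Lemma uniform_C1_shift D B u du x : uniform_C1 D B u du ->
  uniform_C1 (D + enorm x) B (fun z => u (z + x)) (fun i z => du i (z + x)).
Proof.
have sh f : vmeas f -> vmeas (fun z : V => f (z + x)).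
  move=> mf; have := vmeas_aff 1 x mf; congr vmeas.
  by apply/funext => y; rewrite scale1r.
move=> [[mu mdu] uB uD uT]; split.
- by split => [|i]; exact: sh.
- by move=> y; exact: uB.
- move=> y yD; apply: uD; have := ler_enormB y (- x); rewrite opprK enormN; lra.
- move=> e e0; have [tau tau0 tauP] := uT e e0; exists tau => // y w wt.
  by rewrite (addrAC y w); exact: tauP.
Qed.
End UniformC1.

Section NewtonKernel.
Variables (R : realType) (m : nat).
Local Notation V := 'rV[R]_m.
Implicit Types (x y z w v : V).

Definition cball (r : R) : set V := [set z | enorm z <= r].

Definition ball_vol : R := fine (lebesgue_vol (cball 1)).

Lemma indicT (A : set V) z : A z -> \1_A z = 1 :> R.
Proof. by move=> Az; rewrite indicE mem_set. Qed.

Lemma indicF (A : set V) z : ~ A z -> \1_A z = 0 :> R.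
Proof. by move=> Az; rewrite indicE (_ : _ \in _ = false)//; apply/negP; rewrite inE. Qed.

Lemma cball_integrable r : vintegrable (\1_(cball r) : V -> R).
Proof.
have mU := @vset_enorm_le R m r.
by apply: vintegrable_indic => //; exact: (vol_bounded_fin mU (fun y h => h)).
Qed.

Lemma vint_cball r : 0 < r -> vint (\1_(cball r) : V -> R) = r ^+ m * ball_vol.
Proof.
move=> r0; have ri : 0 < r^-1 by rewrite invr_gt0.
have := vint_aff 0 ri (cball_integrable 1).
rewrite vint_indic ?exprVn ?invrK; last exact: vset_enorm_le.
move=> <-; congr vint; apply/funext => z; rewrite addr0 !indicE; congr (nat_of_bool _)%:R.
apply/idP/idP; rewrite !inE /cball /= enormZ gtr0_norm//.
  by move=> zr; rewrite mulrC ler_pdivrMr// mul1r.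
by rewrite mulrC ler_pdivrMr// mul1r.
Qed.

Lemma ball_vol_ge0 : 0 <= ball_vol.
Proof. by rewrite fine_ge0// measure_ge0. Qed.

Lemma eq0_small (a C : R) : (forall eta, 0 < eta -> eta <= 1 -> `|a| <= eta * C) -> a = 0.
Proof.
move=> h; apply/eqP; rewrite -normr_eq0 eq_le normr_ge0 andbT.
have C0 : 0 <= C by have := h 1 ltr01 (lexx 1); rewrite mul1r; exact: le_trans.
apply/ler_addgt0Pl => e e0; rewrite addr0.
have C1 : 0 < C + 1 by rewrite ltr_wpDl.
have m0 : 0 < Num.min 1 (e / (C + 1)) by rewrite lt_min ltr01 divr_gt0.
apply: (le_trans (h _ m0 _)); first by rewrite ge_min lexx.
apply: (@le_trans _ _ (e / (C + 1) * (C + 1))); last by rewrite divfK// gt_eqF.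
by apply: ler_pM; rewrite ?(ltW m0)//; [rewrite ge_min lexx orbT | rewrite lerDl].
Qed.

(** The kernel |z|^-m, capped on the ball of radius e. *)
Definition theta (e : R) z : R := ((Num.max (enorm z) e) ^+ m)^-1.

Lemma theta_ge0 e z : 0 <= theta e z.
Proof. by rewrite invr_ge0 exprn_ge0// le_max enorm_ge0. Qed.

Lemma theta_le e z : 0 < e -> theta e z <= (e ^+ m)^-1.
Proof.
move=> e0; rewrite lef_pV2 ?posrE ?exprn_gt0// ?lt_max ?e0 ?orbT//.
by apply: lerXn2r; rewrite ?nnegrE ?le_max ?enorm_ge0 ?lexx ?orbT ?(ltW e0).
Qed.

Lemma vmeas_theta e : vmeas (theta e).
Proof.
rewrite (_ : theta e = fun z => (Num.max (enorm z) e) `^ (- m%:R)).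
  apply: vmeas_powR; apply: measurable_maxr; first exact: vmeas_enorm.
  exact: measurable_cst.
by apply/funext => z; rewrite powR_invn// le_max enorm_ge0.
Qed.

Lemma vmeas_scale (f : V -> R) s : vmeas f -> vmeas (fun z => f (s *: z)).
Proof.
move=> mf; have := vmeas_aff s 0 mf; congr vmeas.
by apply/funext => z; rewrite addr0.
Qed.

Lemma theta_dilate (u : V -> R) (B D e s : R) : 0 < e -> 0 < s -> vmeas u ->
  (forall y, `|u y| <= B) -> (forall y, D < enorm y -> u y = 0) ->
  vint (fun z => theta e z * u (s *: z)) = vint (fun z => theta (s * e) z * u z).
Proof.
move=> e0 s0 mu uB uD; have s1 : s != 0 by rewrite gt_eqF.
have si : 0 < s^-1 by rewrite invr_gt0.
pose g y := theta e (s^-1 *: y) * u y.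
have gi : vintegrable g.
  apply: (vintegrable_bounded (B := (e ^+ m)^-1 * B) (D := D)).
  - by apply: vmeasM => //; apply: vmeas_scale; exact: vmeas_theta.
  - move=> y; rewrite normrM (ger0_norm (theta_ge0 _ _)).
    by apply: ler_pM; rewrite ?theta_ge0// theta_le.
  - by move=> y /uD; rewrite /g => ->; rewrite mulr0.
have := vint_aff 0 s0 gi; rewrite -(vintZ _ gi) => E.
transitivity (vint (fun z => g (s *: z + 0))).
  by congr vint; apply/funext => z; rewrite addr0 /g scalerA mulVf// scale1r.
rewrite E; congr vint; apply/funext => y; rewrite /g mulrA; congr (_ * _).
rewrite /theta -invfM -exprMn; congr ((_ ^+ _)^-1).
rewrite enormZ gtr0_norm// maxr_pMr ?(ltW s0)//.
by rewrite mulrA divff// mul1r.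
Qed.

(** Outside the ball of radius s e both kernels coincide; inside the ball of radius
   e they are constants; the shell in between is the error term. *)
Lemma theta_incr (e s : R) z : 0 < e -> 1 < s ->
  `|theta (s * e) z - theta e z - ((s ^+ m)^-1 - 1) * (e ^+ m)^-1 * \1_(cball e) z|
     <= (1 - (s ^+ m)^-1) * (e ^+ m)^-1 * (\1_(cball (s * e)) z - \1_(cball e) z).
Proof.
move=> e0 s1; have s0 : 0 < s by lra.
have se : e < s * e by rewrite ltr_pMl.
have sm : (s ^+ m)^-1 <= 1 by rewrite invf_le1 ?exprn_gt0// exprn_ege1// ltW.
have em : 0 < (e ^+ m)^-1 by rewrite invr_gt0 exprn_gt0.
have sem : ((s * e) ^+ m)^-1 = (s ^+ m)^-1 * (e ^+ m)^-1 by rewrite exprMn invfM.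
rewrite /theta; have [ze|ze] := leP (enorm z) e.
  rewrite max_r; last by lra.
  rewrite !indicT /cball /=; [|lra|lra].
  by rewrite sem mulr1 subrr mulr0 (_ : _ - _ = 0) ?normr0//; ring.
have nze : ~ cball e z by rewrite /cball /=; apply/negP; rewrite -ltNge.
rewrite (indicF nze) mulr0 !subr0.
have [zse|zse] := leP (enorm z) (s * e).
  rewrite indicT// mulr1 mulrBl mul1r -sem distrC.
  have z0 : 0 < enorm z by lra.
  have h1 : ((s * e) ^+ m)^-1 <= (enorm z ^+ m)^-1.
    by rewrite lef_pV2 ?posrE ?exprn_gt0 ?mulr_gt0//; apply: lerXn2r; rewrite ?nnegrE ?mulr_ge0// ltW.
  have h2 : (enorm z ^+ m)^-1 <= (e ^+ m)^-1.
    by rewrite lef_pV2 ?posrE ?exprn_gt0//; apply: lerXn2r; rewrite ?nnegrE// ltW.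
  by rewrite ger0_norm ?subr_ge0// lerB.
have nz : ~ cball (s * e) z by rewrite /cball /=; apply/negP; rewrite -ltNge.
by rewrite (indicF nz) mulr0 subrr normr0.
Qed.

Lemma exprV_deriv (eta : R) : 0 < eta -> exists2 tau : R, 0 < tau &
  forall t : R, 0 < t -> t < tau ->
    `|((1 + t) ^+ m)^-1 - 1 + m%:R * t| <= eta * t /\ (1 + t) ^+ m - 1 <= eta.
Proof.
move=> eta0.
have d1 : is_derive (1 : R) 1 (fun t : R => t ^+ m) m%:R.
  have h := is_deriveX m (is_derive_id (1 : R) (1 : R)).
  have E : (id : R -> R) ^+ m = (fun t : R => t ^+ m).
    by apply/funext => t; rewrite exprfctE.
  rewrite E in h; apply: (is_derive_eq h).
  by rewrite /GRing.scale /= expr1n !mulr1.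
have d2 : is_derive (1 : R) 1 (fun t : R => (t ^+ m)^-1) (- m%:R).
  have n0 : (fun t : R => t ^+ m) 1 != 0 by rewrite /= expr1n oner_neq0.
  have h : is_derive (1 : R) 1 (fun t : R => (t ^+ m)^-1) (- (1 ^+ m) ^- 2 *: m%:R).
    exact: (@is_deriveV R (fun t : R => t ^+ m) 1 m%:R 1 n0 d1).
  apply: (is_derive_eq h).
  by rewrite expr1n expr1n invr1 /GRing.scale /= mulN1r.
have [t1 t10 t1P] := (is_deriveP _ _ _ _).2 d1 1 ltr01.
have [t2 t20 t2P] := (is_deriveP _ _ _ _).2 d2 eta eta0.
have m1 : 0 < m%:R + 1 :> R by rewrite ltr_wpDl.
exists (Num.min (Num.min t1 t2) (eta / (m%:R + 1))).
  by rewrite !lt_min t10 t20 divr_gt0.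
move=> t t0; rewrite !lt_min => /andP[/andP[tt1 tt2] tt3].
have tn0 : t != 0 by rewrite gt_eqF.
have ta : `|t| = t by rewrite gtr0_norm.
have := t1P t tn0; have := t2P t tn0; rewrite ta [t%:A]mulr1 expr1n invr1 => h2 h1.
split.
  have := h2 tt2; rewrite (_ : _ - _ = ((1 + t) ^+ m)^-1 - 1 + m%:R * t)//.
  by rewrite mulrN opprK (mulrC t).
have := h1 tt1; rewrite ler_norml => /andP[_ h].
rewrite ltr_pdivlMr// in tt3; nra.
Qed.

(** The vector field theta e z *: z has divergence m e^-m on the ball of radius e
   and 0 outside, so this is integration by parts against u. It is obtained
   without surface integrals: the radial derivative of u is the derivative at
   s = 1 of its dilations u (s z), and a dilation of u is one of theta. *)
Lemma theta_gradient (D B e : R) u du : 0 < e -> uniform_C1 D B u du ->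
  vint (fun z => theta e z * \sum_i z 0 i * du i z) =
  - (m%:R * (e ^+ m)^-1 * vint (fun z => \1_(cball e) z * u z)).
Proof.
move=> e0 uC1; have B0 := uniform_C1_ge0 uC1; case: uC1 => [[mu mdu] uB uD uT].
pose rad z := \sum_i z 0 i * du i z.
have uB' y := (uB y).1; have uD' y (Dy : D < enorm y) := (uD y Dy).1.
have mrad : vmeas rad by apply: vmeas_sum => i; apply: vmeasM => //; exact: vmeas_coord.
have radD y : D < enorm y -> rad y = 0.
  by move=> Dy; rewrite /rad big1// => i _; rewrite (uD y Dy).2 mulr0.
have radB y : `|rad y| <= m%:R * (`|D| * B).
  have [yD|yD] := ltP D (enorm y); first by rewrite radD// normr0 !mulr_ge0.
  apply: (le_trans (sum_coord_le y (B := B) (fun i => (uB y).2 i))).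
  apply: (ler_wpM2l (ler0n _ _)); apply: (ler_wpM2r B0).
  by rewrite (le_trans yD)// ler_norm.
have em : 0 < (e ^+ m)^-1 by rewrite invr_gt0 exprn_gt0.
have thi (f : V -> R) (M e' : R) : 0 < e' -> vmeas f -> (forall y, `|f y| <= M) ->
    (forall y, D < enorm y -> f y = 0) -> vintegrable (fun z => theta e' z * f z).
  move=> e'0 mf fM fD; apply: (vintegrable_bounded (B := (e' ^+ m)^-1 * M) (D := D)).
  - by apply: vmeasM => //; exact: vmeas_theta.
  - move=> y; rewrite normrM (ger0_norm (theta_ge0 _ _)).
    by apply: ler_pM => //; [exact: theta_ge0 | exact: theta_le].
  - by move=> y /fD ->; rewrite mulr0.
have ibi (r : R) : vintegrable (fun z => \1_(cball r) z * u z).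
  apply: (vintegrable_bounded (B := B) (D := D)).
  - by apply: vmeasM => //; apply: vmeas_indic; exact: vset_enorm_le.
  - move=> y; rewrite normrM -[leRHS]mul1r; apply: ler_pM => //.
    by rewrite indicE; case: (_ \in _); rewrite ?normr1 ?normr0.
  - by move=> y /uD' ->; rewrite mulr0.
pose b := vint (fun z => \1_(cball e) z * u z).
pose Ie := vint (fun z => theta e z * rad z).
pose A1 := (e ^+ m)^-1 * (`|D| * vint (\1_(cball D) : V -> R)).
pose A2 := (e ^+ m)^-1 * `|b|.
pose A3 := (m%:R + 1) * B * ball_vol.
have bv := ball_vol_ge0.
suff : Ie + m%:R * (e ^+ m)^-1 * b = 0 by move/eqP; rewrite addr_eq0 => /eqP.
apply: (@eq0_small _ (A1 + A2 + A3)) => eta eta0 eta1.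
have [tau tau0 tauP] := uT eta eta0.
have [tau' tau'0 tau'P] := exprV_deriv eta0.
pose t := Num.min (tau / (`|D| + 1)) tau' / 2.
have D1 : 0 < `|D| + 1 by rewrite ltr_wpDl.
have mt0 : 0 < Num.min (tau / (`|D| + 1)) tau' by rewrite lt_min tau'0 divr_gt0.
have t0 : 0 < t by rewrite divr_gt0.
have tmin : t < Num.min (tau / (`|D| + 1)) tau' by rewrite /t; lra.
move: tmin; rewrite lt_min ltr_pdivlMr// => /andP[tD tt'].
have [ha hs] := tau'P t t0 tt'.
pose s := 1 + t.
have s1 : 1 < s by rewrite ltrDl.
have s0 : 0 < s by lra.
have se0 : 0 < s * e by rewrite mulr_gt0.
set a := (s ^+ m)^-1 - 1 in ha.
have a_le : - a <= (m%:R + 1) * t.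
  have : `|a + m%:R * t| <= t by apply: (le_trans ha); rewrite ler_piMl// ltW.
  by rewrite ler_norml => /andP[h _]; rewrite mulrDl mul1r; lra.
have a_ge : 0 <= - a.
  by rewrite opprB subr_ge0 invf_le1 ?exprn_gt0// exprn_ege1// ltW.
have I1 := thi _ _ _ e0 mrad radB radD.
have I2 := thi _ _ _ e0 mu uB' uD'.
have I3 := thi _ _ _ se0 mu uB' uD'.
have us_B y : `|u (s *: y)| <= B by exact: uB'.
have us_D y : D < enorm y -> u (s *: y) = 0.
  move=> yD; apply: uD'; rewrite enormZ gtr0_norm//; apply: (lt_le_trans yD).
  by rewrite ler_peMl ?enorm_ge0// ltW.
have I4 := thi _ _ _ e0 (vmeas_scale s mu) us_B us_D.
have C1 := cball_integrable D.
(* the dilation difference of u against the regularised kernel *)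
have err1 : `|vint (fun z => theta e z * u (s *: z)) - vint (fun z => theta e z * u z) - t * Ie|
    <= eta * t * A1.
  rewrite -(vintB I4 I2) -(vintZ t I1) -(vintB (vintegrableB I4 I2) (vintegrableZ t I1)).
  have -> : eta * t * A1 = vint (fun z => eta * t * ((e ^+ m)^-1 * `|D|) * \1_(cball D) z).
    by rewrite (vintZ _ C1) /A1; ring.
  apply: (le_norm_vint _ (vintegrableZ _ C1)).
    by apply: vintegrable_meas; apply: vintegrableB (vintegrableB I4 I2) (vintegrableZ t I1).
  move=> z; have [zD|zD] := leP (enorm z) D; last first.
    rewrite us_D// uD'// radD// !mulr0 !subr0 normr0 (indicF (A := cball D)) ?mulr0//.
    by rewrite /cball /=; apply/negP; rewrite -ltNge.
  rewrite (indicT (A := cball D))// mulr1.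
  rewrite (_ : _ - _ = theta e z * (u (z + t *: z) - u z - t * rad z)); last first.
    by rewrite (_ : z + t *: z = s *: z); [ring | rewrite scalerDl scale1r].
  rewrite normrM (ger0_norm (theta_ge0 _ _)).
  rewrite (_ : eta * t * _ = (e ^+ m)^-1 * (eta * (t * `|D|))); last by ring.
  apply: ler_pM => //; [exact: theta_ge0 | exact: theta_le|].
  have tz : enorm (t *: z) <= t * `|D|.
    by rewrite enormZ gtr0_norm//; apply: (ler_wpM2l (ltW t0)); rewrite (le_trans zD)// ler_norm.
  have tzt : enorm (t *: z) < tau by apply: (le_lt_trans tz); nra.
  have := tauP z (t *: z) tzt.
  have -> : \sum_i (t *: z) 0 i * du i z = t * rad z.
    by rewrite /rad mulr_sumr; apply: eq_bigr => i _; rewrite mxE mulrA.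
  move=> h; apply: (le_trans h); exact: (ler_wpM2l (ltW eta0) tz).
(* the same difference after moving the dilation onto the kernel *)
have err2 : `|vint (fun z => theta (s * e) z * u z) - vint (fun z => theta e z * u z)
     - a * (e ^+ m)^-1 * b| <= - a * (B * (ball_vol * (s ^+ m - 1))).
  rewrite -(vintB I3 I2) -(vintZ _ (ibi e)).
  rewrite -(vintB (vintegrableB I3 I2) (vintegrableZ _ (ibi e))).
  have Cse := cball_integrable (s * e); have Ce := cball_integrable e.
  have -> : - a * (B * (ball_vol * (s ^+ m - 1))) =
      vint (fun z => - a * (e ^+ m)^-1 * B * (\1_(cball (s * e)) z - \1_(cball e) z)).
    rewrite (vintZ _ (vintegrableB Cse Ce)) (vintB Cse Ce) !vint_cball// exprMn.
    by field; rewrite expf_neq0// gt_eqF.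
  apply: (le_norm_vint _ (vintegrableZ _ (vintegrableB Cse Ce))).
    by apply: vintegrable_meas; apply: vintegrableB (vintegrableB I3 I2) (vintegrableZ _ (ibi e)).
  move=> z; have := theta_incr z e0 s1; rewrite -/a -(opprB _ 1) -/a => h.
  rewrite (_ : _ - _ = (theta (s * e) z - theta e z - a * (e ^+ m)^-1 * \1_(cball e) z) * u z); last by ring.
  rewrite normrM [leRHS]mulrAC; apply: ler_pM => //; exact: uB'.
have dil := theta_dilate e0 s0 mu uB' uD'.
rewrite dil in err1.
set X := vint (fun z => theta (s * e) z * u z) in err1 err2.
set Y := vint (fun z => theta e z * u z) in err1 err2.
have key : t * (Ie + m%:R * (e ^+ m)^-1 * b) =
    (X - Y - a * (e ^+ m)^-1 * b) - (X - Y - t * Ie) + (a + m%:R * t) * ((e ^+ m)^-1 * b) by ring.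
rewrite -(ler_pM2l t0) -{1}(gtr0_norm t0) -normrM key.
have h3 : `|(a + m%:R * t) * ((e ^+ m)^-1 * b)| <= eta * t * A2.
  rewrite normrM (normrM (e ^+ m)^-1) (gtr0_norm em) /A2.
  by apply: (ler_wpM2r _ ha); rewrite mulr_ge0// ltW.
have h2 : - a * (B * (ball_vol * (s ^+ m - 1))) <= eta * t * A3.
  have x1 : 0 <= s ^+ m - 1 by rewrite subr_ge0 exprn_ege1// ltW.
  apply: (le_trans (ler_wpM2r _ a_le)); first by rewrite !mulr_ge0.
  rewrite /A3 [leLHS](_ : _ = (m%:R + 1) * B * ball_vol * t * (s ^+ m - 1)); last by ring.
  rewrite [leRHS](_ : _ = (m%:R + 1) * B * ball_vol * t * eta); last by ring.
  apply: ler_wpM2l; last exact: hs.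
  have M0 : 0 <= m%:R + 1 :> R by rewrite addr_ge0.
  exact: mulr_ge0 (mulr_ge0 (mulr_ge0 M0 B0) bv) (ltW t0).
apply: (le_trans (ler_normD _ _)); apply: (le_trans (lerD (ler_normB _ _) h3)).
apply: (le_trans (lerD (lerD (le_trans err2 h2) err1) (lexx _))).
by rewrite le_eqVlt; apply/orP; left; apply/eqP; ring.
Qed.

(** Letting e tend to 0: the gradient of the Newton kernel, proportional to
   |z|^-m z, has as divergence a multiple of the Dirac mass. *)
Lemma newton_gradient0 (D B : R) u du : (2 < m)%N -> uniform_C1 D B u du ->
  vint (fun z => (enorm z ^+ m)^-1 * \sum_i z 0 i * du i z) = - (m%:R * ball_vol * u 0).
Proof.
move=> m2 uC1; have B0 := uniform_C1_ge0 uC1.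
have thg e (e0 : 0 < e) := theta_gradient e0 uC1.
have [[mu mdu] uB uD uT] := uC1.
have m0 : (0 < m)%N by lia.
have mR : m%:R = m.-1%:R + 1 :> R by rewrite natr1 prednK.
have mp : (0 < m.-1)%N by lia.
have d0 : 0 < 2^-1 :> R by rewrite invr_gt0.
have d1 : 2^-1 < 1 :> R by rewrite invf_lt1// ltr1n.
pose rad z := \sum_i z 0 i * du i z.
have mrad : vmeas rad by apply: vmeas_sum => i; apply: vmeasM => //; exact: vmeas_coord.
have radD y : D < enorm y -> rad y = 0.
  by move=> Dy; rewrite /rad big1// => i _; rewrite (uD y Dy).2 mulr0.
have radB y : `|rad y| <= m%:R * (enorm y * B) by exact: (sum_coord_le y (fun i => (uB y).2 i)).
have ind1 (r : R) (y : V) : `|\1_(cball r) y : R| <= 1.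
  by rewrite indicE; case: (_ \in _); rewrite ?normr1 ?normr0.
have indD (r : R) (y : V) : r < enorm y -> \1_(cball r) y = 0 :> R.
  by move=> ry; apply: indicF; rewrite /cball /=; apply/negP; rewrite -ltNge.
have mind (r : R) : vmeas (\1_(cball r) : V -> R) by apply: vmeas_indic; exact: vset_enorm_le.
have [Cd dens1] := bounded_density m0 d0 d1 (mind 1) (ind1 1) (@indD 1).
have [_ _ /(_ 0)[Wi _]] := dens1.
pose W := vint (fun y : V => weight 2^-1 (y - 0) * `|\1_(cball 1) y : R|).
have W0 : 0 <= W by apply: vint_ge0 => z; rewrite mulr_ge0// weight_ge0.
have bv := ball_vol_ge0.
pose th e z := theta e z.
have thi e : 0 < e -> vintegrable (fun z => theta e z * rad z).
  move=> e0; apply: (vintegrable_bounded (B := (e ^+ m)^-1 * (m%:R * (`|D| * B))) (D := D)).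
  - by apply: vmeasM => //; exact: vmeas_theta.
  - move=> y; rewrite normrM (ger0_norm (theta_ge0 _ _)).
    apply: ler_pM => //; [exact: theta_ge0 | exact: theta_le|].
    have [yD|yD] := ltP D (enorm y); first by rewrite radD// normr0 !mulr_ge0.
    apply: (le_trans (radB y)); apply: (ler_wpM2l (ler0n _ _)); apply: (ler_wpM2r B0).
    by rewrite (le_trans yD)// ler_norm.
  - by move=> y /radD ->; rewrite mulr0.
(* the part of the integral that the regularisation changes *)
have near0 e z : 0 < e -> e <= 1 ->
    `|(enorm z ^+ m)^-1 * rad z - theta e z * rad z|
       <= m%:R * B * e `^ 2^-1 * (weight 2^-1 (z - 0) * `|\1_(cball 1) z : R|).
  move=> e0 e1; have rhs0 : 0 <= m%:R * B * e `^ 2^-1 * (weight 2^-1 (z - 0) * `|\1_(cball 1) z : R|).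
    by rewrite !mulr_ge0// ?powR_ge0// weight_ge0.
  have [ez|ze] := leP e (enorm z).
    by rewrite /theta max_l// subrr normr0.
  have [z0|z0] := eqVneq z 0.
    have r0 : rad z = 0 by rewrite /rad big1// => i _; rewrite z0 mxE mul0r.
    by rewrite r0 !mulr0 subr0 normr0.
  have rz : 0 < enorm z by rewrite enorm_gt0.
  have z1 : \1_(cball 1) z = 1 :> R by apply: indicT; rewrite /cball /=; lra.
  rewrite z1 normr1 mulr1 subr0 -mulrBl normrM.
  have i0 : 0 <= (enorm z ^+ m)^-1 by rewrite invr_ge0 exprn_ge0// ltW.
  have h1 : `|(enorm z ^+ m)^-1 - theta e z| <= (enorm z ^+ m)^-1.
    have t0 := theta_ge0 e z.
    rewrite ger0_norm ?lerBlDr ?lerDl// subr_ge0 /theta max_r; last exact: ltW.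
    rewrite lef_pV2 ?posrE ?exprn_gt0//.
    by apply: lerXn2r; rewrite ?nnegrE ltW.
  apply: (le_trans (ler_pM (normr_ge0 _) (normr_ge0 _) h1 (radB z))).
  have -> : (enorm z ^+ m)^-1 * (m%:R * (enorm z * B)) = m%:R * B * (enorm z ^+ m.-1)^-1.
    have -> : enorm z ^+ m = enorm z * enorm z ^+ m.-1 by rewrite -exprS prednK.
    rewrite invfM; set q := (enorm z ^+ m.-1)^-1.
    transitivity (m%:R * B * q * ((enorm z)^-1 * enorm z)).
      by move: q (enorm z)^-1 (enorm z) => q p r; ring.
    by rewrite mulVf ?mulr1// gt_eqF.
  rewrite -[leRHS]mulrA; apply: ler_wpM2l; first by rewrite mulr_ge0.
  rewrite weightE; apply: (le_trans (invX_powR (m%:R - 1 + 2^-1) mp (ltW rz))).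
  rewrite (_ : m%:R - 1 + 2^-1 - m.-1%:R = 2^-1); last by rewrite mR; ring.
  by apply: (ler_wpM2r (powR_ge0 _ _)); apply: ler_powR2; rewrite ltW.
have mI : vmeas (fun z : V => (enorm z ^+ m)^-1 * rad z).
  exact: vmeasM (riesz_vmeas (riesz_pow R m m)) mrad.
have diffi : vintegrable (fun z => (enorm z ^+ m)^-1 * rad z - theta 1 z * rad z).
  apply: (le_vintegrable _ (fun z => near0 1 z ltr01 (lexx 1)) (vintegrableZ _ Wi)).
  by apply: vmeasB => //; apply: vmeasM => //; exact: vmeas_theta.
have Ii : vintegrable (fun z => (enorm z ^+ m)^-1 * rad z).
  have := vintegrableD diffi (thi 1 ltr01); congr vintegrable.
  by apply/funext => z; rewrite subrK.
set I := vint _.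
suff : I + m%:R * ball_vol * u 0 = 0 by move/eqP; rewrite addr_eq0 => /eqP.
pose C := m%:R * B * W + m%:R * ((1 + m%:R * B) * ball_vol).
apply: (@eq0_small _ C) => eta eta0 eta1.
have [tau tau0 tauP] := uT 1 ltr01.
pose e := Num.min (eta ^+ 2) (tau / 2).
have e0 : 0 < e by rewrite lt_min exprn_gt0// divr_gt0.
have eeta : e <= eta ^+ 2 by rewrite ge_min lexx.
have e1 : e <= 1 by apply: (le_trans eeta); rewrite exprn_ile1// ltW.
have etau : e < tau by rewrite gt_min; apply/orP; right; lra.
have se : e `^ 2^-1 <= eta.
  rewrite powR12_sqrt ?(ltW e0)// -[leRHS](gtr0_norm eta0) -sqrtr_sqr.
  by apply: ler_wsqrtr.
have err1 : `|I - vint (fun z => theta e z * rad z)| <= m%:R * B * eta * W.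
  rewrite -(vintB Ii (thi e e0)).
  apply: (le_trans (le_norm_vint (vintegrable_meas (vintegrableB Ii (thi e e0))) (vintegrableZ (m%:R * B * e `^ 2^-1) Wi) (fun z => near0 e z e0 e1))).
  rewrite (vintZ _ Wi) -/W; apply: (ler_wpM2r W0); apply: ler_wpM2l => //.
  by rewrite mulr_ge0.
have em : 0 < e ^+ m by rewrite exprn_gt0.
have Ce := cball_integrable e.
have ui : vintegrable (fun z => \1_(cball e) z * u z).
  apply: (vintegrable_bounded (B := B) (D := D)).
  - by apply: vmeasM => //; exact: mind.
  - move=> y; rewrite normrM -[leRHS]mul1r; exact: (ler_pM (normr_ge0 _) (normr_ge0 _) (ind1 e y) (uB y).1).
  - by move=> y /uD [-> _]; rewrite mulr0.
have err2 : `|vint (fun z => \1_(cball e) z * u z) - e ^+ m * ball_vol * u 0|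
     <= (1 + m%:R * B) * e * (e ^+ m * ball_vol).
  rewrite -(vint_cball e0) (mulrC (vint _) (u 0)) -(vintZ (u 0) Ce) -(vintZ _ Ce).
  rewrite -(vintB ui (vintegrableZ (u 0) Ce)).
  apply: (le_norm_vint _ (vintegrableZ _ Ce)).
    exact: vintegrable_meas (vintegrableB ui (vintegrableZ (u 0) Ce)).
  move=> z; have [ze|ze] := leP (enorm z) e; last first.
    by rewrite (indD e z ze) !(mul0r, mulr0) subrr normr0.
  rewrite indicT// mulr1 mul1r mulr1.
  have := tauP 0 z (le_lt_trans ze etau); rewrite add0r mul1r => h.
  rewrite -[u z - u 0](subrK (\sum_i z 0 i * du i 0)); apply: (le_trans (ler_normD _ _)).
  have h' := sum_coord_le z (fun i => (uB 0).2 i).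
  apply: (le_trans (lerD h h')).
  rewrite mulrDl mul1r -mulrA (mulrC B); apply: lerD => //.
  by apply: ler_wpM2l => //; exact: ler_wpM2r.
have key : I + m%:R * ball_vol * u 0 = (I - vint (fun z => theta e z * rad z)) -
   m%:R * (e ^+ m)^-1 * (vint (fun z => \1_(cball e) z * u z) - e ^+ m * ball_vol * u 0).
  rewrite (thg e e0); field; exact: lt0r_neq0.
rewrite key; apply: (le_trans (ler_normB _ _)).
have -> : eta * C = m%:R * B * eta * W + m%:R * (e ^+ m)^-1 * ((1 + m%:R * B) * eta * (e ^+ m * ball_vol)).
  by rewrite /C; field; exact: lt0r_neq0.
apply: lerD => //; rewrite normrM ger0_norm; last by rewrite mulr_ge0// invr_ge0 ltW.
apply: ler_wpM2l; first by rewrite mulr_ge0// invr_ge0 ltW.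
apply: (le_trans err2); apply: ler_wpM2r; first by rewrite mulr_ge0// ltW.
apply: ler_wpM2l; first by rewrite addr_ge0// mulr_ge0.
by apply: (le_trans eeta); rewrite expr2 ler_piMl ?(ltW eta0) ?(ltW eta1).
Qed.

Lemma vol_pt0 : (0 < m)%N -> lebesgue_vol [set 0 : V] = 0%E.
Proof.
move=> m0; rewrite (_ : [set 0 : V] = [set y : V | forall i, [set (0 : R)] (y 0 i)]).
  rewrite (vol_coord (B := fun=> [set 0]))//.
  by rewrite (bigD1 (Ordinal m0))//= lebesgue_measure_set1 mul0e.
apply/seteqP; split => y /=; first by move=> -> i; rewrite mxE.
by move=> h; apply/rowP => i; rewrite h mxE.
Qed.

(** The cone over the unit sphere is the unit ball without its centre. *)
Lemma sphere_areaE : (0 < m)%N -> sphere_area R m = m%:R * ball_vol.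
Proof.
move=> m0.
have mc := @vset_enorm_le R m 1.
have m1 : vset [set 0 : V] by apply: vset_closed; exact: accessible_closed_set1 (hausdorff_accessible (@norm_hausdorff _ V)) 0.
rewrite /sphere_area /sphere_measure.
rewrite (_ : [set _ | _ in _ & _ in _] = cball 1 `\` [set 0 : V]); last first.
  apply/seteqP; split => y.
    move=> [t /= /andP[t0 t1] [x /= x1 <-]]; split => /=.
      by rewrite /cball /= enormZ x1 mulr1 gtr0_norm.
    apply/eqP; rewrite -enorm_eq0 enormZ x1 mulr1 normr_eq0 gt_eqF//.
  move=> [/= y1 y0]; have ny : 0 < enorm y by rewrite enorm_gt0; exact/eqP.
  exists (enorm y); first by rewrite /= ny.
  exists ((enorm y)^-1 *: y); last by rewrite scalerA divff ?scale1r// gt_eqF.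
  by rewrite /= enormZ gtr0_norm ?invr_gt0// mulVf// gt_eqF.
have -> : lebesgue_vol (cball 1 `\` [set 0 : V]) = lebesgue_vol (cball 1).
  have fin1 : (lebesgue_vol (cball 1) < +oo)%E by exact: (@vol_bounded_fin R m _ 1 mc).
  rewrite [LHS](measureD mc m1 fin1) [X in (_ - X)%E](_ : _ = 0%E) ?sube0//.
  apply/eqP; rewrite eq_le measure_ge0 andbT -(vol_pt0 m0).
  by apply: le_measure; rewrite ?inE//; exact: measurableI.
rewrite fineM// ge0_fin_numE; last exact: measure_ge0.
exact: (@vol_bounded_fin R m _ 1 mc).
Qed.

Lemma ball_vol_gt0 : (0 < m)%N -> 0 < ball_vol.
Proof.
move=> m0; have M0 : 0 < m%:R :> R by rewrite ltr0n.
pose r : R := (m%:R)^-1 / 2; have r0 : 0 < r by rewrite divr_gt0// invr_gt0.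
have mc := @vset_enorm_le R m 1.
have sub : closed_box (0 : V) r `<=` cball 1.
  move=> y yb; rewrite /cball /=; apply: (le_trans (enorm_le_sum y)).
  apply: (@le_trans _ _ (\sum_(i < m) r)); first by apply: ler_sum => i _; have := yb i; rewrite mxE subr0.
  rewrite sumr_const card_ord -mulr_natl /r mulrA divff ?gt_eqF// mul1r.
  by rewrite invf_le1// ler1n.
have := le_vol (vset_closed_box 0 r) mc sub; rewrite vol_closed_box ?(ltW r0)//.
have fin1 : (lebesgue_vol (cball 1) < +oo)%E by exact: (@vol_bounded_fin R m _ 1 mc).
rewrite -[X in (_ <= X)%E]fineK ?ge0_fin_numE ?measure_ge0// lee_fin.
by apply: lt_le_trans; rewrite exprn_gt0// mulr_gt0.
Qed.
End NewtonKernel.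

(** * Compactly supported functions of class C^1 *)

Section CompactSupport.
Variables (R : realType) (m : nat).
Local Notation V := 'rV[R]_m.
Implicit Types (f h u : V -> R) (x y z w v : V).

Lemma cball_compact (D : R) : compact [set y : V | enorm y <= D].
Proof.
apply: bounded_closed_compact.
  exists D; split; first exact: num_real.
  by move=> M DM y /= yD; apply: (le_trans (norm_le_enorm y)); rewrite (le_trans yD)// ltW.
rewrite (_ : mkset _ = (@enorm R m) @^-1` `]-oo, D]%classic); last first.
  by apply/seteqP; split => y /=; rewrite in_itv.
by apply: closed_comp => [y _|]; [exact: continuous_enorm | exact: interval_closed].
Qed.

Lemma compact_support_bounded f (D : R) : continuous f ->
  (forall y, D < enorm y -> f y = 0) -> exists B : R, forall y, `|f y| <= B.
Proof.
move=> cf fD.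
have [M [Mr MP]] : bounded_set (f @` [set y : V | enorm y <= D]).
  apply: compact_bounded; apply: continuous_compact; last exact: cball_compact.
  exact: continuous_subspaceT.
exists (`|M| + 1) => y; have [yD|yD] := ltP D (enorm y).
  by rewrite fD// normr0 addr_ge0.
apply: (MP (`|M| + 1)); first by rewrite ltr_pwDr// ler_norm.
by exists y.
Qed.

(** Heine-Cantor, in the form of a covering argument. *)
Lemma compact_support_uniform f (D : R) : continuous f ->
  (forall y, D < enorm y -> f y = 0) -> forall e, 0 < e ->
  exists2 tau : R, 0 < tau & forall x w, enorm w < tau -> `|f (x + w) - f x| <= e.
Proof.
move=> cf fD e e0.
have near_x x : [set y : V | enorm y <= D + 1] x ->
    \forall y \near x & w \near nbhs (0 : V), `|f (y + w) - f y| <= e.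
  move=> _.
  have e20 : 0 < e / 2 by rewrite divr_gt0.
  have /continuous_enormP/(_ _ e20)[d d0 dP] := cf x.
  have d20 : 0 < d / 2 by rewrite divr_gt0.
  exists ([set y : V | enorm (y - x) < d / 2], [set w : V | enorm w < d / 2]).
    split; apply/nbhs_enormP; exists (d / 2) => // w.
    by rewrite subr0.
  move=> [y w] [/= yx wd].
  have h1 : `|f y - f x| < e / 2 by apply: dP; lra.
  have h2 : `|f (y + w) - f x| < e / 2.
    apply: dP; rewrite addrAC; apply: (le_lt_trans (enormD _ _)); lra.
  rewrite -(subrKA (f x)); apply: (le_trans (ler_normD _ _)).
  by rewrite (distrC (f x)); lra.
have /compact_near_coveringP cov := @cball_compact (D + 1).
have /nbhs_enormP[tau tau0 tauP] : nbhs (0 : V)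
    (fun w => [set y : V | enorm y <= D + 1] `<=` (fun y => `|f (y + w) - f y| <= e)).
  exact: (cov V _ (fun w y => `|f (y + w) - f y| <= e) (nbhs_filter (0 : V)) near_x).
exists (Num.min tau 1); first by rewrite lt_min tau0 ltr01.
move=> x w; rewrite lt_min => /andP[wt w1].
have [xD|xD] := leP (enorm x) (D + 1).
  by apply: tauP; rewrite ?subr0.
have xw : D < enorm (x + w).
  by have := ler_enormB x (- w); rewrite opprK enormN; lra.
by rewrite !fD ?subrr ?normr0 ?ltW//; lra.
Qed.

Lemma enorm_le_coord x y : (forall i, `|x 0 i| <= `|y 0 i|) -> enorm x <= enorm y.
Proof.
move=> h; rewrite /enorm; apply: ler_wsqrtr; apply: ler_sum => i _.
by rewrite -!expr2 -(real_normK (num_real (x 0 i))) -(real_normK (num_real (y 0 i))) lerXn2r ?nnegrE.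
Qed.

Lemma is_deriveZv f x v (c d : R) : is_derive x v f d -> is_derive x (c *: v) f (c * d).
Proof.
have [->|c0] := eqVneq c 0.
  rewrite scale0r mul0r => _; apply/is_deriveP => e e0; exists 1 => // t _ _.
  by rewrite scaler0 addr0 subrr mulr0 subr0 normr0 mulr_ge0// ltW.
move=> /is_deriveP h; apply/is_deriveP => e e0.
have ec : 0 < e / `|c| by rewrite divr_gt0// normr_gt0.
have [tau tau0 tauP] := h _ ec; exists (tau / `|c|); first by rewrite divr_gt0// normr_gt0.
move=> t t0; rewrite ltr_pdivlMr ?normr_gt0// -normrM => tt.
have tc : t * c != 0 by rewrite mulf_neq0.
have := tauP _ tc tt; rewrite scalerA mulrA normrM mulrA.
by rewrite (mulrAC _ `|t|) divfK ?normr_eq0.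
Qed.

(** The Taylor estimate of a C^1 function, moving along one coordinate at a
   time: each step is the mean value theorem for one partial derivative. *)
Lemma partials_taylor f (df : 'I_m -> V -> R) x w (e : R) :
  (forall y i, enorm (y - x) <= enorm w -> is_derive y (delta_mx 0 i) f (df i y)) ->
  (forall y i, enorm (y - x) <= enorm w -> `|df i y - df i x| <= e) ->
  `|f (x + w) - f x - \sum_i w 0 i * df i x| <= m%:R * (enorm w * e).
Proof.
move=> fd de; pose p (k : nat) : V := \row_j (if (j < k)%N then w 0 j else 0).
have pin k i (t : R) : nat_of_ord i = k -> 0 <= t -> t <= 1 ->
    enorm (x + p k + t *: (w 0 i *: delta_mx 0 i) - x) <= enorm w.
  move=> ik t0 t1; rewrite addrC !addrA addNr add0r; apply: enorm_le_coord => j.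
  rewrite !mxE eqxx /=; have [->|ji] := eqVneq j i.
    by rewrite ik ltnn add0r mulr1 normrM ler_piMl// ger0_norm.
  by rewrite mulr0 mulr0 addr0; case: ifP => // _; rewrite normr0.
have pS (i : 'I_m) : p i.+1 = p i + w 0 i *: delta_mx 0 i.
  apply/rowP => j; rewrite !mxE eqxx /= ltnS leq_eqVlt.
  have [->|ji] := eqVneq j i; first by rewrite eqxx ltnn add0r mulr1.
  rewrite mulr0 addr0 (_ : (_ == _ :> nat) = false)//; exact: negbTE.
have step (i : 'I_m) : `|f (x + p i.+1) - f (x + p i) - w 0 i * df i x| <= enorm w * e.
  have e0 : 0 <= e by apply: le_trans (de x i _); rewrite ?subrr ?enorm0 ?enorm_ge0.
  have [|t [t0 t1]] := @MVT_line R V f (x + p i) (w 0 i *: delta_mx 0 i)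
      (fun t => w 0 i * df i (x + p i + t *: (w 0 i *: delta_mx 0 i))).
    by move=> t t0 t1; apply: is_deriveZv; apply: fd; exact: pin.
  rewrite -addrA -pS => ->; rewrite -mulrBr normrM; apply: ler_pM => //.
    exact: coord_le_enorm.
  by apply: de; exact: pin.
have pm : p m = w by apply/rowP => j; rewrite mxE ltn_ord.
have p0 : p 0%N = 0 by apply/rowP => j; rewrite !mxE.
have -> : f (x + w) - f x = \sum_(i < m) (f (x + p i.+1) - f (x + p i)).
  rewrite -(big_mkord xpredT (fun k => f (x + p k.+1) - f (x + p k))).
  by rewrite telescope_sumr// pm p0 addr0.
rewrite -sumrB; apply: (le_trans (ler_norm_sum _ _ _)).
apply: (@le_trans _ _ (\sum_(i < m) enorm w * e)); first exact: ler_sum.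
by rewrite sumr_const card_ord mulr_natl.
Qed.

Lemma compact_support_C1 u (du : 'I_m -> V -> R) (D : R) :
  continuous u -> (forall i, continuous (du i)) ->
  (forall y i, is_derive y (delta_mx 0 i) u (du i y)) ->
  (forall y, D < enorm y -> u y = 0 /\ forall i, du i y = 0) ->
  exists B, uniform_C1 D B u du.
Proof.
move=> cu cdu ud uD.
have uD' y : D < enorm y -> u y = 0 by case/uD.
have duD i y : D < enorm y -> du i y = 0 by case/uD.
have [B0 uB] := compact_support_bounded cu uD'.
have /choice[B1 duB] i := compact_support_bounded (cdu i) (duD i).
exists (B0 + \sum_i B1 i).
have B00 : 0 <= B0 by apply: le_trans (uB 0).
have B10 i : 0 <= B1 i by apply: le_trans (duB i 0).
split => //.
- by split => [|i]; exact: vmeas_continuous.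
- move=> y; split; first by apply: (le_trans (uB y)); rewrite lerDl sumr_ge0.
  move=> i; apply: (le_trans (duB i y)); rewrite (bigD1 i)//= addrCA lerDl.
  by rewrite addr_ge0// sumr_ge0.
move=> e e0; have [|m0] := posnP m.
  move=> m0; exists 1 => // y w _; rewrite (_ : w = 0); last first.
    by apply/rowP => j; have := ltn_ord j; rewrite {2}m0 ltn0.
  rewrite addr0 subrr sub0r big1 ?oppr0 ?normr0 ?enorm0 ?mulr0// => i _.
  by rewrite mxE mul0r.
have em : 0 < e / m%:R by rewrite divr_gt0// ltr0n.
have /choice[tau tauP] : forall i, exists tau : R, 0 < tau /\
    forall x w, enorm w < tau -> `|du i (x + w) - du i x| <= e / m%:R.
  move=> i; have [tau t0 tP] := compact_support_uniform (cdu i) (duD i) em.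
  by exists tau.
exists (\big[Num.min/1]_i tau i).
  apply/bigmin_gtP; split => // i _; exact: (tauP i).1.
move=> y w wt; have := @partials_taylor u du y w (e / m%:R).
rewrite (_ : m%:R * _ = e * enorm w); last first.
  by move: (enorm w) => r; field; rewrite pnatr_eq0 -lt0n.
apply=> // z i zy; rewrite -[z](subrKC y); apply: (tauP i).2.
apply: (le_lt_trans zy); apply: (lt_le_trans wt).
by rewrite bigmin_le_cond.
Qed.

End CompactSupport.

(** * Cutoffs and mixed derivatives *)

Section Cutoff.
Variable R : realType.
Implicit Types (s t : R).

Definition pos_part t : R := Num.max t 0.

(** A C^1 function of one variable equal to 1 up to 1 and to 0 from 2 on; the
   squared positive part is the simplest C^1 function vanishing on a half-line. *)
Definition bump t : R := pos_part (1 - pos_part (t - 1) ^+ 2) ^+ 2.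

Definition dbump t : R :=
  2 * pos_part (1 - pos_part (t - 1) ^+ 2) * - (2 * pos_part (t - 1)).

Lemma continuous_pos_part : continuous pos_part.
Proof. by move=> t; apply: continuous_max; [exact: cvg_id | exact: cvg_cst]. Qed.

Lemma is_derive_sqr_pos_part t : is_derive t 1 (fun s => pos_part s ^+ 2) (2 * pos_part t).
Proof.
apply/is_deriveP => e e0; exists e => // s s0 se; rewrite [s%:A]mulr1.
apply: (@le_trans _ _ (`|s| * `|s|)); last exact: (ler_wpM2r (normr_ge0 s) (ltW se)).
rewrite -normrM ger0_norm; last by rewrite -expr2 sqr_ge0.
rewrite ler_norml /pos_part.
by case: (leP (t + s) 0) => h1; case: (leP t 0) => h2; apply/andP; split; nra.
Qed.

Lemma is_derive_bump t : is_derive t 1 bump (dbump t).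
Proof.
have h1 : is_derive t 1 (fun s => pos_part (s - 1) ^+ 2) (2 * pos_part (t - 1)).
  have := is_derive_sqr_pos_part (t - 1) => /is_deriveP h; apply/is_deriveP => e e0.
  have [tau t0 tP] := h e e0; exists tau => // s s0 st; have := tP s s0 st.
  by rewrite -[t - 1 + _]addrA (addrC (-1)) addrA.
have h2 : is_derive t 1 (fun s => 1 - pos_part (s - 1) ^+ 2) (- (2 * pos_part (t - 1))).
  move/is_deriveP: h1 => h; apply/is_deriveP => e e0.
  have [tau t0 tP] := h e e0; exists tau => // s s0 st; have := tP s s0 st.
  rewrite -normrN; congr (_ <= _); congr `|_|; ring.
rewrite (_ : bump = (fun s => pos_part s ^+ 2) \o (fun s => 1 - pos_part (s - 1) ^+ 2))//.
have := @is_derive1_comp R (fun s => pos_part s ^+ 2) (fun s => 1 - pos_part (s - 1) ^+ 2) t _ _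
  (is_derive_sqr_pos_part (1 - pos_part (t - 1) ^+ 2)) h2.
by rewrite /dbump.
Qed.

Lemma bump1 t : t <= 1 -> bump t = 1.
Proof.
move=> t1; rewrite /bump {2}/pos_part max_r ?subr_le0//.
by rewrite expr0n subr0 /pos_part max_l// expr1n.
Qed.

Lemma bump0 t : 2 <= t -> bump t = 0 /\ dbump t = 0.
Proof.
move=> t2; have h : pos_part (1 - pos_part (t - 1) ^+ 2) = 0.
  by rewrite /pos_part (max_l (x := t - 1)) ?max_r//; nra.
by rewrite /bump /dbump h expr0n mulr0 mul0r.
Qed.

Lemma continuous_dbump : continuous dbump.
Proof.
have c1 : continuous (fun t => pos_part (t - 1)).
  move=> t; apply: (@continuous_comp _ _ _ (fun t => t - 1) pos_part); last exact: continuous_pos_part.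
  by apply: cvgB; [exact: cvg_id | exact: cvg_cst].
move=> t; apply: (@continuousM _ _ (fun t => 2 * pos_part (1 - pos_part (t - 1) ^+ 2))
  (fun t => - (2 * pos_part (t - 1)))); last first.
  by apply: continuousN; apply: continuousM; [exact: cvg_cst | exact: c1].
apply: continuousM; first exact: cvg_cst.
apply: (@continuous_comp _ _ _ (fun t => 1 - pos_part (t - 1) ^+ 2) pos_part).
  apply: cvgB; first exact: cvg_cst.
  apply: (@continuous_comp _ _ _ (fun t => pos_part (t - 1)) (fun s : R => s ^+ 2)).
    exact: c1.
  exact: exprn_continuous.
exact: continuous_pos_part.
Qed.

Lemma continuous_bump : continuous bump.
Proof.
move=> t; apply: differentiable_continuous; apply/derivable1_diffP.
by have [] := is_derive_bump t.
Qed.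
End Cutoff.

Section LocallyC1.
Variables (R : realType) (m : nat).
Local Notation V := 'rV[R]_m.
Implicit Types (f g h u : V -> R) (x y z w v : V).

Lemma continuous_const (c : R) x : {for x, continuous (fun _ : V => c)}.
Proof.
apply/continuous_enormP => e e0; exists 1 => // y _.
by rewrite subrr normr0.
Qed.

Lemma continuous_local f g x (r : R) : 0 < r ->
  (forall y, enorm (y - x) < r -> f y = g y) ->
  {for x, continuous f} -> {for x, continuous g}.
Proof.
move=> r0 fg /continuous_enormP cf; apply/continuous_enormP => e e0.
have [d d0 dP] := cf e e0; exists (Num.min r d); first by rewrite lt_min r0.
move=> y; rewrite lt_min => /andP[yr yd].
by rewrite -!fg ?subrr ?enorm0//; exact: dP.
Qed.

Lemma is_derive_local f g x v (d r : R) : 0 < r ->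
  (forall y, enorm (y - x) < r -> f y = g y) ->
  is_derive x v f d -> is_derive x v g d.
Proof.
move=> r0 fg; apply: near_eq_is_derive; apply/nbhs_enormP; exists r => //.
Qed.

Lemma is_derive_shift f x v c (d : R) :
  is_derive (x + c) v f d -> is_derive x v (fun y => f (y + c)) d.
Proof.
move=> /is_deriveP h; apply/is_deriveP => e e0; have [tau tau0 tauP] := h e e0.
by exists tau => // t t0 tt; have := tauP t t0 tt; rewrite -[x + c + _]addrA (addrC c) addrA.
Qed.

(** The second order difference of f over a small parallelogram is, by two
   applications of the mean value theorem, a mixed second derivative nearby. *)
Lemma double_difference f f1 f12 x0 a b (r s : R) :
  (forall x, enorm (x - x0) < r -> is_derive x a f (f1 x)) ->
  (forall x, enorm (x - x0) < r -> is_derive x b f1 (f12 x)) ->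
  0 < s -> s * (enorm a + enorm b) < r ->
  exists2 p, enorm (p - x0) <= s * (enorm a + enorm b) &
    f (x0 + s *: a + s *: b) - f (x0 + s *: a) - f (x0 + s *: b) + f x0 = s ^+ 2 * f12 p.
Proof.
move=> fa fb s0 sr.
have ab (t t' : R) : 0 <= t -> t <= 1 -> 0 <= t' -> t' <= 1 ->
    enorm (x0 + t *: (s *: a) + t' *: (s *: b) - x0) <= s * (enorm a + enorm b).
  move=> t0 t1 t'0 t'1; rewrite addrC !addrA addNr add0r.
  apply: (le_trans (enormD _ _)); rewrite !enormZ !ger0_norm ?(ltW s0)// mulrDr.
  by apply: lerD; rewrite ler_piMl// mulr_ge0 ?enorm_ge0// ltW.
have [|t [t0 t1 E]] := @MVT_line R V (fun x => f (x + s *: b) - f x) x0 (s *: a)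
    (fun t => s * (f1 (x0 + t *: (s *: a) + s *: b) - f1 (x0 + t *: (s *: a)))).
  move=> t t0 t1; apply: is_deriveZv; apply: is_deriveB.
    apply: is_derive_shift; apply: fa; apply: le_lt_trans sr.
    by have := ab t 1 t0 t1 ler01 (lexx 1); rewrite scale1r.
  apply: fa; apply: le_lt_trans sr.
  by have := ab t 0 t0 t1 (lexx 0) ler01; rewrite scale0r addr0.
have [|t' [t'0 t'1 E']] := @MVT_line R V f1 (x0 + t *: (s *: a)) (s *: b)
    (fun t' => s * f12 (x0 + t *: (s *: a) + t' *: (s *: b))).
  by move=> t' t'0 t'1; apply: is_deriveZv; apply: fb; apply: le_lt_trans sr; exact: ab.
exists (x0 + t *: (s *: a) + t' *: (s *: b)); first exact: ab.
rewrite expr2 -mulrA -E' -E; ring.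
Qed.

(** Schwarz: both mixed derivatives are limits of the same second difference. *)
Lemma mixed_derivatives f f1 f2 f12 f21 x0 a b (r : R) : 0 < r ->
  (forall x, enorm (x - x0) < r -> is_derive x a f (f1 x)) ->
  (forall x, enorm (x - x0) < r -> is_derive x b f (f2 x)) ->
  (forall x, enorm (x - x0) < r -> is_derive x b f1 (f12 x)) ->
  (forall x, enorm (x - x0) < r -> is_derive x a f2 (f21 x)) ->
  {for x0, continuous f12} -> {for x0, continuous f21} -> f12 x0 = f21 x0.
Proof.
move=> r0 fa fb fab fba c12 c21; apply: subr0_eq.
apply/eqP; rewrite -normr_eq0 eq_le normr_ge0 andbT; apply/ler_addgt0Pl => e e0.
rewrite addr0; have e2 : 0 < e / 2 by rewrite divr_gt0.
have /continuous_enormP/(_ _ e2)[d1 d10 d1P] := c12.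
have /continuous_enormP/(_ _ e2)[d2 d20 d2P] := c21.
pose A := enorm a + enorm b + 1.
have A0 : 0 < A by rewrite ltr_wpDl// addr_ge0// enorm_ge0.
pose q := Num.min r (Num.min d1 d2).
have q0 : 0 < q by rewrite !lt_min r0 d10.
pose s := q / A / 2.
have s0 : 0 < s by rewrite !divr_gt0.
have sq : s * (enorm a + enorm b) < q.
  apply: (@lt_trans _ _ (s * A)); first by rewrite ltr_pM2l// /A ltrDl.
  by rewrite /s mulrAC divfK ?gt_eqF// ltr_pdivrMr// ltr_pMr// ltr1n.
move: (sq); rewrite !lt_min => /and3P[sr sd1 sd2].
have [p px E1] := double_difference fa fab s0 sr.
rewrite addrC in sr sd2; have [p' p'x E2] := double_difference fb fba s0 sr.
have E : f12 p = f21 p'.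
  have s2 : s ^+ 2 != 0 by rewrite expf_neq0// gt_eqF.
  apply: (mulfI s2); rewrite -E1 -E2 (addrAC x0 (s *: b)); ring.
have h1 := d1P p (le_lt_trans px sd1); have h2 := d2P p' (le_lt_trans p'x sd2).
rewrite (_ : _ - _ = (f21 p' - f21 x0) - (f12 p - f12 x0)); last by rewrite E; ring.
by apply: (le_trans (ler_normB _ _)); lra.
Qed.

Definition C1_near h x0 := exists r B D : R, exists (u : V -> R) du,
  [/\ 0 < r, uniform_C1 D B u du & forall y, enorm (y - x0) < r -> h y = u y].

Lemma is_derive_chain (g : R -> R) f x v (dg d : R) :
  is_derive (f x) 1 g dg -> is_derive x v f d -> is_derive x v (g \o f) (dg * d).
Proof.
move=> gd fd.
have fl : is_derive (0 : R) 1 (fun t : R => f (x + t *: v)) d.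
  by apply: is_derive_lineP; rewrite scale0r addr0.
have gl : is_derive (f (x + 0 *: v)) 1 g dg by rewrite scale0r addr0.
have /is_deriveP h := is_derive1_comp gl fl; apply/is_deriveP => e e0.
have [tau t0 tP] := h e e0; exists tau => // t tn tt; have := tP t tn tt.
by rewrite /= add0r [t%:A]mulr1 scale0r addr0.
Qed.

(** A function that is C^1 on a ball agrees, on a smaller ball, with one that is
   C^1 on the whole space with compact support: its product with a cutoff. *)
Lemma partials_C1_near h (dh : 'I_m -> V -> R) x0 (r : R) : 0 < r ->
  (forall y, enorm (y - x0) < r -> {for y, continuous h} /\
     forall i, is_derive y (delta_mx 0 i) h (dh i y) /\ {for y, continuous (dh i)}) ->
  C1_near h x0.
Proof.
move=> r0 hC; pose s := r / 4; have s0 : 0 < s by rewrite divr_gt0.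
have s2 : 0 < s ^+ 2 by rewrite exprn_gt0.
pose rho x := dotv (x - x0) (x - x0) / s ^+ 2.
pose drho (i : 'I_m) x := 2 * (x 0 i - x0 0 i) / s ^+ 2.
have rhoE x : rho x = (enorm (x - x0) / s) ^+ 2 by rewrite expr_div_n sqr_enorm.
have rho_le x : enorm (x - x0) <= s -> rho x <= 1.
  move=> h1; rewrite rhoE expr_le1//; last by rewrite divr_ge0 ?enorm_ge0 ?(ltW s0).
  by rewrite ler_pdivrMr// mul1r.
(* r / 2 = 2 s, so that rho is even at least 4 there *)
have rho_ge x : r / 2 <= enorm (x - x0) -> 2 <= rho x.
  move=> h1; have : 2 <= enorm (x - x0) / s by rewrite ler_pdivlMr// /s; lra.
  by rewrite rhoE; nra.
have drhoP i x : is_derive x (delta_mx 0 i) rho (drho i x).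
  apply/is_deriveP => e e0; exists (e * s ^+ 2); first by rewrite mulr_gt0.
  move=> t t0 tt; rewrite /rho (addrAC x) /drho.
  rewrite (_ : x 0 i - x0 0 i = (x - x0) 0 i); last by rewrite !mxE.
  move: (x - x0) => z; rewrite dotvDl !dotvDr !dotvZl !dotvZr.
  have -> : dotv (delta_mx 0 i) (delta_mx 0 i) = 1 :> R by rewrite -sqr_enorm enorm_delta expr1n.
  rewrite (dotvC (delta_mx 0 i) z).
  have -> : dotv z (delta_mx 0 i) = z 0 i by rewrite dotvC /dotv sum_delta.
  rewrite (_ : _ - _ = (t / s ^+ 2) * t); last by field; exact: lt0r_neq0.
  rewrite normrM; apply: (ler_wpM2r (normr_ge0 t)).
  by rewrite normrM normfV (gtr0_norm s2) ler_pdivrMr// ltW.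
have crho : continuous rho.
  have cd : continuous (fun x => enorm (x - x0)).
    apply: (@lipschitz_continuous R m _ 1) => x y; rewrite mul1r.
    by apply: (le_trans (ler_dist_enorm _ _)); rewrite opprB addrA subrK.
  move=> x; apply: (@continuous_local (fun x => (enorm (x - x0) / s) ^+ 2) rho x 1 ltr01) => //.
  apply: (@continuous_comp _ _ _ (fun x => enorm (x - x0) / s) (fun s : R => s ^+ 2)).
    apply: (@continuousM _ _ (fun x => enorm (x - x0)) (fun=> s^-1)); first exact: cd.
    exact: continuous_const.
  exact: exprn_continuous.
have ccoord i : continuous (fun x : V => x 0 i) by exact: coord_continuous.
have cdrho i : continuous (drho i).
  move=> x; apply: (@continuousM _ _ (fun x : V => 2 * (x 0 i - x0 0 i)) (fun=> (s ^+ 2)^-1)).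
    apply: (@continuousM _ _ (fun=> 2) (fun x : V => x 0 i - x0 0 i)); first exact: continuous_const.
    by apply: continuousB; [exact: ccoord | exact: continuous_const].
  exact: continuous_const.
pose u y := bump (rho y) * h y.
pose du i y := bump (rho y) * dh i y + h y * (dbump (rho y) * drho i y).
have cb : continuous (fun y => bump (rho y)).
  by move=> y; apply: continuous_comp; [exact: crho | exact: continuous_bump].
have cdb : continuous (fun y => dbump (rho y)).
  by move=> y; apply: continuous_comp; [exact: crho | exact: continuous_dbump].
have u0 y : r / 2 <= enorm (y - x0) -> u y = 0 /\ forall i, du i y = 0.
  by move=> /rho_ge/bump0[b0 b0']; rewrite /u /du b0 b0'; split=> [|i]; rewrite !(mul0r,mulr0)// addr0.
have away y : ~~ (enorm (y - x0) < r) -> forall z, enorm (z - y) < r / 2 -> r / 2 <= enorm (z - x0).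
  rewrite -leNgt => yr z zy; have := ler_enormB (y - x0) (y - z).
  rewrite opprB [y - x0 + _]addrC addrA subrK (enormBC y z); lra.
have r20 : 0 < r / 2 by rewrite divr_gt0.
have uP y : [/\ {for y, continuous u}, forall i, {for y, continuous (du i)} &
    forall i, is_derive y (delta_mx 0 i) u (du i y)].
  have [yr|yr] := boolP (enorm (y - x0) < r).
    have [ch hi] := hC y yr; split.
    - by apply: continuousM; [exact: cb | exact: ch].
    - move=> i; have [hd cdh] := hi i; apply: continuousD.
        by apply: continuousM; [exact: cb | exact: cdh].
      apply: continuousM; first exact: ch.
      by apply: continuousM; [exact: cdb | exact: cdrho].
    - move=> i; have [hd _] := hi i.
      have bd := is_derive_chain (is_derive_bump (rho y)) (drhoP i y).
      exact: (is_deriveM bd hd).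
  have z0 := fun z zy => u0 z (away y yr z zy).
  have zz (f : V -> R) : (forall z, enorm (z - y) < r / 2 -> f z = 0) ->
      {for y, continuous f} /\ (forall v, is_derive y v f 0).
    move=> f0; split.
      apply: (@continuous_local (fun=> 0) f y _ r20); last exact: continuous_const.
      by move=> z /f0.
    move=> v; apply: (@is_derive_local (fun=> 0) f y v 0 _ r20); first by move=> z /f0.
  have [cu ud] := zz u (fun z zy => (z0 z zy).1).
  split => // [i|i]; first by have [] := zz (du i) (fun z zy => (z0 z zy).2 i).
  by rewrite (z0 y _).2 ?subrr ?enorm0//; exact: ud.
have [||||B uB] := @compact_support_C1 R m u du (enorm x0 + r).
- by move=> y; have [] := uP y.
- by move=> i y; have [_ + _] := uP y; exact.
- by move=> y i; have [_ _ +] := uP y; exact.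
- move=> y yD; apply: u0; have := ler_enormB y x0; lra.
exists s, B, (enorm x0 + r), u, du; split => // y ys.
by rewrite /u bump1 ?mul1r// rho_le// ltW.
Qed.

End LocallyC1.

(** * Second derivatives of potentials *)

Lemma is_derive_bigsum (R : realType) (W : normedModType R) (I : Type) (s : seq I)
    (F : I -> W -> R) (d : I -> R) (x v : W) :
  (forall i, is_derive x v (F i) (d i)) ->
  is_derive x v (fun y => \sum_(i <- s) F i y) (\sum_(i <- s) d i).
Proof.
move=> Fd; elim: s => [|i s IH].
  rewrite big_nil; apply/is_deriveP => e e0; exists 1 => // t _ _.
  by rewrite !big_nil mulr0 !subr0 normr0 mulr_ge0// ltW.
rewrite big_cons (_ : (fun y => _) = fun y => F i y + \sum_(i <- s) F i y).
  exact: is_deriveD.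
by apply/funext => y; rewrite big_cons.
Qed.

Section SecondDerivatives.
Variables (R : realType) (m n : nat).
Local Notation V := 'rV[R]_m.
Hypotheses (mn : m = n.+2) (n0 : (0 < n)%N).
Variables (delta C D : R) (h : V -> R).
Hypotheses (d0 : 0 < delta) (d1 : delta < 1) (hd : density delta C D h).
Variables (k : V -> R) (dk : 'I_m -> V -> R) (ddk : 'I_m -> 'I_m -> V -> R).
Hypotheses (kn : riesz n k) (dkn : forall i, riesz n.+1 (dk i))
  (ddkn : forall i j, riesz n.+2 (ddk i j)).
Hypothesis dkP : forall z v, z != 0 -> is_derive z v k (\sum_i v 0 i * dk i z).
Hypothesis ddkP : forall i z v, z != 0 -> is_derive z v (dk i) (\sum_j v 0 j * ddk i j z).

(** The second derivatives of the potential of k, up to sign: near x0 the density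
   splits into u and h - u, and each part is differentiated in its own way. *)
Definition hess_potential (u : V -> R) (du : 'I_m -> V -> R) i j (x : V) : R :=
  potential (dk j) (du i) x - potential (ddk i j) (fun y => h y - u y) x.

Variables (x0 : V) (r B E : R) (u : V -> R) (du : 'I_m -> V -> R).
Hypotheses (r0 : 0 < r) (uC1 : uniform_C1 E B u du)
  (hu : forall y, enorm (y - x0) < r -> h y = u y).

Let m0 : (0 < m)%N. Proof. by rewrite mn. Qed.
Let h0 : 0 < 2^-1 :> R. Proof. by rewrite invr_gt0. Qed.
Let h1 : 2^-1 < 1 :> R. Proof. by rewrite invf_lt1// ltr1n. Qed.

Lemma uniform_C1_density : exists Cu, density 2^-1 Cu E u.
Proof.
have [[mu _] uB uD _] := uC1.
apply: (bounded_density m0 h0 h1 mu (B := B)) => y; first by case: (uB y).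
by move/uD => [].
Qed.

Lemma uniform_C1_density_partial i : exists Cu, density 2^-1 Cu E (du i).
Proof.
have [[_ mdu] uB uD _] := uC1.
apply: (bounded_density m0 h0 h1 (mdu i) (B := B)) => y; first by case: (uB y).
by move/uD => [].
Qed.

Lemma far_part_integrable : vintegrable (fun y => h y - u y).
Proof.
have [Cu [ui _ _]] := uniform_C1_density; have [hi _ _] := hd.
exact: vintegrableB.
Qed.

Lemma far_part0 y : enorm (y - x0) < r -> h y - u y = 0.
Proof. by move=> /hu ->; rewrite subrr. Qed.

(** The kernel dk is one order too singular for differentiating its potential.
   Near x0 the density is u, whose potential gains an order by moving one
   derivative onto u; the remaining density vanishes near x0. *)
Lemma potential_split i x :
  potential (dk i) h x = potential (dk i) (fun y => h y - u y) x - potential k (du i) x.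
Proof.
rewrite -(potential_by_parts mn n0 kn dkn dkP uC1 i x) /potential.
have [Cu ud] := uniform_C1_density.
have nm : (n.+1 < m)%N by rewrite mn.
have i1 := potential_integrable x (ltn0Sn n) nm d0 (dkn i) hd.
have i2 := potential_integrable x (ltn0Sn n) nm h0 (dkn i) ud.
have i3 : vintegrable (fun y => dk i (y - x) * (h y - u y)).
  by move: (vintegrableB i1 i2); congr vintegrable; apply/funext => y; rewrite mulrBr.
by rewrite -(vintD i3 i2); congr vint; apply/funext => y; ring.
Qed.

Lemma is_derive_hess_potential i x : enorm (x - x0) < r / 2 ->
  (forall v, is_derive x v (potential (dk i) h) (\sum_j v 0 j * hess_potential u du i j x)) /\
  forall j, {for x, continuous (hess_potential u du i j)}.
Proof.
move=> xx0; have [Cu dud] := uniform_C1_density_partial i.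
have fi := far_part_integrable.
split=> [v|j].
  rewrite (_ : potential (dk i) h =
      fun x => potential (dk i) (fun y => h y - u y) x - potential k (du i) x); last first.
    by apply/funext => z; exact: potential_split.
  have e1 := (far_potential_derive r0 (dkn i) (ddkn i) (ddkP i) fi far_part0 xx0).1 v.
  have e2 := (potential_derive mn n0 h0 h1 kn dkn dkP dud x).1 v.
  apply: (is_derive_eq (is_deriveB e1 e2)); rewrite -sumrB; apply: eq_bigr => j _.
  by rewrite /hess_potential; ring.
have [dddk dddkn dddkP] := riesz_derive (ddkn i j).
have cj : continuous (potential (dk j) (du i)).
  exact: (potential_continuous mn (ltn0Sn n) h0 h1 (dkn j) dud).
apply: continuousB; first exact: cj.
exact: (far_potential_derive r0 (ddkn i j) dddkn dddkP fi far_part0 xx0).2.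
Qed.

End SecondDerivatives.

Section NewtonPotential.
Variables (R : realType) (m : nat).
Local Notation V := 'rV[R]_m.
Hypothesis m2 : (2 < m)%N.

Let m0 : (0 < m)%N. Proof. exact: leq_trans m2. Qed.

Definition dE1 (i : 'I_m) (z : V) : R :=
  - (sphere_area R m)^-1 * (z 0 i * (enorm z ^+ m)^-1).

Definition ddE1 (i j : 'I_m) (z : V) : R :=
  - (sphere_area R m)^-1 * ((j == i)%:R * (enorm z ^+ m)^-1 +
     z 0 i * (- m%:R * (z 0 j * (enorm z ^+ m.+2)^-1))).

Lemma sphere_area_gt0 : 0 < sphere_area R m.
Proof. by rewrite sphere_areaE// mulr_gt0 ?ltr0n// ball_vol_gt0. Qed.

Lemma riesz_E1 n : m = n.+2 -> riesz n (@E1 R m).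
Proof.
move=> mn; rewrite (_ : @E1 R m = fun z : V => 1 / ((m%:R - 2) * sphere_area R m) * (enorm z ^+ n)^-1).
  by apply: rieszZ; exact: riesz_pow.
apply/funext => z; rewrite /E1 (_ : (m - 2)%N = n); last by rewrite mn subn2.
by rewrite !div1r invfM.
Qed.

Lemma riesz_dE1 n i : m = n.+2 -> riesz n.+1 (dE1 i).
Proof. by move=> mn; apply: rieszZ; apply: riesz_coord; rewrite -mn; exact: riesz_pow. Qed.

Lemma riesz_ddE1 n i j : m = n.+2 -> riesz n.+2 (ddE1 i j).
Proof.
move=> mn; rewrite -mn; apply: rieszZ; apply: rieszD.
  by apply: rieszZ; exact: riesz_pow.
by apply: riesz_coord; apply: rieszZ; apply: riesz_coord; exact: riesz_pow.
Qed.

Lemma is_derive_E1 z v : z != 0 -> is_derive z v (@E1 R m) (\sum_i v 0 i * dE1 i z).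
Proof.
move=> z0; have s0 := sphere_area_gt0.
have mE : m.-2.+2 = m by lia.
rewrite (_ : @E1 R m = fun z : V => 1 / ((m%:R - 2) * sphere_area R m) * (enorm z ^+ m.-2)^-1).
  apply: (is_derive_eq (is_deriveZ _ (is_derive_enormV m.-2 v z0))).
  rewrite /GRing.scale /= mulr_sumr; apply: eq_bigr => i _; rewrite /dE1 mE.
  have -> : m%:R - 2 = m.-2%:R :> R by rewrite -[in LHS]mE -addn2 natrD addrK.
  have n0 : m.-2%:R != 0 :> R by rewrite pnatr_eq0; lia.
  move: (enorm z ^- m) => q; by field; rewrite n0 gt_eqF.
by apply/funext => y; rewrite /E1 subn2 !div1r invfM.
Qed.

Lemma is_derive_dE1 i z v : z != 0 -> is_derive z v (dE1 i) (\sum_j v 0 j * ddE1 i j z).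
Proof.
move=> z0; have h := is_derive_coordM i (is_derive_enormV m v z0).
apply: (is_derive_eq (is_deriveZ (- (sphere_area R m)^-1) h)).
by rewrite /GRing.scale /= mulr_sumr; apply: eq_bigr => j _; rewrite /ddE1; ring.
Qed.

Lemma ddE1_trace z : z != 0 -> \sum_i ddE1 i i z = 0.
Proof.
move=> z0; rewrite -mulr_sumr big_split /=; apply/eqP; rewrite mulf_eq0; apply/orP; right.
under eq_bigr do rewrite eqxx mul1r.
rewrite sumr_const card_ord (_ : \sum_i _ = - m%:R * (enorm z ^+ m.+2)^-1 * dotv z z).
  have r0 : enorm z != 0 by rewrite gt_eqF// enorm_gt0.
  rewrite -sqr_enorm -addn2 exprD -mulr_natl; apply/eqP; field.
  by rewrite r0 expf_neq0.
by rewrite /dotv mulr_sumr; apply: eq_bigr => i _; ring.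
Qed.

(** The potential of E1 inverts the Laplacian up to sign. Near x0 the density is
   a C^1 function u and the singular part of the Laplacian is the divergence of
   the Newton kernel tested against u; the trace of ddE1 kills the rest. *)
Lemma laplace_newton n (delta C D : R) h x0 (r B E : R) u du : m = n.+2 ->
  0 < delta -> density delta C D h ->
  0 < r -> uniform_C1 E B u du -> (forall y, enorm (y - x0) < r -> h y = u y) ->
  \sum_i hess_potential h dE1 ddE1 u du i i x0 = h x0.
Proof.
move=> mn d0 hd r0 uC1 hu; have s0 := sphere_area_gt0.
have h0 : 0 < 2^-1 :> R by rewrite invr_gt0.
have nm : (n.+1 < m)%N by rewrite mn.
rewrite sumrB (_ : \sum_i potential (ddE1 i i) _ x0 = 0) ?subr0; last first.
  have fi := far_part_integrable mn hd uC1.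
  have f0 := far_part0 hu.
  rewrite -vint_sum; last first.
    move=> i; apply: (far_potential_integrable r0 (riesz_ddE1 i i mn) fi f0).
    by rewrite subrr enorm0 divr_gt0.
  rewrite (_ : (fun _ => _) = fun=> 0); first exact: vint0.
  apply/funext => y; rewrite -mulr_suml.
  have [yx|yx] := eqVneq (y - x0) 0; first by rewrite f0 ?mulr0// yx enorm0.
  by rewrite ddE1_trace ?mul0r.
rewrite -vint_sum; last first.
  move=> i; have [Cu dud] := uniform_C1_density_partial mn uC1 i.
  exact: (potential_integrable x0 (ltn0Sn n) nm h0 (riesz_dE1 i mn) dud).
have I : vintegrable (fun y => \sum_i dE1 i (y - x0) * du i y).
  apply: vintegrable_sum => i; have [Cu dud] := uniform_C1_density_partial mn uC1 i.
  exact: (potential_integrable x0 (ltn0Sn n) nm h0 (riesz_dE1 i mn) dud).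
rewrite -(vint_shift x0 I).
have N := newton_gradient0 m2 (uniform_C1_shift x0 uC1).
pose g z := (enorm z ^+ m)^-1 * \sum_i z 0 i * du i (z + x0).
have gE z : \sum_i dE1 i (z + x0 - x0) * du i (z + x0) = - (sphere_area R m)^-1 * g z.
  by rewrite /g addrK !mulr_sumr; apply: eq_bigr => i _; rewrite /dE1; ring.
have gi : vintegrable g.
  have := vintegrableZ (- sphere_area R m) (vintegrable_shift x0 I); congr vintegrable.
  by apply/funext => z; rewrite gE mulrA mulrNN divff ?mul1r// gt_eqF.
rewrite (_ : (fun _ => _) = fun z => - (sphere_area R m)^-1 * g z); last by apply/funext.
rewrite (vintZ _ gi) N -sphere_areaE// add0r mulrNN mulrA mulVf ?gt_eqF// mul1r.
by rewrite hu// subrr enorm0.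
Qed.

End NewtonPotential.

Section Elastic.
Variables (R : realType) (m : nat).
Local Notation V := 'rV[R]_m.
Hypothesis m2 : (2 < m)%N.
Implicit Types (i j k : 'I_m) (z v : V).

(** The k-th partial derivative of z_j E1. Both transforms are combinations with
   Clifford coefficients of the potentials of these kernels. *)
Definition moment j k z : R := (j == k)%:R * E1 z + z 0 j * dE1 k z.

(** The i-th partial derivative of moment j k. *)
Definition dmoment j k i z : R :=
  (j == k)%:R * dE1 i z + ((i == j)%:R * dE1 k z + z 0 j * ddE1 k i z).

Lemma is_derive_moment j k z v : z != 0 ->
  is_derive z v (moment j k) (\sum_i v 0 i * dmoment j k i z).
Proof.
move=> z0; have h1 := is_deriveZ (j == k)%:R (is_derive_E1 m2 v z0).
have h2 := is_derive_coordM j (is_derive_dE1 k v z0).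
apply: (is_derive_eq (is_deriveD h1 h2)); rewrite /GRing.scale /= mulr_sumr -big_split.
by apply: eq_bigr => i _; rewrite /dmoment /=; ring.
Qed.

Lemma riesz_moment n j k : m = n.+2 -> riesz n (moment j k).
Proof.
move=> mn; apply: rieszD; first by apply: rieszZ; exact: riesz_E1.
by apply: riesz_coord; exact: riesz_dE1.
Qed.

Lemma riesz_dmoment n j k i : m = n.+2 -> riesz n.+1 (dmoment j k i).
Proof.
move=> mn; apply: rieszD; first by apply: rieszZ; exact: riesz_dE1.
apply: rieszD; first by apply: rieszZ; exact: riesz_dE1.
by apply: riesz_coord; exact: riesz_ddE1.
Qed.

Lemma dmomentE j k i z : dmoment j k i z = - (sphere_area R m)^-1 *
  (((j == k)%:R * z 0 i + (i == j)%:R * z 0 k + (i == k)%:R * z 0 j) * (enorm z ^+ m)^-1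
   - m%:R * (z 0 i * z 0 j * z 0 k) * (enorm z ^+ m.+2)^-1).
Proof. by rewrite /dmoment /dE1 /ddE1; ring. Qed.

Lemma dmoment_symr j k i z : dmoment j k i z = dmoment k j i z.
Proof.
rewrite !dmomentE (eq_sym k j); congr (_ * (_ * _ - _ * _ * _)); ring.
Qed.

Lemma dmoment_syml j k i z : dmoment j k i z = dmoment i k j z.
Proof.
rewrite !dmomentE (eq_sym j i); congr (_ * (_ * _ - _ * _ * _)); ring.
Qed.

(** Euler's identity, dE1 k being homogeneous of degree 1 - m. *)
Lemma dmoment_trace k z : \sum_i dmoment i k i z = 2 * dE1 k z.
Proof.
under eq_bigr do rewrite dmomentE.
have [->|z0] := eqVneq z 0.
  rewrite big1 => [|i _]; last by rewrite !mxE; ring.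
  by rewrite /dE1 mxE; ring.
have r0 : enorm z != 0 by rewrite gt_eqF// enorm_gt0.
rewrite -mulr_sumr sumrB -!mulr_suml -!mulr_sumr !big_split /=.
have -> : \sum_(i < m) (i == k)%:R * z 0 i = z 0 k.
  by rewrite (bigD1 k)//= eqxx mul1r big1 ?addr0// => i /negPf ->; rewrite mul0r.
have -> : \sum_(i < m) (i == i)%:R * z 0 k = m%:R * z 0 k.
  by under eq_bigr do rewrite eqxx mul1r; rewrite sumr_const card_ord mulr_natl.
have -> : \sum_(i < m) z 0 i * z 0 i * z 0 k = enorm z ^+ 2 * z 0 k.
  by rewrite -mulr_suml sqr_enorm.
rewrite /dE1 -(addn2 m) exprD.
have s0 := sphere_area_gt0 R m2; have en0 := expf_neq0 m r0.
by field; rewrite r0 en0 gt_eqF.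
Qed.

(** The fourth order tensor S of second derivatives of the potentials of the
   kernels moment j k is totally symmetric, by Schwarz's theorem and the symmetry
   of dmoment, and its full trace is a multiple of the Laplacian of the Newton
   potential. *)
Lemma elastic_potential n (delta C D : R) (h : V -> R) x0 : m = n.+2 ->
  0 < delta -> delta < 1 -> density delta C D h -> C1_near h x0 ->
  exists2 r : R, 0 < r & exists S : 'I_m -> 'I_m -> 'I_m -> 'I_m -> V -> R,
  [/\ forall x, enorm (x - x0) < r -> forall a b j k,
        is_derive x (delta_mx 0 a) (fun x => - potential (dmoment j k b) h x) (S a b j k x)
        /\ {for x, continuous (S a b j k)},
      forall a b j k, S a b j k x0 = S b a j k x0,
      forall a b j k, S a b j k x0 = S a j b k x0,
      forall a b j k, S a b j k x0 = S a b k j x0 &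
      \sum_a \sum_b S a a b b x0 = - (2 * h x0)].
Proof.
move=> mn d0 d1 hd [r [B [E [u [du [r0 uC1 hu]]]]]].
have n0 : (0 < n)%N by move: m2; rewrite mn.
have /choice[T TP] (p : 'I_m * 'I_m * 'I_m) : exists T : 'I_m -> V -> R,
    (forall i, riesz n.+2 (T i)) /\
    forall z v, z != 0 -> is_derive z v (dmoment p.1.1 p.1.2 p.2) (\sum_i v 0 i * T i z).
  by have [T T1 T2] := riesz_derive (riesz_dmoment p.1.1 p.1.2 p.2 mn); exists T.
pose H j k b a x := hess_potential h (dmoment j k) (fun b => T (j, k, b)) u du b a x.
have HP j k b x (xr : enorm (x - x0) < r / 2) :=
  is_derive_hess_potential mn n0 d0 hd (riesz_moment j k mn)
    (fun i => riesz_dmoment j k i mn) (fun i l => (TP (j, k, i)).1 l)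
    (fun z v => @is_derive_moment j k z v) (fun i => (TP (j, k, i)).2) r0 uC1 hu b xr.
have r2 : 0 < r / 2 by rewrite divr_gt0.
pose S a b j k x := - H j k b a x.
have SP x (xr : enorm (x - x0) < r / 2) a b j k :
    is_derive x (delta_mx 0 a) (fun x => - potential (dmoment j k b) h x) (S a b j k x).
  apply: is_deriveN; have := (HP j k b x xr).1 (delta_mx 0 a).
  by rewrite sum_delta.
have Sc x (xr : enorm (x - x0) < r / 2) a b j k : {for x, continuous (S a b j k)}.
  by apply: continuousN; exact: (HP j k b x xr).2.
have x00 : enorm (x0 - x0) < r / 2 by rewrite subrr enorm0.
have S1 a b j k : S a b j k x0 = S b a j k x0.
  have P1 x (_ : enorm (x - x0) < r / 2) i : is_derive x (delta_mx 0 i)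
      (potential (moment j k) h) (- potential (dmoment j k i) h x).
    have := (potential_derive mn n0 d0 d1 (riesz_moment j k mn)
      (fun i => riesz_dmoment j k i mn) (fun z v => @is_derive_moment j k z v) hd x).1 (delta_mx 0 i).
    by rewrite sum_delta.
  exact: (mixed_derivatives r2 (fun x xr => P1 x xr b) (fun x xr => P1 x xr a)
    (fun x xr => SP x xr a b j k) (fun x xr => SP x xr b a j k) (Sc x0 x00 _ _ _ _) (Sc x0 x00 _ _ _ _)).
have S2 a b j k : S a b j k x0 = S a j b k x0.
  apply: (is_derive_unique (SP x0 x00 a b j k)).
  rewrite (_ : dmoment j k b = dmoment b k j); first exact: SP.
  by apply/funext => z; exact: dmoment_syml.
have S3 a b j k : S a b j k x0 = S a b k j x0.
  apply: (is_derive_unique (SP x0 x00 a b j k)).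
  rewrite (_ : dmoment j k b = dmoment k j b); first exact: SP.
  by apply/funext => z; exact: dmoment_symr.
exists (r / 2) => //; exists S.
split; [move=> x xr a b j k; split; [exact: SP | exact: Sc] | exact: S1 | exact: S2 | exact: S3|].
have nm : (n.+1 < m)%N by rewrite mn.
have trace k x : \sum_b - potential (dmoment b k b) h x = - (2 * potential (dE1 k) h x).
  rewrite sumrN; congr (- _); rewrite -vint_sum => [|b]; last first.
    exact: (potential_integrable x (ltn0Sn n) nm d0 (riesz_dmoment b k b mn) hd).
  rewrite /potential -(vintZ 2 (potential_integrable x (ltn0Sn n) nm d0 (riesz_dE1 R k mn) hd)).
  by congr vint; apply/funext => y; rewrite -mulr_suml dmoment_trace mulrA.
have contract a : \sum_b S a a b b x0 = - (2 * hess_potential h (@dE1 R m) (@ddE1 R m) u du a a x0).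
  under eq_bigr => b _ do rewrite S2.
  have e1 : is_derive x0 (delta_mx 0 a) (fun x => \sum_b - potential (dmoment b a b) h x)
      (\sum_b S a b a b x0).
    under eq_bigr => b _ do rewrite S3.
    exact: (is_derive_bigsum _ (fun b => SP x0 x00 a b b a)).
  have e2 : is_derive x0 (delta_mx 0 a) (fun x => \sum_b - potential (dmoment b a b) h x)
      (- (2 * hess_potential h (@dE1 R m) (@ddE1 R m) u du a a x0)).
    rewrite (_ : (fun x => _) = fun x => - (2 * potential (dE1 a) h x)); last first.
      by apply/funext => x; exact: trace.
    apply: is_deriveN.
    have := (is_derive_hess_potential mn n0 d0 hd (riesz_E1 R mn) (fun i => riesz_dE1 R i mn)
      (fun i j => riesz_ddE1 R i j mn) (fun z v => @is_derive_E1 R m m2 z v)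
      (fun i z v => @is_derive_dE1 R m i z v) r0 uC1 hu a x00).1 (delta_mx 0 a).
    rewrite sum_delta => h1; exact: (is_deriveZ 2 h1).
  exact: is_derive_unique e1 e2.
under eq_bigr => a _ do rewrite contract.
by rewrite sumrN -mulr_sumr (laplace_newton m2 mn d0 hd r0 uC1 hu).
Qed.

End Elastic.

(** * Calculus of Clifford-valued functions *)

Section CliffordCalculus.
Variables (R : realType) (m : nat).
Local Notation V := 'rV[R]_m.
Local Notation Cl := (clifford R m).
Implicit Types (f g : V -> Cl) (x y : V) (X Y : Cl) (A B : {set 'I_m}).

Lemma cl_sumE (I : Type) (s : seq I) (P : pred I) (F : I -> Cl) A :
  (\sum_(i <- s | P i) F i) A = \sum_(i <- s | P i) F i A.
Proof.
by apply: (big_morph (fun X : Cl => X A)) => [X Y|]; rewrite ffunE.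
Qed.

Lemma cl_addE X Y A : (X + Y) A = X A + Y A. Proof. by rewrite ffunE. Qed.

Lemma cl_oppE X A : (- X) A = - X A. Proof. by rewrite ffunE. Qed.

Lemma cl_decomp X : X = \sum_B X B *: cl_blade R B.
Proof.
apply/ffunP => A; rewrite cl_sumE (bigD1 A)//= big1 ?addr0 => [|B BA].
  by rewrite cl_scaleE ffunE eqxx mulr1.
by rewrite cl_scaleE ffunE eq_sym (negPf BA) mulr0.
Qed.

(** Linearity over R, in coordinates: the form in which a linear map passes
   through limits, derivatives and integrals of components. *)
Definition cl_linear (T : Cl -> Cl) :=
  exists c : {set 'I_m} -> {set 'I_m} -> R, forall X A, T X A = \sum_B c A B * X B.

Lemma cl_linear_mul (a b : Cl) : cl_linear (fun X => a * X * b).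
Proof.
exists (fun A B => (a * cl_blade R B * b) A) => X A.
rewrite {1}(cl_decomp X) mulr_sumr mulr_suml cl_sumE; apply: eq_bigr => B _.
by rewrite -scalerAr -scalerAl cl_scaleE mulrC.
Qed.

Lemma cl_linearD T T' : cl_linear T -> cl_linear T' -> cl_linear (fun X => T X + T' X).
Proof.
move=> [c cP] [c' c'P]; exists (fun A B => c A B + c' A B) => X A.
by rewrite cl_addE cP c'P -big_split; apply: eq_bigr => B _; rewrite mulrDl.
Qed.

Lemma cl_linearZ (a : R) T : cl_linear T -> cl_linear (fun X => a *: T X).
Proof.
move=> [c cP]; exists (fun A B => a * c A B) => X A.
by rewrite cl_scaleE cP mulr_sumr; apply: eq_bigr => B _; rewrite mulrA.
Qed.

Lemma cl_linear_mull (a : Cl) : cl_linear (fun X => a * X).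
Proof.
have := cl_linear_mul a 1; congr cl_linear.
by apply/funext => X; rewrite mulr1.
Qed.

Lemma cl_linear_mulr (b : Cl) : cl_linear (fun X => X * b).
Proof.
have := cl_linear_mul 1 b; congr cl_linear.
by apply/funext => X; rewrite mul1r.
Qed.

Lemma cl_linear_id : cl_linear (fun X => X).
Proof.
have := cl_linear_mull 1; congr cl_linear.
by apply/funext => X; rewrite mul1r.
Qed.

Lemma cnorm_ge0 X : 0 <= cnorm X. Proof. exact: sqrtr_ge0. Qed.

Lemma coef_le_cnorm X A : `|X A| <= cnorm X.
Proof.
rewrite /cnorm -sqrtr_sqr; apply: ler_wsqrtr; rewrite (bigD1 A)//= lerDl.
by apply: sumr_ge0 => B _; exact: sqr_ge0.
Qed.

Lemma cnorm_lt X (e : R) : 0 < e -> (forall A, `|X A| < e / #|{set 'I_m}|%:R) -> cnorm X < e.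
Proof.
move=> e0 XA; set N := #|_|%:R in XA.
have N0 : 0 < N by rewrite ltr0n; apply/card_gt0P; exists finset.set0.
have N1 : 1 <= N by rewrite ler1n; apply/card_gt0P; exists finset.set0.
rewrite /cnorm -[ltRHS](gtr0_norm e0) -sqrtr_sqr ltr_sqrt ?exprn_gt0//.
apply: (@lt_le_trans _ _ (\sum_(A : {set 'I_m}) (e / N) ^+ 2)).
  apply: ltr_sum => [|A _]; first by apply/hasP; exists finset.set0; rewrite ?mem_index_enum.
  by rewrite -[ltLHS]real_normK ?num_real// ltrXn2r// ?nnegrE ?divr_ge0 ?ltW.
rewrite sumr_const -mulr_natl -/N expr_div_n mulrCA; apply: ler_piMr; first by rewrite exprn_ge0// ltW.
by rewrite expr2 invfM mulrA divff ?gt_eqF// mul1r invf_le1.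
Qed.

Lemma cl_linear_bound T : cl_linear T -> exists2 M : R, 0 <= M & forall X A, `|T X A| <= M * cnorm X.
Proof.
move=> [c cP]; exists (\sum_A \sum_B `|c A B|); first by do 2 apply: sumr_ge0 => ? _.
move=> X A; rewrite cP; apply: (le_trans (ler_norm_sum _ _ _)).
rewrite [in leRHS](bigD1 A)//= mulrDl; apply: (@le_trans _ _ ((\sum_B `|c A B|) * cnorm X)).
  rewrite mulr_suml; apply: ler_sum => B _; rewrite normrM; apply: ler_wpM2l => //.
  exact: coef_le_cnorm.
by rewrite lerDl mulr_ge0 ?cnorm_ge0//; do 2 apply: sumr_ge0 => ? _.
Qed.

Definition ccont f x := forall A, {for x, continuous (fun y => f y A)}.

Definition cderive f x (j : 'I_m) (d : Cl) :=
  forall A, is_derive x (delta_mx 0 j : V) (fun y => f y A) (d A).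

Lemma pderivE f x j d : cderive f x j d -> pderiv j f x = d.
Proof. by move=> fd; apply/ffunP => A; rewrite ffunE; have [_ ->] := fd A. Qed.

Lemma continuous_bigsum (I : Type) (s : seq I) (F : I -> V -> R) x :
  (forall i, {for x, continuous (F i)}) ->
  {for x, continuous (fun y => \sum_(i <- s) F i y)}.
Proof.
move=> Fc; elim: s => [|i s IH].
  rewrite (_ : (fun _ => _) = fun=> 0); first exact: continuous_const.
  by apply/funext => y; rewrite big_nil.
rewrite (_ : (fun _ => _) = fun y => F i y + \sum_(i <- s) F i y).
  by apply: continuousD; [exact: Fc | exact: IH].
by apply/funext => y; rewrite big_cons.
Qed.

Lemma cderive_lin (I : finType) (T : I -> Cl -> Cl) (F : I -> V -> Cl) (d : I -> Cl) x j :
  (forall i, cl_linear (T i)) -> (forall i, cderive (F i) x j (d i)) ->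
  cderive (fun y => \sum_i T i (F i y)) x j (\sum_i T i (d i)).
Proof.
move=> Tl Fd A; rewrite cl_sumE.
rewrite (_ : (fun y => _) = fun y => \sum_i T i (F i y) A); last first.
  by apply/funext => y; rewrite cl_sumE.
apply: is_derive_bigsum => i; have [c cP] := Tl i; rewrite cP.
rewrite (_ : (fun y => _) = fun y => \sum_B c A B * F i y B); last first.
  by apply/funext => y; rewrite cP.
by apply: is_derive_bigsum => B; exact: is_deriveZ (Fd i B).
Qed.

Lemma ccont_lin (I : finType) (T : I -> Cl -> Cl) (F : I -> V -> Cl) x :
  (forall i, cl_linear (T i)) -> (forall i, ccont (F i) x) ->
  ccont (fun y => \sum_i T i (F i y)) x.
Proof.
move=> Tl Fc A; rewrite (_ : (fun y => _) = fun y => \sum_i \sum_B (projT1 (cid (Tl i))) A B * F i y B).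
  apply: continuous_bigsum => i; apply: continuous_bigsum => B.
  apply: (@continuousM _ _ (fun=> _) (fun y => F i y B)); first exact: continuous_const.
  exact: Fc.
apply/funext => y; rewrite cl_sumE; apply: eq_bigr => i _.
by rewrite (projT2 (cid (Tl i))).
Qed.

Lemma cderiveB f g x j d e : cderive f x j d -> cderive g x j e ->
  cderive (fun y => f y - g y) x j (d - e).
Proof.
move=> fd ge A; rewrite cl_addE cl_oppE.
rewrite (_ : (fun y => _) = fun y => f y A - g y A); first exact: is_deriveB.
by apply/funext => y; rewrite cl_addE cl_oppE.
Qed.

Lemma ccontB f g x : ccont f x -> ccont g x -> ccont (fun y => f y - g y) x.
Proof.
move=> fc gc A; rewrite (_ : (fun y => _) = fun y => f y A - g y A).
  by apply: continuousB; [exact: fc | exact: gc].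
by apply/funext => y; rewrite cl_addE cl_oppE.
Qed.

Lemma ccont_local f g x (r : R) : 0 < r -> (forall y, enorm (y - x) < r -> f y = g y) ->
  ccont f x -> ccont g x.
Proof. by move=> r0 fg fc A; apply: (continuous_local r0 _ (fc A)) => y /fg ->. Qed.

Lemma cderive_local f g x j d (r : R) : 0 < r -> (forall y, enorm (y - x) < r -> f y = g y) ->
  cderive f x j d -> cderive g x j d.
Proof. by move=> r0 fg fd A; apply: (is_derive_local r0 _ (fd A)) => y /fg ->. Qed.

Lemma class_C_cont k (U : set V) f x : class_C k U f -> U x -> ccont f x.
Proof. by move=> fk Ux A; have [+ _] := fk [::] (leq0n k) A x Ux. Qed.

Lemma class_C_derive k (U : set V) f x j : class_C k.+1 U f -> U x ->
  cderive f x j (pderiv j f x).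
Proof.
move=> fk Ux A; have [_ /(_ (ltn0Sn k) j) fd] := fk [::] (leq0n _) A x Ux.
by rewrite ffunE; apply: DeriveDef.
Qed.

Lemma class_C_pderiv k (U : set V) f j : class_C k.+1 U f -> class_C k U (pderiv j f).
Proof.
move=> fk s sk A x Ux; have := fk (rcons s j) _ A x Ux.
by rewrite size_rcons /pderivs foldr_rcons; apply.
Qed.

Lemma class_C_le k l (U : set V) f : (k <= l)%N -> class_C l U f -> class_C k U f.
Proof.
move=> kl fl s sk A x Ux; have [fc fd] := fl s (leq_trans sk kl) A x Ux.
by split=> // sk'; apply: fd; exact: leq_trans kl.
Qed.

Lemma open_enormP (W : set V) x : open W -> W x ->
  exists2 r : R, 0 < r & forall y, enorm (y - x) < r -> W y.
Proof. by move=> oW Wx; apply/nbhs_enormP; exact: open_nbhs_nbhs. Qed.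

(** The derivatives are only compared with G1 and G2 on W, where each passes to the
   next order because W is open. *)
Lemma class_C2_intro (W : set V) F (G1 : 'I_m -> V -> Cl) (G2 : 'I_m -> 'I_m -> V -> Cl) :
  open W ->
  (forall x, W x -> ccont F x /\ forall b, cderive F x b (G1 b x)) ->
  (forall x b, W x -> ccont (G1 b) x /\ forall a, cderive (G1 b) x a (G2 a b x)) ->
  (forall x a b, W x -> ccont (G2 a b) x) ->
  class_C 2 W F /\ forall x, W x -> (forall b, pderiv b F x = G1 b x) /\
    (forall a b, cderive (pderiv b F) x a (G2 a b x)).
Proof.
move=> oW F0 F1 F2.
have E1 x b : W x -> pderiv b F x = G1 b x by move=> Wx; apply: pderivE; exact: (F0 x Wx).2.
have N1 x b : W x -> exists2 r : R, 0 < r & forall y, enorm (y - x) < r -> G1 b y = pderiv b F y.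
  move=> Wx; have [r r0 rW] := open_enormP oW Wx.
  by exists r => // y /rW Wy; rewrite E1.
have D1 x a b : W x -> cderive (pderiv b F) x a (G2 a b x).
  move=> Wx; have [r r0 rE] := N1 x b Wx.
  by apply: (cderive_local r0 rE); exact: (F1 x b Wx).2.
have N2 x a b : W x -> exists2 r : R, 0 < r &
    forall y, enorm (y - x) < r -> G2 a b y = pderiv a (pderiv b F) y.
  move=> Wx; have [r r0 rW] := open_enormP oW Wx.
  by exists r => // y /rW Wy; rewrite (pderivE (D1 _ _ _ Wy)).
split; last by move=> x Wx; split => [b|a b]; [exact: E1 | exact: D1].
move=> [|b [|a [|//]]] /= _ A x Wx; split => //.
- exact: (F0 x Wx).1.
- by move=> _ j; have [] := (F0 x Wx).2 j A.
- have [r r0 rE] := N1 x b Wx.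
  by apply: (ccont_local r0 rE); exact: (F1 x b Wx).1.
- by move=> _ j; have [] := D1 x j b Wx A.
- have [r r0 rE] := N2 x b a Wx.
  by apply: (ccont_local r0 rE); exact: F2.
Qed.

Section Lame.
Variables (phi psi : 'I_m -> V) (mu lambda : R).

Definition lame_coef (a b : 'I_m) (X : Cl) : Cl :=
  ((mu + lambda) / 2) *: (cl_vec (phi b) * X * cl_vec (psi a)) +
  ((3 * mu + lambda) / 2) *: (cl_vec (phi a) * cl_vec (psi b) * X).

Definition M_coef (b : 'I_m) (X : Cl) : Cl :=
  ((mu + lambda) / 2) *: (X * cl_vec (psi b)) +
  ((3 * mu + lambda) / 2) *: (cl_vec (psi b) * X).

Lemma cl_linear_lame a b : cl_linear (lame_coef a b).
Proof.
apply: cl_linearD; apply: cl_linearZ; first exact: cl_linear_mul.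
exact: cl_linear_mull.
Qed.

Lemma cl_linear_M b : cl_linear (M_coef b).
Proof.
apply: cl_linearD; apply: cl_linearZ; first exact: cl_linear_mulr.
exact: cl_linear_mull.
Qed.

Lemma lame_opE f x (D : 'I_m -> 'I_m -> Cl) :
  (forall a b, cderive (pderiv b f) x a (D a b)) ->
  lame_op phi psi mu lambda f x = \sum_a \sum_b lame_coef a b (D a b).
Proof.
move=> fD; rewrite /lame_op /dirac_r /dirac_l.
have E1 (xi : 'I_m -> V) a :
    pderiv a (fun y => \sum_b cl_vec (xi b) * pderiv b f y) x = \sum_b cl_vec (xi b) * D a b.
  apply: pderivE; apply: (@cderive_lin 'I_m (fun b X => cl_vec (xi b) * X)) => b.
    exact: cl_linear_mull.
  exact: fD.
under eq_bigr do rewrite (E1 phi).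
under [X in _ + _ *: X]eq_bigr do rewrite (E1 psi).
rewrite !scaler_sumr -big_split; apply: eq_bigr => a _ /=.
rewrite mulr_suml mulr_sumr !scaler_sumr -big_split; apply: eq_bigr => b _ /=.
by rewrite /lame_coef mulrA.
Qed.

Lemma M_opE f x : M_op psi mu lambda f x = \sum_b M_coef b (pderiv b f x).
Proof. by rewrite /M_op /dirac_r /dirac_l !scaler_sumr -big_split. Qed.

End Lame.

End CliffordCalculus.

(** * Algebra of the symbol *)

Section Contraction.
Variables (R : realType) (m : nat).
Local Notation V := 'rV[R]_m.
Local Notation Cl := (clifford R m).
Implicit Types (phi psi : 'I_m -> V) (x y : V) (X Y : Cl) (a b j k : 'I_m).

Lemma cl_vec_rel x y :
  cl_vec x * cl_vec y + cl_vec y * cl_vec x = - (2 * dotv x y)%:A :> Cl.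
Proof.
have E u v : cl_vec u * cl_vec v = \sum_i \sum_j (u 0 i * v 0 j) *: (cl_e R i * cl_e R j) :> Cl.
  rewrite /cl_vec mulr_suml; apply: eq_bigr => i _; rewrite mulr_sumr.
  by apply: eq_bigr => j _; rewrite -scalerAl -scalerAr scalerA.
rewrite !E [X in _ + X]exchange_big /= -big_split /=.
under eq_bigr => i _.
  rewrite -big_split /=.
  under eq_bigr => j _ do rewrite (mulrC (y 0 j)) -scalerDr cl_e_rel.
  over.
rewrite /dotv mulr_sumr scaler_suml -sumrN; apply: eq_bigr => i _.
rewrite (bigD1 i)//= big1 ?addr0 => [|j /negPf ji].
  by rewrite eqxx mulr1 scalerN scalerA mulrC.
by rewrite eq_sym ji mulr0 scale0r oppr0 scaler0.
Qed.

Lemma half_double X Y : X + X = Y + Y -> X = Y.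
Proof.
have E (Z : Cl) : Z = 2^-1 *: (Z + Z).
  by rewrite scalerDr -scalerDl -div1r -splitr scale1r.
by move=> XY; rewrite (E X) XY -E.
Qed.

(** The relation satisfied by an orthonormal basis of vectors. *)
Definition anticommuting (P : 'I_m -> Cl) :=
  forall i j, P i * P j + P j * P i = - (2 * (i == j)%:R)%:A.

Lemma structural_anticommuting phi : structural_set phi ->
  anticommuting (fun j => cl_vec (phi j)).
Proof. by move=> [_ ort] i j; rewrite cl_vec_rel ort. Qed.

(** Against a symmetric array only the anticommutators survive. *)
Lemma contract_left P (G : 'I_m -> 'I_m -> Cl) : anticommuting P ->
  (forall i j, G i j = G j i) ->
  \sum_i \sum_j P i * P j * G i j = - \sum_i G i i.
Proof.
move=> PP Gs; apply: half_double; rewrite {2}exchange_big -big_split /=.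
rewrite -opprD -big_split -sumrN /=; apply: eq_bigr => i _; rewrite -big_split /=.
rewrite (bigD1 i)//= big1 ?addr0 => [|j /negPf ji].
  by rewrite -mulrDl PP eqxx mulr1 mulNr -scalerAl mul1r scalerDl scale1r.
by rewrite (Gs j) -mulrDl PP eq_sym ji mulr0 scale0r oppr0 mul0r.
Qed.

Lemma contract_right P (G : 'I_m -> 'I_m -> Cl) : anticommuting P ->
  (forall i j, G i j = G j i) ->
  \sum_i \sum_j G i j * (P i * P j) = - \sum_i G i i.
Proof.
move=> PP Gs; apply: half_double; rewrite {2}exchange_big -big_split /=.
rewrite -opprD -big_split -sumrN /=; apply: eq_bigr => i _; rewrite -big_split /=.
rewrite (bigD1 i)//= big1 ?addr0 => [|j /negPf ji].
  by rewrite -mulrDr PP eqxx mulr1 mulrN -scalerAr mulr1 scalerDl scale1r.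
by rewrite (Gs j) -mulrDr PP eq_sym ji mulr0 scale0r oppr0 mulr0.
Qed.

Section Symbol.
Variables (P Q : 'I_m -> Cl).
Hypotheses (PP : anticommuting P) (QQ : anticommuting Q).
Variables (S : 'I_m -> 'I_m -> 'I_m -> 'I_m -> Cl).
Hypotheses (S1 : forall a b j k, S a b j k = S b a j k)
  (S2 : forall a b j k, S a b j k = S a j b k)
  (S3 : forall a b j k, S a b j k = S a b k j).

Let Tr := \sum_a \sum_b S a a b b.

Lemma symbol_infra :
  \sum_a \sum_b \sum_j \sum_k P b * P k * S a b j k * (Q j * Q a) = Tr.
Proof.
transitivity (- \sum_a \sum_j (\sum_b S a b j b) * (Q j * Q a)).
  rewrite -sumrN; apply: eq_bigr => a _; rewrite exchange_big -sumrN; apply: eq_bigr => j _.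
  rewrite -mulNr -(contract_left PP (G := fun b k => S a b j k)) => [|b k].
    by rewrite mulr_suml; apply: eq_bigr => b _; rewrite mulr_suml.
  by rewrite S2 S3 S2.
rewrite exchange_big (contract_right QQ (G := fun j a => \sum_b S a b j b)) => [|j a].
  rewrite opprK; apply: eq_bigr => a _; apply: eq_bigr => b _.
  by rewrite (S2 a b a b).
by apply: eq_bigr => b _; rewrite (S2 a b) (S1 a j) -(S2 j b a b).
Qed.

Lemma symbol_teo :
  \sum_a \sum_b \sum_j \sum_k P a * Q b * (Q j * P k * S a b j k) = Tr.
Proof.
transitivity (- \sum_a \sum_k P a * P k * (\sum_b S a b b k)).
  rewrite -sumrN; apply: eq_bigr => a _.
  transitivity (P a * (\sum_b \sum_j Q b * Q j * (\sum_k P k * S a b j k))).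
    rewrite mulr_sumr; apply: eq_bigr => b _; rewrite mulr_sumr; apply: eq_bigr => j _.
    by rewrite !mulr_sumr; apply: eq_bigr => k _; rewrite !mulrA.
  rewrite (contract_left QQ (G := fun b j => \sum_k P k * S a b j k)); last first.
    by move=> b j; apply: eq_bigr => k _; rewrite S2.
  rewrite mulrN exchange_big mulr_sumr; congr (- _); apply: eq_bigr => k _.
  by rewrite -mulr_sumr mulrA.
rewrite (contract_left PP (G := fun a k => \sum_b S a b b k)) => [|a k].
  rewrite opprK; apply: eq_bigr => a _; apply: eq_bigr => b _.
  by rewrite S3 S2.
by apply: eq_bigr => b _; rewrite S3 S2 S1 S2 S3.
Qed.

(** The total symmetry of S allows the indices to be permuted cyclically. *)
Lemma symbol_cross :
  \sum_a \sum_b \sum_j \sum_k P b * (Q j * P k * S a b j k) * Q a =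
  \sum_a \sum_b \sum_j \sum_k P a * Q b * (P k * S a b j k * Q j).
Proof.
rewrite exchange_big /=; apply: eq_bigr => b _.
rewrite exchange_big /=; apply: eq_bigr => j _; apply: eq_bigr => a _; apply: eq_bigr => k _.
by rewrite (S1 a b j k) (S2 b a j k) !mulrA.
Qed.

Variables (mu lambda : R).
Hypotheses (mu0 : mu != 0) (ml0 : 2 * mu + lambda != 0).

(** The operator applied to the transform, on the level of second derivatives:
   the diagonal products contract to the trace and the two mixed ones cancel. *)
Lemma symbol_lame_dag :
  \sum_a \sum_b
    (let X := \sum_j \sum_k
       (((mu + lambda) / (4 * mu * (2 * mu + lambda))) *: (P k * S a b j k * Q j) +
        (- ((3 * mu + lambda) / (4 * mu * (2 * mu + lambda)))) *: (Q j * P k * S a b j k)) in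
     ((mu + lambda) / 2) *: (P b * X * Q a) + ((3 * mu + lambda) / 2) *: (P a * Q b * X)) =
  - (2^-1 *: Tr).
Proof.
set q := 4 * mu * (2 * mu + lambda).
set p1 := (mu + lambda) / q; set p2 := - ((3 * mu + lambda) / q).
set l1 := (mu + lambda) / 2; set l2 := (3 * mu + lambda) / 2.
pose A1 a b j k := P b * P k * S a b j k * (Q j * Q a).
pose A2 a b j k := P b * (Q j * P k * S a b j k) * Q a.
pose A3 a b j k := P a * Q b * (P k * S a b j k * Q j).
pose A4 a b j k := P a * Q b * (Q j * P k * S a b j k).
transitivity ((l1 * p1) *: (\sum_a \sum_b \sum_j \sum_k A1 a b j k) +
  (l1 * p2) *: (\sum_a \sum_b \sum_j \sum_k A2 a b j k) +
  (l2 * p1) *: (\sum_a \sum_b \sum_j \sum_k A3 a b j k) +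
  (l2 * p2) *: (\sum_a \sum_b \sum_j \sum_k A4 a b j k)).
  clearbody p1 p2 l1 l2; rewrite !scaler_sumr -!big_split /=; apply: eq_bigr => a _.
  rewrite !scaler_sumr -!big_split /=; apply: eq_bigr => b _.
  rewrite !mulr_sumr mulr_suml !scaler_sumr -!big_split /=; apply: eq_bigr => j _.
  rewrite !mulr_sumr mulr_suml !scaler_sumr -!big_split /=; apply: eq_bigr => k _.
  rewrite !mulrDr mulrDl -!scalerAr -!scalerAl !scalerDr !scalerA addrA.
  by rewrite /A1 /A2 /A3 /A4 !mulrA.
rewrite /A1 /A2 /A3 /A4 symbol_infra symbol_cross symbol_teo.
set Y := \sum_a _.
rewrite -(addrA (_ *: Tr)) -scalerDl (_ : l1 * p2 + l2 * p1 = 0); last first.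
  by rewrite /l1 /l2 /p1 /p2; ring.
rewrite scale0r addr0 -scalerDl -scaleNr; congr (_ *: _).
rewrite /l1 /l2 /p1 /p2 /q; field.
by rewrite mu0 ml0.
Qed.
End Symbol.
End Contraction.

Section LameDag.
Variables (R : realType) (m : nat).
Local Notation V := 'rV[R]_m.
Local Notation Cl := (clifford R m).
Variables (phi psi : 'I_m -> V) (mu lambda : R).

Definition dag_coef (j k : 'I_m) (X : Cl) : Cl :=
  ((mu + lambda) / (4 * mu * (2 * mu + lambda))) *: (cl_vec (phi k) * X * cl_vec (psi j)) +
  (- ((3 * mu + lambda) / (4 * mu * (2 * mu + lambda)))) *:
    (cl_vec (psi j) * cl_vec (phi k) * X).

Lemma cl_linear_dag j k : cl_linear (dag_coef j k).
Proof.
apply: cl_linearD; apply: cl_linearZ; first exact: cl_linear_mul.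
exact: cl_linear_mull.
Qed.

Lemma lame_dag_coef (S : 'I_m -> 'I_m -> 'I_m -> 'I_m -> Cl) :
  structural_set phi -> structural_set psi -> mu != 0 -> 2 * mu + lambda != 0 ->
  (forall a b j k, S a b j k = S b a j k) ->
  (forall a b j k, S a b j k = S a j b k) ->
  (forall a b j k, S a b j k = S a b k j) ->
  \sum_a \sum_b lame_coef phi psi mu lambda a b (\sum_j \sum_k dag_coef j k (S a b j k)) =
  - (2^-1 *: \sum_a \sum_b S a a b b).
Proof.
move=> /structural_anticommuting PP /structural_anticommuting QQ mu0 ml0 S1 S2 S3.
exact: (symbol_lame_dag PP QQ S1 S2 S3 mu0 ml0).
Qed.
End LameDag.

(** * The transform as a sum of potentials *)

Section Teodorescu.
Variables (R : realType) (m n : nat).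
Local Notation V := 'rV[R]_m.
Local Notation Cl := (clifford R m).
Local Notation pt := (@pt_of_tuple R m).
Hypotheses (m2 : (2 < m)%N) (mn : m = n.+2).
Variables (Omega : set V) (g : V -> Cl).
Hypothesis mO : vset Omega.

(** A component of g restricted to Omega and extended by 0. *)
Definition cut (A : {set 'I_m}) (y : V) : R := \1_Omega y * g y A.

Hypothesis dens : forall A, exists delta C D : R,
  [/\ 0 < delta, delta < 1 & density delta C D (cut A)].

Definition cl_potential (K : V -> R) (x : V) : Cl := [ffun A => potential K (cut A) x].

Lemma cl_integral_cut (G : V -> Cl) :
  (forall A, vintegrable (fun y => \1_Omega y * G y A)) ->
  cl_integrable Omega G /\
  forall A, cl_integral Omega G A = vint (fun y => \1_Omega y * G y A).
Proof.
have E A : (fun t => G (pt t) A) \_ (pt @^-1` Omega) = fun t => \1_Omega (pt t) * G (pt t) A.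
  apply/funext => t; rewrite patchE indicE.
  rewrite (_ : (t \in pt @^-1` Omega) = (pt t \in Omega)); last first.
    by apply/idP/idP; rewrite !inE.
  by case: ifP => _; rewrite ?mul1r ?mul0r.
move=> Gi; split => A.
  apply/(integrable_mkcond _ mO); have := Gi A; rewrite /vintegrable.
  by congr (_.-integrable _ _); rewrite restrict_EFin E.
by rewrite ffunE Rintegral_mkcond E vintE.
Qed.

Lemma kernel_integral (I : finType) (K : I -> V -> R) (T : I -> Cl -> Cl) (G : V -> Cl) x :
  (forall i, cl_linear (T i)) -> (forall y, G y = \sum_i K i (y - x) *: T i (g y)) ->
  (forall i A, vintegrable (fun y => K i (y - x) * cut A y)) ->
  cl_integrable Omega G /\ cl_integral Omega G = \sum_i T i (cl_potential (K i) x).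
Proof.
move=> /choice[c cP] GE Ki.
have E A : (fun y => \1_Omega y * G y A) =
    fun y => \sum_i \sum_B c i A B * (K i (y - x) * cut B y).
  apply/funext => y; rewrite GE cl_sumE mulr_sumr; apply: eq_bigr => i _.
  by rewrite cl_scaleE cP !mulr_sumr; apply: eq_bigr => B _; rewrite /cut; ring.
have I1 A i B : vintegrable (fun y => c i A B * (K i (y - x) * cut B y)).
  exact: vintegrableZ.
have I2 A i : vintegrable (fun y => \sum_B c i A B * (K i (y - x) * cut B y)).
  by apply: vintegrable_sum => B; exact: I1.
have [|Gi GI] := @cl_integral_cut G.
  by move=> A; rewrite E; apply: vintegrable_sum => i; exact: I2.
split => //; apply/ffunP => A; rewrite GI E vint_sum; last exact: I2.
rewrite cl_sumE; apply: eq_bigr => i _; rewrite vint_sum; last exact: I1.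
rewrite cP; apply: eq_bigr => B _; rewrite ffunE /potential.
by rewrite (vintZ _ (Ki i B)).
Qed.

Lemma cut_integrable k K A x : riesz k K -> (0 < k)%N -> (k < m)%N ->
  vintegrable (fun y => K (y - x) * cut A y).
Proof.
move=> Kk k0 km; have [delta [C [D [d0 d1 hd]]]] := dens A.
exact: (potential_integrable x k0 km d0 Kk hd).
Qed.

Let n0 : (0 < n)%N. Proof. by move: m2; rewrite mn. Qed.
Let nm : (n < m)%N. Proof. by rewrite mn. Qed.

Definition coordE1 (j k : 'I_m) (z : V) : R := z 0 j * dE1 k z.

Lemma riesz_coordE1 j k : riesz n (coordE1 j k).
Proof. by apply: riesz_coord; exact: riesz_dE1. Qed.

(** The scalar and the vectorial integral of each transform merge into one. *)
Lemma cl_potential_moment j k x :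
  cl_potential (moment j k) x = (j == k)%:R *: cl_potential (@E1 R m) x + cl_potential (coordE1 j k) x.
Proof.
apply/ffunP => A; rewrite cl_addE cl_scaleE !ffunE /potential.
have i1 := cut_integrable A x (riesz_E1 R mn) n0 nm.
have i2 := cut_integrable A x (riesz_coordE1 j k) n0 nm.
rewrite -(vintZ _ i1) -(vintD (vintegrableZ _ i1) i2).
by congr vint; apply/funext => y; rewrite /moment /coordE1; ring.
Qed.

Lemma struct_vecB (phi : 'I_m -> V) x y :
  struct_vec phi y - struct_vec phi x = struct_vec phi (y - x).
Proof.
by rewrite /struct_vec -sumrB; apply: eq_bigr => j _; rewrite !mxE scalerBl.
Qed.

Lemma K_kerE (phi : 'I_m -> V) z : K_ker phi z = \sum_k dE1 k z *: cl_vec (phi k).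
Proof.
rewrite /K_ker /struct_vec !scaler_sumr; apply: eq_bigr => k _.
by rewrite !scalerA /dE1; congr (_ *: _); ring.
Qed.

Section Transforms.
Variables (phi psi : 'I_m -> V) (mu lambda : R).

Lemma teo_vec_integral x : cl_integrable Omega (teo_vec phi psi g x) /\
  cl_integral Omega (teo_vec phi psi g x) =
  \sum_j \sum_k cl_vec (psi j) * cl_vec (phi k) * cl_potential (coordE1 j k) x.
Proof.
rewrite pair_bigA; apply: (@kernel_integral _ (fun p : 'I_m * 'I_m => coordE1 p.1 p.2)
    (fun p X => cl_vec (psi p.1) * cl_vec (phi p.2) * X)).
- by move=> p; exact: cl_linear_mull.
- move=> y; rewrite /teo_vec struct_vecB K_kerE /struct_vec.
  rewrite -(pair_bigA _ (fun j k => coordE1 j k (y - x) *: (cl_vec (psi j) * cl_vec (phi k) * g y))) /=.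
  rewrite !mulr_suml; apply: eq_bigr => j _; rewrite mulr_sumr mulr_suml; apply: eq_bigr => k _.
  by rewrite -scalerAr -!scalerAl scalerA mulrC.
- by move=> p A; exact: cut_integrable (riesz_coordE1 _ _) n0 nm.
Qed.

Lemma teo_infra_vec_integral x : cl_integrable Omega (teo_infra_vec phi psi g x) /\
  cl_integral Omega (teo_infra_vec phi psi g x) =
  \sum_j \sum_k cl_vec (phi k) * cl_potential (coordE1 j k) x * cl_vec (psi j).
Proof.
rewrite pair_bigA; apply: (@kernel_integral _ (fun p : 'I_m * 'I_m => coordE1 p.1 p.2)
    (fun p X => cl_vec (phi p.2) * X * cl_vec (psi p.1))).
- by move=> p; exact: cl_linear_mul.
- move=> y; rewrite /teo_infra_vec struct_vecB K_kerE /struct_vec.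
  rewrite -(pair_bigA _ (fun j k => coordE1 j k (y - x) *: (cl_vec (phi k) * g y * cl_vec (psi j)))) /=.
  rewrite mulr_sumr; apply: eq_bigr => j _; rewrite !mulr_suml; apply: eq_bigr => k _.
  by rewrite -scalerAr -!scalerAl scalerA.
- by move=> p A; exact: cut_integrable (riesz_coordE1 _ _) n0 nm.
Qed.

Lemma teo_scal_integral j x : cl_integrable Omega (teo_scal phi psi g j x) /\
  cl_integral Omega (teo_scal phi psi g j x) =
  cl_vec (psi j) * cl_vec (phi j) * cl_potential (@E1 R m) x.
Proof.
have [||i A|h1 h2] := @kernel_integral unit (fun=> @E1 R m)
    (fun _ X => cl_vec (psi j) * cl_vec (phi j) * X) (teo_scal phi psi g j x) x.
- by move=> _; exact: cl_linear_mull.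
- by move=> y; rewrite (big_pred1 tt) => // -[].
- exact: cut_integrable (riesz_E1 R mn) n0 nm.
by split => //; rewrite h2 (big_pred1 tt) => // -[].
Qed.

Lemma teo_infra_scal_integral x : cl_integrable Omega (teo_infra_scal g x) /\
  cl_integral Omega (teo_infra_scal g x) = cl_potential (@E1 R m) x.
Proof.
have [||i A|h1 h2] := @kernel_integral unit (fun=> @E1 R m)
    (fun _ X => X) (teo_infra_scal g x) x.
- by move=> _; exact: cl_linear_id.
- by move=> y; rewrite (big_pred1 tt) => // -[].
- exact: cut_integrable (riesz_E1 R mn) n0 nm.
by split => //; rewrite h2 (big_pred1 tt) => // -[].
Qed.

Lemma teodorescu_dag_defined_cut x : teodorescu_dag_defined Omega phi psi g x.
Proof.
split; [exact: (teo_vec_integral x).1 | move=> j; exact: (teo_scal_integral j x).1 |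
  exact: (teo_infra_vec_integral x).1 | exact: (teo_infra_scal_integral x).1].
Qed.

Lemma diag_sum (F : 'I_m -> 'I_m -> Cl) : \sum_j F j j = \sum_j \sum_k (j == k)%:R *: F j k.
Proof.
apply: eq_bigr => j _; rewrite (bigD1 j)//= eqxx scale1r big1 ?addr0// => k /negPf kj.
by rewrite eq_sym kj scale0r.
Qed.

Lemma teodorescu_dagE x : teodorescu_dag Omega phi psi mu lambda g x =
  \sum_j \sum_k dag_coef phi psi mu lambda j k (cl_potential (moment j k) x).
Proof.
rewrite /teodorescu_dag /teodorescu_infra /teodorescu /dag_coef.
rewrite (teo_vec_integral x).2 (teo_infra_vec_integral x).2 (teo_infra_scal_integral x).2.
rewrite (eq_bigr _ (fun j _ => (teo_scal_integral j x).2)).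
rewrite (diag_sum (fun j k => cl_vec (psi j) * cl_vec (phi k) * cl_potential (@E1 R m) x)).
rewrite (diag_sum (fun j k => cl_vec (phi k) * cl_potential (@E1 R m) x * cl_vec (psi j))).
set h := - (1 / 2); set s1 := - (_ / _); set s2 := _ / _.
have halve a b c : a / (4 * b * c) = - h * (a / (2 * b * c)) :> R.
  by rewrite (_ : 4 * b * c = 2 * (2 * b * c)) ?invfM /h; ring.
rewrite (_ : _ / (4 * mu * _) = h * s1); last by rewrite halve /s1 mulNr mulrN.
rewrite (_ : - (_ / (4 * mu * _)) = h * s2); last by rewrite halve /s2 mulNr opprK.
clearbody h s1 s2.
rewrite !scalerDr !scaler_sumr -!big_split /=; apply: eq_bigr => j _.
rewrite !scaler_sumr -!big_split /=; apply: eq_bigr => k _.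
rewrite cl_potential_moment; set N := cl_potential _ x; set M := cl_potential _ x.
rewrite !mulrDr !mulrDl -!scalerAr -!scalerAl !scalerDr !scalerA.
by congr (_ + _); rewrite addrC (mulrC h).
Qed.
End Transforms.
End Teodorescu.

(** * The transform as a right inverse *)

Section Vanishing.
Variables (R : realType) (m : nat).
Local Notation V := 'rV[R]_m.
Local Notation Cl := (clifford R m).

Lemma vanishesP (f : V -> Cl) : vanishes_at_infinity f <->
  forall A (e : R), 0 < e -> exists r : R, forall x, r < enorm x -> `|f x A| < e.
Proof.
split=> [h A e e0|h e e0].
  have [r rP] := h e e0; exists r => x /rP; apply: le_lt_trans; exact: coef_le_cnorm.
have eN : 0 < e / #|{set 'I_m}|%:R.
  by rewrite divr_gt0// ltr0n; apply/card_gt0P; exists finset.set0.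
have /choice[r rP] A := h A _ eN.
exists (\big[Num.max/0]_A r A) => x xr; apply: cnorm_lt => // A; apply: rP.
by apply: le_lt_trans xr; exact: le_bigmax.
Qed.

Lemma vanishes_lin (I : finType) (T : I -> Cl -> Cl) (F : I -> V -> Cl) :
  (forall i, cl_linear (T i)) -> (forall i, vanishes_at_infinity (F i)) ->
  vanishes_at_infinity (fun x => \sum_i T i (F i x)).
Proof.
move=> Tl Fv; have /choice[M MP] i : exists M : R, 0 <= M /\ forall X A, `|T i X A| <= M * cnorm X.
  by have [M M0 MP] := cl_linear_bound (Tl i); exists M.
apply/vanishesP => A e e0; pose S := 1 + \sum_i M i.
have S0 : 0 < S by rewrite ltr_pwDl// sumr_ge0// => i _; case: (MP i).
have eS : 0 < e / S by rewrite divr_gt0.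
have /choice[r rP] i := Fv i _ eS.
exists (\big[Num.max/0]_i r i) => x xr; rewrite cl_sumE.
apply: (le_lt_trans (ler_norm_sum _ _ _)).
apply: (@le_lt_trans _ _ (\sum_i M i * (e / S))).
  apply: ler_sum => i _; apply: (le_trans ((MP i).2 _ _)); apply: ler_wpM2l; first exact: (MP i).1.
  by apply: ltW; apply: rP; apply: le_lt_trans xr; exact: le_bigmax.
rewrite -mulr_suml mulrA ltr_pdivrMr// mulrC ltr_pM2l//.
by rewrite /S ltrDr.
Qed.
End Vanishing.

Section DagTransform.
Variables (R : realType) (m n : nat).
Local Notation V := 'rV[R]_m.
Local Notation Cl := (clifford R m).
Hypotheses (m2 : (2 < m)%N) (mn : m = n.+2).
Variables (Omega : set V) (g : V -> Cl).
Hypothesis mO : vset Omega.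
Local Notation cut := (cut Omega g).
Hypothesis dens : forall A, exists delta C D : R,
  [/\ 0 < delta, delta < 1 & density delta C D (cut A)].
Variables (phi psi : 'I_m -> V) (mu lambda : R).
Hypotheses (sphi : structural_set phi) (spsi : structural_set psi).
Hypotheses (mu0 : mu != 0) (ml0 : 2 * mu + lambda != 0).
Local Notation P := (cl_potential Omega g).
Local Notation Tg := (teodorescu_dag Omega phi psi mu lambda g).
Local Notation dag := (dag_coef phi psi mu lambda).

Let n0 : (0 < n)%N. Proof. by move: m2; rewrite mn. Qed.

Definition dag_partial (b : 'I_m) (x : V) : Cl :=
  \sum_j \sum_k dag j k (- P (dmoment j k b) x).

Lemma TgE : Tg = fun x => \sum_j \sum_k dag j k (P (moment j k) x).
Proof. by apply/funext => x; exact: (teodorescu_dagE m2 mn mO dens). Qed.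

Lemma ccont_lin2 (F : 'I_m -> 'I_m -> V -> Cl) x : (forall j k, ccont (F j k) x) ->
  ccont (fun y => \sum_j \sum_k dag j k (F j k y)) x.
Proof.
move=> Fc; apply: (@ccont_lin R m 'I_m (fun _ X => X)) => j; first exact: cl_linear_id.
by apply: ccont_lin => k; [exact: cl_linear_dag | exact: Fc].
Qed.

Lemma cderive_lin2 (F : 'I_m -> 'I_m -> V -> Cl) (d : 'I_m -> 'I_m -> Cl) x b :
  (forall j k, cderive (F j k) x b (d j k)) ->
  cderive (fun y => \sum_j \sum_k dag j k (F j k y)) x b (\sum_j \sum_k dag j k (d j k)).
Proof.
move=> Fd; apply: (@cderive_lin R m 'I_m (fun _ X => X)) => j; first exact: cl_linear_id.
by apply: cderive_lin => k; [exact: cl_linear_dag | exact: Fd].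
Qed.

Lemma moment_derive A j k x :
  (forall v, is_derive x v (potential (moment j k) (cut A))
     (\sum_i v 0 i * - potential (dmoment j k i) (cut A) x)) /\
  {for x, continuous (potential (moment j k) (cut A))}.
Proof.
have [delta [C [D [d0 d1 hd]]]] := dens A.
exact: (potential_derive mn n0 d0 d1 (riesz_moment R j k mn)
  (fun i => riesz_dmoment R j k i mn) (fun z v => @is_derive_moment R m m2 j k z v) hd x).
Qed.

Lemma ccont_dmoment j k b x : ccont (fun y => - P (dmoment j k b) y) x.
Proof.
move=> A; have [delta [C [D [d0 d1 hd]]]] := dens A.
rewrite (_ : (fun y => _) = fun y => - potential (dmoment j k b) (cut A) y); last first.
  by apply/funext => y; rewrite cl_oppE ffunE.
apply: continuousN.
by have := potential_continuous mn (ltn0Sn n) d0 d1 (riesz_dmoment R j k b mn) hd; exact.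
Qed.

Lemma ccont_dag x : ccont Tg x.
Proof.
rewrite TgE; apply: ccont_lin2 => j k A.
rewrite (_ : (fun y => _) = potential (moment j k) (cut A)); first exact: (moment_derive A j k x).2.
by apply/funext => y; rewrite ffunE.
Qed.

Lemma cderive_dag x b : cderive Tg x b (dag_partial b x).
Proof.
rewrite TgE; apply: cderive_lin2 => j k A.
rewrite (_ : (fun y => _) = potential (moment j k) (cut A)); last first.
  by apply/funext => y; rewrite ffunE.
by have := (moment_derive A j k x).1 (delta_mx 0 b); rewrite sum_delta cl_oppE ffunE.
Qed.

Lemma pderiv_dag b : pderiv b Tg = dag_partial b.
Proof. by apply/funext => x; apply: pderivE; exact: cderive_dag. Qed.

Lemma ccont_dag_partial b x : ccont (dag_partial b) x.
Proof. by apply: ccont_lin2 => j k; exact: ccont_dmoment. Qed.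

(** Where the density is C^1 the transform is C^2 and inverts the operator. *)
Lemma dag_C2_near x0 : (forall A, C1_near (cut A) x0) ->
  [/\ forall a b, cderive (dag_partial b) x0 a (pderiv a (dag_partial b) x0),
      forall a b, ccont (pderiv a (dag_partial b)) x0 &
      lame_op phi psi mu lambda Tg x0 = [ffun A => cut A x0]].
Proof.
move=> loc.
have /choice[r rP] A : exists r : R, 0 < r /\
    exists S : 'I_m -> 'I_m -> 'I_m -> 'I_m -> V -> R,
  [/\ forall x, enorm (x - x0) < r -> forall a b j k,
        is_derive x (delta_mx 0 a) (fun x => - potential (dmoment j k b) (cut A) x) (S a b j k x)
        /\ {for x, continuous (S a b j k)},
      forall a b j k, S a b j k x0 = S b a j k x0,
      forall a b j k, S a b j k x0 = S a j b k x0,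
      forall a b j k, S a b j k x0 = S a b k j x0 &
      \sum_a \sum_b S a a b b x0 = - (2 * cut A x0)].
  have [delta [C [D [d0 d1 hd]]]] := dens A.
  by have [r r0 h] := elastic_potential m2 mn d0 d1 hd (loc A); exists r.
have r0 A := (rP A).1; have /choice[S SP] A := (rP A).2.
pose T a b j k x : Cl := [ffun A => S A a b j k x].
pose rho := \big[Num.min/1]_A r A.
have rho0 : 0 < rho by apply/bigmin_gtP; split.
have TP x (xr : enorm (x - x0) < rho) a b j k :
    cderive (fun y => - P (dmoment j k b) y) x a (T a b j k x) /\ ccont (T a b j k) x.
  have xA A : enorm (x - x0) < r A by apply: lt_le_trans xr _; exact: bigmin_le.
  split => A; have [h _ _ _ _] := SP A; have [h1 h2] := h x (xA A) a b j k.
    rewrite ffunE (_ : (fun y => _) = fun y => - potential (dmoment j k b) (cut A) y)//.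
    by apply/funext => y; rewrite cl_oppE ffunE.
  rewrite (_ : (fun y => _) = S A a b j k)//.
  by apply/funext => y; rewrite ffunE.
pose D2 a b x := \sum_j \sum_k dag j k (T a b j k x).
have DP x (xr : enorm (x - x0) < rho) a b : cderive (dag_partial b) x a (D2 a b x).
  by apply: cderive_lin2 => j k; exact: (TP x xr a b j k).1.
have x00 : enorm (x0 - x0) < rho by rewrite subrr enorm0.
split=> [a b|a b|].
- by rewrite (pderivE (DP x0 x00 a b)); exact: DP.
- apply: (@ccont_local R m (D2 a b) _ x0 rho rho0) => [y yr|].
    by rewrite (pderivE (DP y yr a b)).
  by apply: ccont_lin2 => j k; exact: (TP x0 x00 a b j k).2.
have Tg2 a b : cderive (pderiv b Tg) x0 a (D2 a b x0) by rewrite pderiv_dag; exact: DP.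
rewrite (lame_opE _ _ _ _ Tg2).
rewrite lame_dag_coef//.
- apply/ffunP => A; have [_ _ _ _ tr] := SP A.
  rewrite cl_oppE cl_scaleE cl_sumE ffunE.
  under eq_bigr => a _.
    rewrite cl_sumE; under eq_bigr => b _ do rewrite ffunE; over.
  by rewrite tr mulrN opprK mulrA mulVf ?mul1r.
- by move=> a b j k; apply/ffunP => A; rewrite !ffunE; have [_ h _ _ _] := SP A.
- by move=> a b j k; apply/ffunP => A; rewrite !ffunE; have [_ _ h _ _] := SP A.
- by move=> a b j k; apply/ffunP => A; rewrite !ffunE; have [_ _ _ h _] := SP A.
Qed.

Lemma vanishes_potential k K : (0 < k)%N -> riesz k K -> vanishes_at_infinity (P K).
Proof.
move=> k0 Kk; apply/vanishesP => A e e0; have [delta [C [D [d0 d1 [hi hD _]]]]] := dens A.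
have [r rP] := potential_vanishes k0 Kk hi hD e0.
by exists r => x /rP; rewrite ffunE.
Qed.

Lemma vanishes_lin2 (F : 'I_m -> 'I_m -> V -> Cl) :
  (forall j k, vanishes_at_infinity (F j k)) ->
  vanishes_at_infinity (fun x => \sum_j \sum_k dag j k (F j k x)).
Proof.
move=> Fv; apply: (@vanishes_lin R m 'I_m (fun _ X => X)) => j; first exact: cl_linear_id.
by apply: vanishes_lin => k; [exact: cl_linear_dag | exact: Fv].
Qed.

Lemma vanishes_dag : vanishes_at_infinity Tg.
Proof.
rewrite TgE; apply: vanishes_lin2 => j k.
exact: (vanishes_potential n0 (riesz_moment R j k mn)).
Qed.

Lemma vanishes_M_dag : vanishes_at_infinity (M_op psi mu lambda Tg).
Proof.
rewrite (_ : M_op _ _ _ _ = fun x => \sum_b M_coef psi mu lambda b (dag_partial b x)).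
  apply: vanishes_lin => b; first exact: cl_linear_M.
  apply: vanishes_lin2 => j k; have h := vanishes_potential (ltn0Sn n) (riesz_dmoment R j k b mn).
  by move=> e /h[r rP]; exists r => x /rP; rewrite /cnorm; under [in X in _ -> X]eq_bigr do rewrite cl_oppE sqrrN.
by apply/funext => x; rewrite M_opE; under eq_bigr do rewrite pderiv_dag.
Qed.

Lemma ccont_M_dag x : ccont (M_op psi mu lambda Tg) x.
Proof.
rewrite (_ : M_op _ _ _ _ = fun x => \sum_b M_coef psi mu lambda b (dag_partial b x)).
  by apply: ccont_lin => b; [exact: cl_linear_M | exact: ccont_dag_partial].
by apply/funext => y; rewrite M_opE; under eq_bigr do rewrite pderiv_dag.
Qed.

End DagTransform.

(** * The jump problem *)

Section Jump.
Variables (R : realType) (m : nat).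
Local Notation V := 'rV[R]_m.
Local Notation Cl := (clifford R m).

Lemma cnormN (X : Cl) : cnorm (- X) = cnorm X.
Proof. by rewrite /cnorm; congr Num.sqrt; apply: eq_bigr => A _; rewrite cl_oppE sqrrN. Qed.

(** Otherwise the domain would be open and closed, and its trace on a line through
   one of its points would be the whole line. *)
Lemma boundary_neq0 (Omega : set V) (D : R) : (0 < m)%N -> open Omega -> Omega !=set0 ->
  (forall y, Omega y -> enorm y <= D) -> boundary Omega !=set0.
Proof.
move=> m0 oO [x0 Ox0] OD; apply/set0P/negP => /eqP bd0.
have cO : closed Omega.
  move=> y cy; apply: contrapT => Oy.
  have : boundary Omega y by split => // /interior_subset.
  by rewrite bd0.
pose e_ : V := delta_mx 0 (Ordinal m0).
pose f (t : R) : V := x0 + t *: e_.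
have cf : continuous f.
  move=> t; apply: cvgD; first exact: cvg_cst.
  by apply: cvgZr_tmp; exact: cvg_id.
have : f @^-1` Omega = [set: R].
  have /connected_intervalP cR : is_interval [set: R] by [].
  apply: cR.
  - by exists 0; rewrite /= /f scale0r addr0.
  - by exists (f @^-1` Omega); [exact: open_comp | rewrite setTI].
  - by exists (f @^-1` Omega); [exact: closed_comp | rewrite setTI].
move=> /seteqP[_ /(_ (`|D| + enorm x0 + 1) I)] /OD.
set t := _ + 1; rewrite /f => h.
have t0 : 0 <= t by rewrite !addr_ge0// enorm_ge0.
have := ler_enormB (t *: e_) (- x0); rewrite opprK enormN addrC enormZ enorm_delta mulr1.
rewrite ger0_norm//; have := ler_norm D; rewrite (addrC (t *: e_)); move: h; rewrite /t; lra.
Qed.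

Lemma side_limit (U : set V) (F H : V -> Cl) x :
  (forall z, U z -> F z = H z) -> ccont H x -> has_side_limit U F x (H x).
Proof.
move=> FH cH A; have h : H z A @[z --> within U (nbhs x)] --> H x A.
  by apply: cvg_within_filter; exact: cH.
apply: cvg_trans h; apply: near_eq_cvg; apply: filterS (withinT _ _) => z Uz.
by rewrite /= FH.
Qed.

Variables (phi psi : 'I_m -> V) (mu lambda : R).
Local Notation lame := (lame_op phi psi mu lambda).
Local Notation coef := (lame_coef phi psi mu lambda).

Lemma lame_class_C2 (W : set V) f x : class_C 2 W f -> W x ->
  lame f x = \sum_a \sum_b coef a b (pderiv a (pderiv b f) x).
Proof.
move=> f2 Wx; apply: lame_opE => a b.
exact: class_C_derive (class_C_pderiv b f2) Wx.
Qed.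

Definition lame_partial f (i : 'I_m) (x : V) : Cl :=
  \sum_a \sum_b coef a b (pderiv i (pderiv a (pderiv b f)) x).

Lemma lame_class_C3 (W : set V) f x : open W -> class_C 3 W f -> W x ->
  ccont (lame f) x /\ forall i, cderive (lame f) x i (lame_partial f i x) /\
    ccont (lame_partial f i) x.
Proof.
move=> oW f3 Wx; have f2 : class_C 2 W f by exact: class_C_le f3.
have [r r0 rW] := open_enormP oW Wx.
have E y : enorm (y - x) < r -> \sum_a \sum_b coef a b (pderiv a (pderiv b f) y) = lame f y.
  by move=> /rW Wy; rewrite (lame_class_C2 f2 Wy).
have lin2c (F : 'I_m -> 'I_m -> V -> Cl) : (forall a b, ccont (F a b) x) ->
    ccont (fun y => \sum_a \sum_b coef a b (F a b y)) x.
  move=> Fc; apply: (@ccont_lin R m 'I_m (fun _ X => X)) => a; first exact: cl_linear_id.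
  by apply: ccont_lin => b; [exact: cl_linear_lame | exact: Fc].
have d2 a b := class_C_pderiv a (class_C_pderiv b f3).
split.
  apply: (ccont_local r0 E); apply: lin2c => a b; exact: class_C_cont (d2 a b) Wx.
move=> i; split; last first.
  by apply: lin2c => a b; exact: class_C_cont (class_C_pderiv i (d2 a b)) Wx.
apply: (cderive_local r0 E).
apply: (@cderive_lin R m 'I_m (fun _ X => X)) => a; first exact: cl_linear_id.
apply: cderive_lin => b; first exact: cl_linear_lame.
exact: class_C_derive (d2 a b) Wx.
Qed.

Lemma cut_near (Omega W : set V) (f : V -> Cl) A x0 : open W -> W x0 ->
  W `<=` Omega /\ class_C 3 W f \/ W `<=` ~` Omega ->
  C1_near (cut Omega (lame f) A) x0.
Proof.
move=> oW Wx0 [[WO f3]|WO]; have [r r0 rW] := open_enormP oW Wx0.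
  apply: (@partials_C1_near R m _ (fun i y => lame_partial f i y A) x0 r r0) => y /rW Wy.
  have [s s0 sW] := open_enormP oW Wy.
  have E z : enorm (z - y) < s -> lame f z A = cut Omega (lame f) A z.
    by move=> /sW/WO Oz; rewrite /cut indicE mem_set// mul1r.
  have [c1 c2] := lame_class_C3 oW f3 Wy.
  split; first exact: (continuous_local s0 E (c1 A)).
  move=> i; have [d1 cd1] := c2 i; split; last exact: cd1.
  exact: (is_derive_local s0 E (d1 A)).
apply: (@partials_C1_near R m _ (fun _ _ => 0) x0 r r0) => y /rW Wy.
have [s s0 sW] := open_enormP oW Wy.
have E z : enorm (z - y) < s -> 0 = cut Omega (lame f) A z.
  by move=> /sW/WO Oz; rewrite /cut indicE memNset// mul0r.
split; first by apply: (@continuous_local R m (fun=> 0) _ y s s0 E); exact: continuous_const.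
move=> i; split; last exact: continuous_const.
by apply: (@is_derive_local R m (fun=> 0) _ y _ _ s s0 E).
Qed.

Lemma lame_bound (W G : set V) f (nu c : R) : class_C 2 W f ->
  (forall i j x, W x -> cnorm (pderiv i (pderiv j f) x) <= c * dist_to x G `^ (nu - 1)) ->
  exists c' : R, forall A x, W x -> `|lame f x A| <= c' * dist_to x G `^ (nu - 1).
Proof.
move=> f2 fc; have /choice[M MP] (p : 'I_m * 'I_m) : exists M : R, 0 <= M /\
    forall X A, `|coef p.1 p.2 X A| <= M * cnorm X.
  by have [M M0 MP] := cl_linear_bound (cl_linear_lame phi psi mu lambda p.1 p.2); exists M.
exists ((\sum_a \sum_b M (a, b)) * c) => A x Wx.
rewrite (lame_class_C2 f2 Wx) cl_sumE -mulrA mulr_suml.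
apply: (le_trans (ler_norm_sum _ _ _)); apply: ler_sum => a _.
rewrite cl_sumE mulr_suml; apply: (le_trans (ler_norm_sum _ _ _)); apply: ler_sum => b _.
have [M0 Mab] := MP (a, b); apply: (le_trans (Mab _ _)); apply: (ler_wpM2l M0).
exact: fc.
Qed.

(** On Omega and on its exterior the candidate solution is the difference of a
   smooth function, respectively the Whitney extension and 0, and the transform. *)
Lemma class_C2_sub (W : set V) f Tg (dT : 'I_m -> V -> Cl) F : open W -> class_C 2 W f ->
  (forall x, W x -> F x = f x - Tg x) ->
  (forall x, ccont Tg x) -> (forall x b, cderive Tg x b (dT b x)) ->
  (forall x b, ccont (dT b) x) ->
  (forall x a b, W x -> cderive (dT b) x a (pderiv a (dT b) x)) ->
  (forall x a b, W x -> ccont (pderiv a (dT b)) x) ->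
  [/\ class_C 2 W F, forall x, W x -> lame F x = lame f x - lame Tg x &
      forall x, W x -> M_op psi mu lambda F x = M_op psi mu lambda f x - M_op psi mu lambda Tg x].
Proof.
move=> oW f2 FE cT dTP cdT d2T cd2T.
have TE b : pderiv b Tg = dT b by apply/funext => x; apply: pderivE; exact: dTP.
have f1 b := class_C_pderiv b f2.
have f0 a b := class_C_pderiv a (f1 b).
have [F2 FP] : class_C 2 W F /\ forall x, W x ->
    (forall b, pderiv b F x = pderiv b f x - dT b x) /\
    (forall a b, cderive (pderiv b F) x a (pderiv a (pderiv b f) x - pderiv a (dT b) x)).
  apply: (@class_C2_intro R m W F (fun b x => pderiv b f x - dT b x)
    (fun a b x => pderiv a (pderiv b f) x - pderiv a (dT b) x)) => //.
  - move=> x Wx; have [r r0 rW] := open_enormP oW Wx.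
    have E y : enorm (y - x) < r -> f y - Tg y = F y by move=> /rW/FE ->.
    split; first exact: (ccont_local r0 E (ccontB (class_C_cont f2 Wx) (cT x))).
    by move=> b; exact: (cderive_local r0 E (cderiveB (class_C_derive b f2 Wx) (dTP x b))).
  - move=> x b Wx; split; first exact: ccontB (class_C_cont (f1 b) Wx) (cdT x b).
    by move=> a; exact: cderiveB (class_C_derive a (f1 b) Wx) (d2T x a b Wx).
  - by move=> x a b Wx; exact: ccontB (class_C_cont (f0 a b) Wx) (cd2T x a b Wx).
split => // x Wx; have [P1 P2] := FP x Wx.
  rewrite (lame_opE _ _ _ _ P2) (lame_class_C2 f2 Wx).
  rewrite (lame_opE (f := Tg) _ _ _ _ (D := fun a b => pderiv a (dT b) x)); last first.
    by move=> a b; rewrite TE; exact: d2T.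
  rewrite -sumrB; apply: eq_bigr => a _; rewrite -sumrB; apply: eq_bigr => b _.
  by rewrite /lame_coef !mulrBr mulrBl !scalerBr opprD addrACA.
rewrite !M_opE -sumrB; apply: eq_bigr => b _.
by rewrite P1 TE /M_coef mulrBl mulrBr !scalerBr opprD addrACA.
Qed.

End Jump.

Theorem theorem3 (R : realType) (m : nat) (phi psi : 'I_m -> 'rV[R]_m)
    (mu lambda : R) (Omega : set 'rV[R]_m) (d nu : R)
    (f : 'rV[R]_m -> clifford R m) (fj : 'I_m -> 'rV[R]_m -> clifford R m)
    (ft : 'rV[R]_m -> clifford R m) :
  (2 < m)%N ->
  structural_set phi -> structural_set psi ->
  0 < mu -> - (2 / 3) * mu < lambda ->
  domain Omega -> bounded_set Omega -> simply_connected Omega ->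
  m%:R - 1 < d -> d < m%:R -> d_summable d (boundary Omega) ->
  0 < nu -> nu < 1 -> d / m%:R < nu ->
  lip_jet nu (boundary Omega) f fj ->
  whitney_extension nu (boundary Omega) f fj ft ->
  let Lft := lame_op phi psi mu lambda ft in
  let F := fun x : 'rV[R]_m =>
    (\1_Omega x : R) *: ft x - teodorescu_dag Omega phi psi mu lambda Lft x in
  (forall x, teodorescu_dag_defined Omega phi psi Lft x) /\
  jump_solution phi psi mu lambda Omega f ft F.
Proof.
move=> m2 sphi spsi mu_gt0 la [oO _ O0] bO _ dm1 dm sumd nu0 nu1 dnu _.
move=> [[ft1 _] ftoo ftG _ [c fc]] Lft F.
have m0 : (0 < m)%N by lia.
have mn : m = m.-2.+2 by lia.
have muN0 : mu != 0 by rewrite gt_eqF.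
have mlN0 : 2 * mu + lambda != 0 by rewrite gt_eqF//; lra.
set G := boundary Omega in sumd ftoo ftG fc *.
set Um := ~` closure Omega.
have oUm : open Um by apply: closed_openC; exact: closed_closure.
have OG : Omega `<=` ~` G by move=> y Oy [_]; apply; exact: oO.
have UmG : Um `<=` ~` G by move=> y Uy [].
have UmO : Um `<=` ~` Omega by move=> y Uy Oy; apply: Uy; exact: subset_closure.
have [D OD] : exists D : R, forall y, Omega y -> enorm y <= D.
  have [M [_ MP]] := bO; exists (m%:R * (`|M| + 1)) => y Oy.
  apply: (le_trans (enorm_le_norm y)); apply: ler_wpM2l => //.
  by apply: MP => //; rewrite ltr_pwDr// ler_norm.
have G0 : G !=set0 by exact: boundary_neq0 m0 oO O0 OD.
have mO := vset_open oO.
have ftO k : class_C k Omega ft by move=> s sk A x /OG; exact: ftoo.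
have [c' Lc] := lame_bound phi psi mu lambda (ftO 2%N) (fun i j x Ox => fc i j x (OG x Ox)).
have dens A : exists delta C D : R,
    [/\ 0 < delta, delta < 1 & density delta C D (cut Omega Lft A)].
  have [|||||delta [C h]] := @tube_density R m d nu c' D G Omega (cut Omega Lft A) _ _ dm nu0 nu1 dnu sumd G0 mO OD.
  - by lia.
  - have : 2 < m%:R :> R by rewrite ltr_nat.
    by lra.
  - have := @vmeas_patch R m Omega (fun y => Lft y A) oO; rewrite (_ : _ \_ _ = cut Omega Lft A).
      by apply => y Oy; have [h _] := lame_class_C3 phi psi mu lambda oO (ftO 3%N) Oy; exact: h.
    apply/funext => y; rewrite patchE /cut indicE.
    by case: ifP => _; rewrite ?mul1r ?mul0r.
  - by move=> y Oy; rewrite /cut indicE memNset// mul0r.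
  - by move=> y Oy; rewrite /cut indicE mem_set// mul1r; exact: Lc.
  by exists delta, C, D.
set Tg := teodorescu_dag Omega phi psi mu lambda Lft in F *.
have near x : (Omega `|` Um) x -> forall A, C1_near (cut Omega Lft A) x.
  case=> Wx A.
    by apply: (@cut_near R m phi psi mu lambda Omega Omega ft A x oO Wx); left; split => //; exact: ftO.
  by apply: (@cut_near R m phi psi mu lambda Omega Um ft A x oUm Wx); right.
pose dT := dag_partial Omega Lft phi psi mu lambda.
have cT x : ccont Tg x by exact: (ccont_dag m2 mn mO dens).
have dTP x b : cderive Tg x b (dT b x) by exact: (cderive_dag m2 mn mO dens).
have cdT x b : ccont (dT b) x by exact: (ccont_dag_partial mn dens).
have d2 x Wx := dag_C2_near m2 mn mO dens sphi spsi muN0 mlN0 (near x Wx).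
have inO x : Omega x -> F x = ft x - Tg x.
  by move=> Ox; rewrite /F indicE mem_set// scale1r.
have inUm x : Um x -> F x = 0 - Tg x.
  by move=> /UmO Ox; rewrite /F indicE memNset// scale0r.
have pz b : pderiv b (fun=> 0 : clifford R m) = fun=> 0.
  apply/funext => x; apply: pderivE => A; rewrite ffunE; apply/is_deriveP => e e0; exists 1 => // t _ _.
  by rewrite mulr0 !subr0 normr0 mulr_ge0// ltW.
have zC2 : class_C 2 Um (fun=> 0 : clifford R m).
  have z s : pderivs s (fun=> 0 : clifford R m) = fun=> 0.
    by elim: s => [//|j s IH]; rewrite /= IH pz.
  move=> s _ A x _; rewrite z; split; first exact: continuous_const.
  by move=> _ j; exact: derivable_cst.
have [FO LO MO] := class_C2_sub phi psi mu lambda oO (ftO 2%N) inO cT dTP cdT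
  (fun x a b Ox => let: And3 h _ _ := d2 x (or_introl Ox) in h a b)
  (fun x a b Ox => let: And3 _ h _ := d2 x (or_introl Ox) in h a b).
have [FU LU MU] := class_C2_sub phi psi mu lambda oUm zC2 inUm cT dTP cdT
  (fun x a b Ox => let: And3 h _ _ := d2 x (or_intror Ox) in h a b)
  (fun x a b Ox => let: And3 _ h _ := d2 x (or_intror Ox) in h a b).
have Lz x : Um x -> lame_op phi psi mu lambda (fun=> 0) x = 0.
  move=> Ux; rewrite (lame_class_C2 _ _ _ _ zC2 Ux) big1// => a _; rewrite big1// => b _.
  by rewrite !pz /lame_coef !(mulr0, mul0r) !scaler0 addr0.
have Mz x : M_op psi mu lambda (fun=> 0) x = 0.
  by rewrite M_opE big1// => b _; rewrite pz /M_coef mul0r mulr0 !scaler0 addr0.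
have cM x : ccont (M_op psi mu lambda Tg) x by exact: (ccont_M_dag m2 mn mO dens).
have cMf x : ccont (M_op psi mu lambda ft) x.
  rewrite (_ : M_op _ _ _ _ = fun x => \sum_b M_coef psi mu lambda b (pderiv b ft x)).
    apply: ccont_lin => b; first exact: cl_linear_M.
    exact: class_C_cont (class_C_pderiv b ft1) I.
  by apply/funext => y; rewrite M_opE.
have cft x : ccont ft x by exact: class_C_cont ft1 I.
have c0 x : ccont (fun=> 0 : clifford R m) x.
  by move=> A; exact: continuous_const.
split; first exact: (teodorescu_dag_defined_cut m2 mn mO dens).
split.
- split.
    by move=> s sk A x [Ox|Ux]; [exact: FO | exact: FU].
  move=> x [Ox|Ux].
    have [_ _ Lx] := d2 x (or_introl Ox); rewrite (LO x Ox) Lx; apply/ffunP => A.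
    by rewrite cl_addE cl_oppE [X in _ - X]ffunE /cut indicE mem_set// mul1r subrr ffunE.
  have [_ _ Lx] := d2 x (or_intror Ux); rewrite (LU x Ux) Lz// Lx; apply/ffunP => A.
  by rewrite cl_addE cl_oppE [X in _ - X]ffunE /cut indicE memNset ?mul0r ?subr0//; exact: UmO.
- move=> x Gx; exists (ft x - Tg x), (0 - Tg x); split.
  + exact: (side_limit (H := fun x => ft x - Tg x)) inO (ccontB (cft x) (cT x)).
  + exact: (side_limit (H := fun x => 0 - Tg x)) inUm (ccontB (c0 x) (cT x)).
  + by rewrite opprB addrA subrK subr0 ftG.
- move=> x Gx; pose MT := M_op psi mu lambda Tg.
  exists (M_op psi mu lambda ft x - MT x), (0 - MT x); split.
  + exact: (side_limit (H := fun x => M_op psi mu lambda ft x - MT x)) MO (ccontB (cMf x) (cM x)).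
  + apply: (side_limit (H := fun x => 0 - MT x)) _ (ccontB (c0 x) (cM x)).
    by move=> z Uz; rewrite MU// Mz.
  + by rewrite opprB addrA subrK subr0.
- have far x : D < enorm x -> Um x.
    move=> xD cx; have [y [Oy]] : Omega `&` [set y | enorm (y - x) < enorm x - D] !=set0.
      by apply: cx; apply/nbhs_enormP; exists (enorm x - D); rewrite ?subr_gt0.
    by have := OD y Oy; have := ler_dist_enorm x y; rewrite ler_norml enormBC /=; lra.
  have vanish (H H' : 'rV[R]_m -> clifford R m) :
      (forall x, Um x -> H x = 0 - H' x) -> vanishes_at_infinity H' -> vanishes_at_infinity H.
    move=> HH' h' e e0; have [r rP] := h' e e0; exists (Num.max r D) => x.
    by rewrite gt_max => /andP[/rP xr /far/HH' ->]; rewrite sub0r cnormN.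
  have vT : vanishes_at_infinity Tg by exact: (vanishes_dag m2 mn mO dens).
  have vMT : vanishes_at_infinity (M_op psi mu lambda Tg) by exact: (vanishes_M_dag m2 mn mO dens).
  split; first exact: (vanish F Tg inUm vT).
  by apply: (vanish (M_op psi mu lambda F) (M_op psi mu lambda Tg) _ vMT) => x Ux; rewrite MU// Mz.
Qed.
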